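(* There exists $d_{**}>0$ such that for all $-d_{**}\le d<0$ the map $$u_{n+1}=v_n,\qquad v_{n+1}=2v_n-u_n+\frac1d\left(\mu v_n-2v_n^3+v_n^5\right)$$ has a $0$-loop of heteroclinic connections between the fixed points $(0,0)$ and $(U_+(\mu),U_+(\mu))$, where $U_+(\mu)=\sqrt{1+\sqrt{1-\mu}}$.
   Context: Here $\mu\in(0,1)$ is the bifurcation parameter. Bounded orbits $(u_n,v_n)=(U_{n-1},U_n)$ of the map correspond to stationary solutions of the lattice system $\dot U_n=d(U_{n+1}+U_{n-1}-2U_n)-\mu U_n+2U_n^3-U_n^5$, $n\in\mathbb{Z}$. Loops of heteroclinic connections. Let $J\subset(0,1)$ be a compact interval, let $S$ be the left shift $[Su]_n=u_{n+1}$ on bounded $\mathbb{R}^2$-valued sequences $\ell^\infty(\mathbb{Z})$, and consider the set of pairs $(u,\mu)\in\ell^\infty\times J$ such that $u$ is an orbit of the map at parameter $\mu$ with $u_n\to(0,0)$ as $n\to-\infty$ and $u_n\to(U_+(\mu),U_+(\mu))$ as $n\to+\infty$. Let $\Gamma$ be a connected component of this set, and let $\pi(u,\mu)=([u],\mu)$, where $[u]$ is the equivalence class of $u$ under $u\sim w\iff S^ku=w$ for some $k\in\mathbb{Z}$. Suppose $\pi(\Gamma)$ is a closed loop, i.e. it is parametrized by a smooth map $\gamma:[0,1]\to\pi(\Gamma)$ with $\gamma(0)=\gamma(1)$. Lift $\gamma$ to a smooth connected curve $(u(s),\mu(s))\in\Gamma$, $s\in[0,1]$, with $\pi(u(s),\mu(s))=\gamma(s)$.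 The curve is called a $0$-loop if $u(1)=u(0)$, and a $1$-loop if $S^ku(1)=u(0)$ for some integer $k\ne0$. *)

(* Defs.v *)
From HB Require Import structures.
From mathcomp Require Import all_boot all_order all_algebra.
From mathcomp Require Import all_classical all_reals topology normedtype derive.

Set Implicit Arguments.
Unset Strict Implicit.
Unset Printing Implicit Defensive.

Import Order.TTheory GRing.Theory Num.Theory.
Import numFieldNormedType.Exports.

Local Open Scope classical_set_scope.
Local Open Scope ring_scope.

(* R^2 carries the maximum norm. *)
Definition is_bounded_seq (R : realType) : {pred int -> R * R} :=
  [pred u | `[< exists M : R, forall n, `|u n| <= M >]].

Section BoundedClosed.
Variable R : realType.

Lemma is_bounded_seq_submod : submod_closed (@is_bounded_seq R).
Proof.
split=> [|a u v /asboolP[M uM] /asboolP[N vN]]; apply/asboolP.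
  by exists 0 => n; rewrite [X in `|X|](_ : _ = 0) ?normr0.
exists (`|a| * M + N) => n.
apply: (le_trans (ler_normD _ _)); apply: lerD => //.
by rewrite (@normrZ _ (R * R)%type) ler_wpM2l.
Qed.

HB.instance Definition _ :=
  GRing.isSubmodClosed.Build R (int -> R * R)%type (@is_bounded_seq R)
    is_bounded_seq_submod.

End BoundedClosed.

(* Bounded bi-infinite sequences in R^2, as a normed space with the supremum
   norm. *)
Record ellinf (R : realType) := Ellinf {
  ellinf_val :> int -> R * R;
  ellinf_boundedP : ellinf_val \in @is_bounded_seq R }.

Section EllinfNormed.
Variable R : realType.

HB.instance Definition _ := [isSub of ellinf R for @ellinf_val R].
HB.instance Definition _ := [Choice of ellinf R by <:].
HB.instance Definition _ := [SubChoice_isSubLmodule of ellinf R by <:].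

Definition sup_norm (u : ellinf R) : R := sup (range (fun n => `|u n|)).

Lemma has_sup_ellinf (u : ellinf R) : has_sup (range (fun n => `|u n|)).
Proof.
split; first by exists `|u 0|, 0.
by have /asboolP[M uM] := ellinf_boundedP u; exists M => _ [n _ <-].
Qed.

Lemma sup_norm_ge (u : ellinf R) n : `|u n| <= sup_norm u.
Proof. by apply: sup_upper_bound; [exact: has_sup_ellinf|exists n]. Qed.

Lemma sup_norm_le (u : ellinf R) (M : R) :
  (forall n, `|u n| <= M) -> sup_norm u <= M.
Proof.
move=> uM; apply: ge_sup; last by move=> _ [n _ <-].
by have [] := has_sup_ellinf u.
Qed.

Lemma sup_normD (u v : ellinf R) : sup_norm (u + v) <= sup_norm u + sup_norm v.
Proof.
apply: sup_norm_le => n; apply: (le_trans (ler_normD _ _)).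
by apply: lerD; exact: sup_norm_ge.
Qed.

Lemma sup_normZ (a : R) (u : ellinf R) : sup_norm (a *: u) = `|a| * sup_norm u.
Proof.
have Z (b : R) (v : ellinf R) : sup_norm (b *: v) <= `|b| * sup_norm v.
  apply: sup_norm_le => n; rewrite (@normrZ _ (R * R)%type).
  by rewrite ler_wpM2l//; exact: sup_norm_ge.
apply/eqP; rewrite eq_le Z /=; have [->|a0] := eqVneq a 0.
  rewrite normr0 mul0r; apply: le_trans (sup_norm_ge _ 0); exact: normr_ge0.
by rewrite -ler_pdivlMl ?normr_gt0// -normfV -[X in sup_norm X <= _](scalerK a0) Z.
Qed.

Lemma sup_norm0_eq0 (u : ellinf R) : sup_norm u = 0 -> u = 0.
Proof.
move=> u0; apply/val_inj/funext => n; apply/eqP.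
by rewrite -normr_eq0 eq_le normr_ge0 andbT -u0; exact: sup_norm_ge.
Qed.

HB.instance Definition _ :=
  @Lmodule_isNormed.Build R (ellinf R) sup_norm sup_normD sup_normZ sup_norm0_eq0.

Lemma shiftz_subproof (k : int) (u : ellinf R) :
  (fun n => u (n + k)) \in @is_bounded_seq R.
Proof. by have /asboolP[M uM] := ellinf_boundedP u; apply/asboolP; exists M. Qed.

(* The k-th iterate S^k, k in Z, of the left shift [S u]_n = u_(n+1). *)
Definition shiftz (k : int) (u : ellinf R) : ellinf R :=
  Ellinf (shiftz_subproof k u).

End EllinfNormed.

Section Heteroclinic.
Variable R : realType.
Implicit Types (d mu : R) (p : ellinf R * R).

Definition lattice_map d mu (x : R * R) : R * R :=
  (x.2, 2 * x.2 - x.1 + d^-1 * (mu * x.2 - 2 * x.2 ^+ 3 + x.2 ^+ 5)).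

Definition U_plus mu : R := Num.sqrt (1 + Num.sqrt (1 - mu)).

Definition is_orbit d mu (u : ellinf R) : Prop :=
  forall n : int, u (n + 1) = lattice_map d mu (u n).

Definition is_heteroclinic d mu (u : ellinf R) : Prop :=
  [/\ is_orbit d mu u,
      (fun n : nat => u (- n%:Z)) @ \oo --> ((0, 0) : R * R) &
      (fun n : nat => u n%:Z) @ \oo --> ((U_plus mu, U_plus mu) : R * R)].

(* The heteroclinic orbits with parameter in J = [a, b], as a subset of
   ell^infty x R; the topology it inherits is that of ell^infty x J. *)
Definition heteroclinic_set d (a b : R) : set (ellinf R * R) :=
  [set p | p.2 \in `[a, b] /\ is_heteroclinic d p.2 p.1].

Definition is_connected_component (T : topologicalType) (A C : set T) : Prop :=
  exists2 x, A x & C = connected_component A x.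

Definition shift_class (u : ellinf R) : set (ellinf R) :=
  [set w | exists k : int, shiftz k u = w].

Definition shift_proj p : set (ellinf R) * R := (shift_class p.1, p.2).

(* C^infty on the closed interval [0, 1], i.e., restriction to [0, 1] of a
   C^infty curve defined on the whole line. *)
Definition smooth_on01 (V : normedModType R) (c : R -> V) : Prop :=
  exists2 f : R -> V,
    (forall k s, derivable (f^`(k)%classic) s 1) & {in `[0, 1], f =1 c}.

(* Injectivity on [0, 1[ makes the parametrization traverse the loop once: it
   excludes constant maps and arcs run back and forth. *)
Definition parametrizes_loop (T : Type) (L : set T) (g : R -> T) : Prop :=
  [/\ g @` `[0, 1] = L, g 0 = g 1 & {in `[0, 1[ &, injective g}].

(* Smoothness of a map into the quotient by the shift is by definition
   smoothness of its lift, as the quotient has no other smooth structure. *)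
Definition smooth_lift (G : set (ellinf R * R))
    (g : R -> set (ellinf R) * R) (c : R -> ellinf R * R) : Prop :=
  [/\ smooth_on01 c,
      forall s, s \in `[0, 1] -> G (c s) &
      forall s, s \in `[0, 1] -> shift_proj (c s) = g s].

Definition has_0_loop d : Prop :=
  exists (a b : R) (G : set (ellinf R * R))
         (g : R -> set (ellinf R) * R) (c : R -> ellinf R * R),
  [/\ [/\ 0 < a, a < b & b < 1],
      is_connected_component (heteroclinic_set d a b) G,
      parametrizes_loop (shift_proj @` G) g,
      smooth_lift G g c &
      (c 1).1 = (c 0).1].

End Heteroclinic.

(* Main.v *)
(* Write d = - e^12, U_n for the second component of u_n, and look at sequences
   close to (..., 0, 0, -a, g, b, U_+, U_+, ...) with U_0 = -a and U_2 = b.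
   Given (a, b) in a rectangle, a contraction argument yields exactly one such
   sequence that solves the lattice equation at all sites n <= 0 with one value
   of mu and at all sites n >= 1 with another; orbits are the zeros of the
   difference [gap] of these two values. The gap is positive on the boundary of
   the rectangle, negative at (e^4, 1), and increasing at its zeros along every
   ray from (e^4, 1), so that its zero set is a star-shaped closed curve. It
   passes the two folds of the branch: site 0 goes from 0 to the middle root
   near mu = 0, and site 2 from U_+ to the middle root near mu = 1.

   The linearised problem, bordered by the ray condition, is bounded below
   uniformly along the curve; bootstrapping this bound gives Lipschitz
   continuity and then all derivatives. The contraction box absorbs every
   heteroclinic orbit near the curve, so the curve is relatively open in the
   set of connections, hence a connected component. *)

Require Import Defs.
From mathcomp Require Import all_boot all_order all_algebra ring lra zify.
From mathcomp Require Import all_classical all_reals topology normedtype derive.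
From mathcomp Require Import sequences exp trigo.

Set Implicit Arguments.
Unset Strict Implicit.
Unset Printing Implicit Defensive.

Import Order.TTheory GRing.Theory Num.Theory.
Import numFieldNormedType.Exports.

Local Open Scope classical_set_scope.
Local Open Scope ring_scope.

(** The powers of [e] are the scales of the two folds, and the twelfth root makes all of them
    integral. At site 0 the term [2 * a ^+ 2] balances [e ^+ 12 * g / a] when [a] is of order
    [e ^+ 4], with [mu] of order [e ^+ 8]. At the other end site 1 lacks a left neighbour near 1, so
    [U 1 - 1] is at least of order [e ^+ 6]; through the coupling at site 2 this keeps [1 - mu] at
    least of order [e ^+ 18], and the roots [x = U n ^+ 2 - 1] at least of order [e ^+ 9]. The
    obstacle is that for a prescribed [mu] the problem degenerates at both folds. Prescribing [a]
    and [b] instead, and eliminating [mu] through site 0 on the left and site 2 on the right, leaves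
    linear coefficients of order at least [e ^+ 8] and [e ^+ 9] against a coupling [e ^+ 12], so
    that the contraction has constant 1/2 through both folds. The value at site 0 is negative
    because [d < 0] reverses the pull of the neighbour [g]. *)

(** * Suprema, bootstrapping and a contraction principle *)

Section SupEstimates.
Variable R : realType.

(** The intervals of radius [k j] about [f j] meet pairwise, so they have a common point, the
    supremum of their left ends. This serves as completeness of the line with an explicit rate. *)
Lemma squeezed_value (J : Type) (f k : J -> R) (j0 : J) :
  (forall j j', `|f j - f j'| <= k j + k j') ->
  exists x, forall j, `|f j - x| <= k j.
Proof.
move=> fk; pose A := range (fun j => f j - k j).
have ubA j : ubound A (f j + k j).
  move=> _ [j' _ <-]; have := fk j' j; rewrite ler_norml => /andP[_]; lra.
have supA : has_sup A by split; [exists (f j0 - k j0), j0|exists (f j0 + k j0)].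
exists (sup A) => j; rewrite ler_norml; apply/andP; split.
  by have := ge_sup (proj1 supA) (ubA j); lra.
have : f j - k j <= sup A by apply: sup_upper_bound => //; exists j.
lra.
Qed.

Lemma le_sum_half_powers (a b C : R) :
  (forall m, a <= b + C * 2^-1 ^+ m) -> a <= b.
Proof.
move=> abC; apply/ler_addgt0Pr => e e0.
have [C0|C0] := leP C 0.
  by have := abC 0%N; rewrite expr0; lra.
have Cm := Num.Theory.upper_nthrootP (leqnn (Num.bound (C / e))).
apply: le_trans (abC (Num.bound (C / e))) _.
rewrite lerD2l exprVn ler_pdivrMr ?exprn_gt0//.
by move: Cm; rewrite ltr_pdivrMr// mulrC => /ltW.
Qed.

Lemma le_add_small (a b C eta : R) : 0 < eta ->
  (forall h, 0 < h < eta -> a <= b + C * h) -> a <= b.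
Proof.
move=> eta0 abC; apply: (@le_sum_half_powers _ _ (C * (eta / 2))) => m.
rewrite -mulrA; apply: abC; have m0 : 0 < 2^-1 ^+ m :> R by rewrite exprn_gt0// invr_gt0.
have m1 : 2^-1 ^+ m <= 1 :> R by apply: exprn_ile1; lra.
move: (_ ^+ m) m0 m1 => x x0 x1; apply/andP; split; nra.
Qed.

(** The supremum [S] of [|f|] satisfies [S <= S / 2 + c]. The a priori bound [B] makes [S] finite;
    the conclusion is independent of its size. *)
Lemma half_bootstrap (I : Type) (f : I -> R) (B c : R) :
  (forall i, `|f i| <= B) ->
  (forall M, (forall i, `|f i| <= M) -> forall i, `|f i| <= M / 2 + c) ->
  forall i, `|f i| <= 2 * c.
Proof.
move=> fB fM i; pose A := range (fun i => `|f i|).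
have supA : has_sup A by split; [exists (`|f i|), i|exists B => _ [j _ <-]].
have leA j : `|f j| <= sup A by apply: sup_upper_bound => //; exists j.
have : sup A <= sup A / 2 + c.
  by apply: ge_sup (proj1 supA) _ => _ [j _ <-]; exact: fM.
have := leA i; lra.
Qed.

(** Banach's theorem on a product of intervals in the supremum distance. The iteration starts at
    [lo], and the bound [B] on the widths makes its first step bounded over all indices. *)
Lemma half_contraction_fixpoint (I : Type) (lo hi : I -> R) (B : R)
    (T : (I -> R) -> I -> R) (K := fun u => forall i, lo i <= u i <= hi i) :
  (forall i, lo i <= hi i) -> (forall i, hi i - lo i <= B) ->
  (forall u, K u -> K (T u)) ->
  (forall u v, K u -> K v -> forall M : R, (forall i, `|u i - v i| <= M) ->
     forall i, `|T u i - T v i| <= M / 2) ->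
  exists2 u, K u & forall i, T u i = u i.
Proof.
move=> lohi hiB TK Tc; have [|i0] := pselect (inhabited I); last first.
  by exists lo => i; exfalso; apply: i0; exists.
move=> -[i0]; have B0 : 0 <= B by have := lohi i0; have := hiB i0; lra.
pose u m := iter m T lo.
have uK m : K (u m).
  elim: m => [i|m IH]; [by rewrite lexx lohi|exact: TK].
have du m i : `|u m.+1 i - u m i| <= B * 2^-1 ^+ m.
  elim: m i => [i|m IH i].
    rewrite expr0 mulr1 ler_norml; have /andP[] := uK 1%N i; have := hiB i.
    rewrite /u /=; lra.
  rewrite exprSr mulrA; apply: (Tc _ _ (uK m.+1) (uK m)) => j; exact: IH.
have dun m n i : (m <= n)%N -> `|u n i - u m i| <= 2 * B * 2^-1 ^+ m - 2 * B * 2^-1 ^+ n.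
  elim: n => [|n IH]; first by rewrite leqn0 => /eqP ->; rewrite !subrr normr0.
  rewrite leq_eqVlt => /predU1P[->|]; first by rewrite !subrr normr0.
  rewrite ltnS => /IH h; have := du n i.
  rewrite exprSr; move: h; rewrite !ler_norml => /andP[? ?] /andP[? ?].
  by apply/andP; split; lra.
have half0 n : 0 <= B * 2^-1 ^+ n by rewrite mulr_ge0// exprn_ge0// invr_ge0.
have xP i : exists x, forall m, `|u m i - x| <= 2 * B * 2^-1 ^+ m.
  apply: (squeezed_value 0%N) => m n; case: (leqP m n) => [mn|/ltnW mn].
    rewrite distrC; apply: le_trans (dun _ _ _ mn) _.
    by have := half0 n; have := half0 m; lra.
  apply: le_trans (dun _ _ _ mn) _.
  by have := half0 n; have := half0 m; lra.
have [x {}xP] := choice xP.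
have xK : K x.
  move=> i; apply/andP; split; apply: (@le_sum_half_powers _ _ (2 * B)) => m;
    have := xP i m; have /andP[? ?] := uK m i; rewrite ler_norml => /andP[? ?]; lra.
exists x => // i; apply/eqP; rewrite -subr_eq0 -normr_le0.
apply: (@le_sum_half_powers _ _ (2 * B)) => m; rewrite add0r.
have xm j : `|x j - u m j| <= 2 * B * 2^-1 ^+ m by rewrite distrC.
have := Tc _ _ xK (uK m) _ xm i.
have := xP i m.+1; rewrite /= -/(u m) exprSr !ler_norml => /andP[? ?] /andP[? ?].
by apply/andP; split; lra.
Qed.

End SupEstimates.

(** * Families of functions smooth in a real parameter, uniformly in the index *)

Section SmoothFamilies.
Variable R : realType.
Implicit Types (I J : Type).

Lemma sqr_normr (x : R) : `|x| ^+ 2 = x ^+ 2.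
Proof. by rewrite real_normK ?num_real. Qed.

Definition bounded_family I (x : R -> I -> R) :=
  exists B : R, forall t i, `|x t i| <= B.

(* [k] successive derivatives in [t], uniformly in the index; quadratic
   remainders make every later argument an inequality without limits. *)
Fixpoint smooth_family k I (x : R -> I -> R) : Prop :=
  bounded_family x /\
  if k is k'.+1 then
    exists2 x', smooth_family k' x' &
      exists B : R, forall t h i, `|x (t + h) i - x t i - h * x' t i| <= B * h ^+ 2
  else exists L : R, forall t h i, `|x (t + h) i - x t i| <= L * `|h|.

Lemma smooth_family_bounded k I (x : R -> I -> R) :
  smooth_family k x -> bounded_family x.
Proof. by case: k => [|k] []. Qed.

(** For [|h| <= 1] the Taylor remainder gives the bound; for larger [h] the bound on [x] itself
    does. *)
Lemma smooth_family_lipschitz k I (x : R -> I -> R) :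
  smooth_family k x -> exists L : R, forall t h i, `|x (t + h) i - x t i| <= L * `|h|.
Proof.
case: k => [|k] [] // [B xB] [x' /smooth_family_bounded[B' xB'] [C xC]].
exists (2 * B + B' + C) => t h i.
have := xB t i; have := xB (t + h) i; have := xC t h i; have := xB' t i.
have h0 : 0 <= `|h| by []; have B0 : 0 <= B := le_trans (normr_ge0 _) (xB 0 i).
have B'0 : 0 <= B' := le_trans (normr_ge0 _) (xB' 0 i).
have C0 : 0 <= C.
  have := le_trans (normr_ge0 _) (xC 0 1 i); lra.
have [h1|h1] := leP `|h| 1 => x'B xx xth xt.
  have hx : `|h * x' t i| <= `|h| * B' by rewrite normrM ler_wpM2l.
  have : `|x (t + h) i - x t i| <= C * h ^+ 2 + `|h| * B'.
    apply: le_trans (lerD xx hx); rewrite -[X in `|X| <= _](subrK (h * x' t i)).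
    exact: ler_normD.
  move/le_trans; apply; rewrite -sqr_normr.
  have h2 : `|h| ^+ 2 <= `|h| by rewrite expr2 ler_piMr.
  have := ler_wpM2l C0 h2; have := mulr_ge0 B0 h0; lra.
have : `|x (t + h) i - x t i| <= 2 * B.
  apply: le_trans (ler_normB _ _) _; lra.
move/le_trans; apply; have := ler_wpM2l B0 (ltW h1).
by have := mulr_ge0 B'0 h0; have := mulr_ge0 C0 h0; lra.
Qed.

Lemma smooth_familyW k I (x : R -> I -> R) :
  smooth_family k.+1 x -> smooth_family k x.
Proof.
elim: k I x => [|k IH] I x xk.
  by split; [exact: smooth_family_bounded xk|exact: smooth_family_lipschitz xk].
by have [xB [x' /IH x'k xx']] := xk; split=> //; exists x'.
Qed.

Lemma smooth_family0 k I (x : R -> I -> R) :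
  smooth_family k x -> smooth_family 0 x.
Proof. by elim: k => // k IH /smooth_familyW. Qed.

Lemma smooth_family_cst k I (a : I -> R) B :
  (forall i, `|a i| <= B) -> smooth_family k (fun=> a).
Proof.
elim: k a B => [|k IH] a B aB; (split; first by exists B).
  by exists 0 => t h i; rewrite subrr normr0 mul0r.
exists (fun=> fun=> 0); first by apply: (IH _ 0) => i; rewrite normr0.
by exists 0 => t h i; rewrite subrr mulr0 subr0 normr0 mul0r.
Qed.

Lemma smooth_family_ext k I (x y : R -> I -> R) :
  (forall t i, x t i = y t i) -> smooth_family k x -> smooth_family k y.
Proof. by move=> xy; have -> : y = x by apply/funext => t; apply/funext => i. Qed.

Lemma smooth_familyD k I (x y : R -> I -> R) :
  smooth_family k x -> smooth_family k y ->
  smooth_family k (fun t i => x t i + y t i).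
Proof.
elim: k x y => [|k IH] x y [[B xB] xx] [[C yC] yy]; split.
- by exists (B + C) => t i; apply: le_trans (ler_normD _ _) (lerD _ _).
- have [[L xL] [N yN]] := (xx, yy); exists (L + N) => t h i.
  by rewrite opprD addrACA mulrDl; apply: le_trans (ler_normD _ _) (lerD _ _).
- by exists (B + C) => t i; apply: le_trans (ler_normD _ _) (lerD _ _).
have [[x' x'k [L xL]] [y' y'k [N yN]]] := (xx, yy).
exists (fun t i => x' t i + y' t i); first exact: IH.
exists (L + N) => t h i; rewrite mulrDl.
apply: le_trans (lerD (xL t h i) (yN t h i)); apply: le_trans (ler_normD _ _).
by rewrite le_eqVlt; apply/orP; left; apply/eqP; congr `|_|; ring.
Qed.

Lemma smooth_familyM k I (x y : R -> I -> R) :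
  smooth_family k x -> smooth_family k y ->
  smooth_family k (fun t i => x t i * y t i).
Proof.
elim: k x y => [|k IH] x y xk yk.
  have [[B xB] [L xL]] := xk; have [[C yC] [N yN]] := yk; split.
    by exists (B * C) => t i; rewrite normrM ler_pM.
  exists (L * C + B * N) => t h i.
  rewrite (_ : _ - _ = (x (t + h) i - x t i) * y (t + h) i
    + x t i * (y (t + h) i - y t i)); last by ring.
  apply: le_trans (ler_normD _ _) _; rewrite !normrM mulrDl.
  apply: lerD; first by rewrite mulrAC ler_pM.
  by rewrite -mulrA ler_pM.
have [L xL] := smooth_family_lipschitz xk; have [N yN] := smooth_family_lipschitz yk.
have xk' := smooth_familyW xk; have yk' := smooth_familyW yk.
have [[B xB] [x' x'k [D xD]]] := xk; have [[C yC] [y' y'k [E yE]]] := yk; split.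
  by exists (B * C) => t i; rewrite normrM ler_pM.
exists (fun t i => x' t i * y t i + x t i * y' t i).
  by apply: smooth_familyD; apply: IH.
exists (D * C + B * E + L * N) => t h i.
(* The last summand is a product of two increments, quadratic in [h] by the Lipschitz bounds. *)
rewrite (_ : _ - _ = (x (t + h) i - x t i - h * x' t i) * y t i
  + x t i * (y (t + h) i - y t i - h * y' t i)
  + (x (t + h) i - x t i) * (y (t + h) i - y t i)); last by ring.
apply: le_trans (ler_normD _ _) _; rewrite [leRHS]mulrDl [X in _ <= X + _]mulrDl.
apply: lerD.
  apply: le_trans (ler_normD _ _) _; rewrite !normrM; apply: lerD.
    by rewrite mulrAC ler_pM.
  by rewrite -mulrA ler_pM.
rewrite normrM -sqr_normr expr2 mulrACA.
by rewrite ler_pM.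
Qed.

Lemma smooth_family_reindex k I J (s : J -> I) (x : R -> I -> R) :
  smooth_family k x -> smooth_family k (fun t j => x t (s j)).
Proof.
elim: k I x s => [|k IH] I x s [[B xB] xx]; (split; first by exists B).
  by have [L xL] := xx; exists L.
have [x' x'k [C xC]] := xx; exists (fun t j => x' t (s j)); first exact: IH.
by exists C.
Qed.

Lemma smooth_family_sum k I J (x : R -> I -> R) (y : R -> J -> R) :
  smooth_family k x -> smooth_family k y ->
  smooth_family k (fun t ij => match ij with inl i => x t i | inr j => y t j end).
Proof.
elim: k x y => [|k IH] x y [[B xB] xx] [[C yC] yy]; split;
  try by exists (Num.max B C) => t [i|j]; rewrite le_max ?xB ?yC ?orbT.
  have [[L xL] [N yN]] := (xx, yy); exists (Num.max L N) => t h [i|j].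
    by apply: le_trans (xL t h i) _; rewrite ler_wpM2r// le_max lexx.
  by apply: le_trans (yN t h j) _; rewrite ler_wpM2r// le_max lexx orbT.
have [[x' x'k [L xL]] [y' y'k [N yN]]] := (xx, yy).
exists (fun t ij => match ij with inl i => x' t i | inr j => y' t j end).
  exact: IH.
exists (Num.max L N) => t h [i|j]; have h2 := sqr_ge0 h.
  by apply: le_trans (xL t h i) _; rewrite ler_wpM2r// le_max lexx.
by apply: le_trans (yN t h j) _; rewrite ler_wpM2r// le_max lexx orbT.
Qed.

Lemma smooth_family_bigsum k I N (x : 'I_N -> R -> I -> R) :
  (forall l, smooth_family k (x l)) ->
  smooth_family k (fun t i => \sum_(l < N) x l t i).
Proof.
elim: N x => [|N IH] x xk.
  apply: smooth_family_ext (@smooth_family_cst k I (fun=> 0) 0 _) => [t i|i].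
    by rewrite big_ord0.
  by rewrite normr0.
apply: smooth_family_ext (smooth_familyD (IH _ (fun l => xk (widen_ord (leqnSn N) l))) (xk ord_max)).
by move=> t i; rewrite big_ord_recr.
Qed.

End SmoothFamilies.

(** * Smooth dependence for finite-range linear equations *)

Section LocalOperators.
Variables (R : realType) (I : Type) (N : nat) (sg : 'I_N -> I -> I).
Implicit Types (q : 'I_N -> I -> R) (v w : I -> R).

(** A finite-range operator with variable coefficients: [sg l] is the map to the [l]-th neighbour
    and [q l] its coefficient. *)
Definition local_op q v i := \sum_(l < N) q l i * v (sg l i).

Lemma local_opB q v w i :
  local_op q (fun j => v j - w j) i = local_op q v i - local_op q w i.
Proof. by rewrite /local_op -sumrB; apply: eq_bigr => l _; rewrite mulrBr. Qed.

Lemma local_opZ q a v i : local_op q (fun j => a * v j) i = a * local_op q v i.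
Proof. by rewrite /local_op mulr_sumr; apply: eq_bigr => l _; rewrite mulrCA. Qed.

Lemma local_op_coefB q q' v i :
  local_op (fun l j => q l j - q' l j) v i = local_op q v i - local_op q' v i.
Proof. by rewrite /local_op -sumrB; apply: eq_bigr => l _; rewrite mulrBl. Qed.

Lemma local_op_le q v (Q M : R) i :
  (forall l, `|q l i| <= Q) -> (forall j, `|v j| <= M) ->
  `|local_op q v i| <= N%:R * (Q * M).
Proof.
move=> qQ vM; apply: le_trans (ler_norm_sum _ _ _) _.
apply: (@le_trans _ _ (\sum_(l < N) Q * M)).
  by apply: ler_sum => l _; rewrite normrM ler_pM.
by rewrite sumr_const card_ord mulr_natl.
Qed.

(** Quantitative injectivity in the supremum norm, without surjectivity. Only bounded [v] are
    tested, since such an estimate is obtained by bootstrapping a finite supremum. *)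
Definition bounded_below q (C : R) :=
  forall v, (exists B : R, forall i, `|v i| <= B) ->
  forall M : R, (forall i, `|local_op q v i| <= M) -> forall i, `|v i| <= C * M.

(* The lower bound makes the difference quotients uniformly Cauchy, so no
   solvability of the linearised equation is needed. *)
Lemma differentiable_of_bounded_below q (Q C B : R) (d : R -> I -> R) (r : I -> R) :
  0 <= C -> (forall l i, `|q l i| <= Q) -> bounded_below q C ->
  (forall h, exists D : R, forall i, `|d h i| <= D) ->
  (forall h i, `|local_op q (d h) i - h * r i| <= B * h ^+ 2) ->
  exists v, [/\ exists D : R, forall i, `|v i| <= D,
    forall i, local_op q v i = r i &
    forall h i, `|d h i - h * v i| <= C * B * h ^+ 2].
Proof.
move=> C0 qQ qC dD dr.
have [[i0]|noI] := pselect (inhabited I); last first.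
  by exists r; split=> [|i|h i]; [exists 0 => i| |]; exfalso; apply: noI; exists.
have Q0 : 0 <= `|Q| by [].
pose J := {h : R | h != 0}.
have J0 : (1 : R) != 0 by exact: oner_neq0.
pose f (h : J) i := d (sval h) i / sval h.
have Jneq (h : J) : sval h != 0 := svalP h.
have fr (h : J) i : `|local_op q (f h) i - r i| <= B * `|sval h|.
  have h0 : 0 < `|sval h| by rewrite normr_gt0.
  rewrite -(ler_pM2l h0) -normrM mulrBr.
  have -> : sval h * local_op q (f h) i = local_op q (d (sval h)) i.
    rewrite -local_opZ; congr local_op; apply/funext => j.
    by rewrite /f mulrCA divff// mulr1.
  apply: le_trans (dr _ i) _.
  by rewrite [leRHS]mulrCA -sqr_normr expr2.
have fD (h : J) : exists D : R, forall i, `|f h i| <= D.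
  have [D dhD] := dD (sval h); exists (D * `|(sval h)^-1|) => i.
  by rewrite normrM ler_wpM2r.
have ff (h h' : J) i : `|f h i - f h' i| <= C * B * `|sval h| + C * B * `|sval h'|.
  rewrite -!mulrA -mulrDr; apply: (qC (fun i => f h i - f h' i)) => [|j].
    have [[D hD] [D' hD']] := (fD h, fD h').
    by exists (D + D') => j; apply: le_trans (ler_normB _ _) (lerD _ _).
  rewrite local_opB; apply: le_trans (lerD (fr h j) (fr h' j)).
  rewrite [X in _ <= _ + X]distrC.
  by apply: le_trans (ler_normD _ _); rewrite addrA subrK.
have vP i : exists x, forall h : J, `|f h i - x| <= C * B * `|sval h|.
  by apply: (squeezed_value (exist _ 1 J0)) => h h'; exact: ff.
have [v {}vP] := choice vP.
have B0 : 0 <= B.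
  have := le_trans (normr_ge0 _) (fr (exist _ 1 J0) i0).
  by rewrite /= normr1 mulr1.
exists v; split.
- have [D hD] := fD (exist _ 1 J0).
  exists (D + C * B * `|1|) => i.
  have := vP i (exist _ 1 J0); rewrite distrC => h1.
  apply: le_trans (lerD (hD i) h1) => /=.
  by apply: le_trans (ler_normD _ _); rewrite addrC subrK.
- move=> i; apply/eqP; rewrite -subr_eq0 -normr_le0.
  apply: (@le_add_small _ _ _ (N%:R * (`|Q| * (C * B)) + B) 1) => // h /andP[h0 _].
  have hJ : h != 0 by rewrite gt_eqF.
  pose j : J := exist _ h hJ; have hE : `|sval j| = h by rewrite gtr0_norm.
  have opB k : `|local_op q (fun i => f j i - v i) k| <= N%:R * (`|Q| * (C * B * h)).
    apply: local_op_le => [l|m]; first exact: le_trans (ler_norm _).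
    by rewrite -[in leRHS]hE.
  have := fr j i; rewrite hE => f1; have := opB i; rewrite local_opB => f2.
  rewrite add0r mulrDl -!mulrA; rewrite -!mulrA in f2.
  apply: le_trans (lerD f2 f1).
  rewrite (_ : _ - r i = local_op q (f j) i - r i - (local_op q (f j) i - local_op q v i)); last by ring.
  by rewrite [leRHS]addrC ler_normB.
- move=> h i; have [->|hn0] := eqVneq h 0.
    have [D hD] := dD 0.
    have d0 k : `|d 0 k| <= C * 0.
      apply: qC; first by exists D.
      by move=> m; have := dr 0 m; rewrite mul0r subr0 expr0n mulr0.
    by rewrite mul0r subr0 expr0n mulr0; apply: le_trans (d0 i) _; rewrite mulr0.
  have := vP i (exist _ h hn0); rewrite /f /= => hv.
  rewrite (_ : d h i - h * v i = h * (d h i / h - v i)); last first.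
    by rewrite mulrBr mulrCA divff// mulr1.
  by rewrite normrM -sqr_normr expr2 mulrCA ler_wpM2l.
Qed.

(** Differentiating [q w = r] gives [q w' = r' - q' w]: an equation of the same form whose source is
    one degree less smooth, so that the induction on [k] applies to [w']. *)
Lemma smooth_family_solution k (q : 'I_N -> R -> I -> R) (r w : R -> I -> R) (C : R) :
  0 <= C -> (forall l, smooth_family k (q l)) -> smooth_family k r ->
  (forall t, exists B : R, forall i, `|w t i| <= B) ->
  (forall t, bounded_below (fun l => q l t) C) ->
  (forall t i, local_op (fun l => q l t) (w t) i = r t i) ->
  smooth_family k w.
Proof.
have bounds (x : 'I_N -> R -> I -> R) j : (forall l, smooth_family j (x l)) ->
    exists Q : R, forall l t i, `|x l t i| <= Q.
  move=> xj; have [Q xQ] := choice (fun l => smooth_family_bounded (xj l)).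
  exists (\sum_l `|Q l|) => l t i; apply: le_trans (xQ l t i) _.
  apply: le_trans (ler_norm _) _; rewrite (bigD1 l)//= lerDl.
  by apply: sumr_ge0.
have lips (x : 'I_N -> R -> I -> R) j : (forall l, smooth_family j (x l)) ->
    exists Q : R, forall l t h i, `|x l (t + h) i - x l t i| <= Q * `|h|.
  move=> xj; have [Q xQ] := choice (fun l => smooth_family_lipschitz (xj l)).
  exists (\sum_l `|Q l|) => l t h i; apply: le_trans (xQ l t h i) _.
  apply: ler_wpM2r => //; apply: le_trans (ler_norm _) _.
  by rewrite (bigD1 l)//= lerDl; apply: sumr_ge0.
elim: k r w => [|k IH] r w C0 qk rk wb qC qw.
  have [Rb rR] := smooth_family_bounded rk.
  have wB t i : `|w t i| <= C * Rb by apply: (qC t) => // j; rewrite qw.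
  split; first by exists (C * Rb).
  have [L rL] := smooth_family_lipschitz rk; have [Q qQ] := lips _ _ qk.
  exists (C * (L + N%:R * (Q * (C * Rb)))) => t h i; rewrite -mulrA.
  apply: (qC (t + h) (fun i => w (t + h) i - w t i)) => [|j].
    exists (C * Rb + C * Rb) => j.
    by apply: le_trans (ler_normB _ _) _; apply: lerD.
  rewrite local_opB qw.
  rewrite (_ : _ - _ = (r (t + h) j - r t j) -
    local_op (fun l j => q l (t + h) j - q l t j) (w t) j); last first.
    by rewrite local_op_coefB qw; ring.
  apply: le_trans (ler_normB _ _) _; rewrite mulrDl; apply: lerD => //.
  have -> : N%:R * (Q * (C * Rb)) * `|h| = N%:R * (Q * `|h| * (C * Rb)) by ring.
  by apply: local_op_le.
have w0 : smooth_family 0 w.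
  have w_k : smooth_family k w.
    by apply: (IH r) => // [l|]; exact: smooth_familyW.
  exact: smooth_family0 w_k.
have [wb' [Lw wL]] := w0; have [Wb wW] := wb'.
split=> //.
have /choice[q' q'P] : forall l, exists x', smooth_family k x' /\ exists B : R,
    forall t h i, `|q l (t + h) i - q l t i - h * x' t i| <= B * h ^+ 2.
  by move=> l; have [_ [x' x'k xx']] := qk l; exists x'.
have q'k l : smooth_family k (q' l) by have [] := q'P l.
have [Cq q'C] : exists Cq : R, forall l t h i,
    `|q l (t + h) i - q l t i - h * q' l t i| <= Cq * h ^+ 2.
  have {q'P} : forall l, exists Cq : R, forall t h i,
    `|q l (t + h) i - q l t i - h * q' l t i| <= Cq * h ^+ 2.
    by move=> l; have [] := q'P l.
  move=> /choice[Q xQ]; exists (\sum_l `|Q l|) => l t h i.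
  apply: le_trans (xQ l t h i) _; rewrite ler_wpM2r ?sqr_ge0//.
  apply: le_trans (ler_norm _) _; rewrite (bigD1 l)//= lerDl.
  by apply: sumr_ge0.
have [r' r'k [Cr r'C]] := proj2 rk.
have [Qb qQ] := bounds _ _ qk; have [Ql qL] := lips _ _ qk.
pose rho t i := r' t i - local_op (fun l => q' l t) (w t) i.
pose B := Cr + N%:R * (Ql * Lw) + N%:R * (Cq * Wb).
have : forall t, exists v : I -> R, [/\ exists D : R, forall i, `|v i| <= D,
    forall i, local_op (fun l => q l t) v i = rho t i &
    forall h i, `|w (t + h) i - w t i - h * v i| <= C * B * h ^+ 2].
  move=> t; apply: (@differentiable_of_bounded_below _ Qb) => //.
    move=> h; exists (Lw * `|h|) => i; exact: wL.
  move=> h i; rewrite local_opB qw.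
  have -> : local_op (fun l => q l t) (w (t + h)) i =
     r (t + h) i - local_op (fun l j => q l (t + h) j - q l t j) (w (t + h)) i.
    by rewrite local_op_coefB qw; ring.
  (* [A1] pairs the increments of the coefficients with those of [w], and [A2] the Taylor remainders
     of the coefficients with [w t]; both are quadratic in [h]. *)
  pose A1 := local_op (fun l j => q l (t + h) j - q l t j) (fun j => w (t + h) j - w t j) i.
  pose A2 := local_op (fun l j => q l (t + h) j - q l t j - h * q' l t j) (w t) i.
  have E1 : A1 = local_op (fun l j => q l (t + h) j - q l t j) (w (t + h)) i -
    local_op (fun l j => q l (t + h) j - q l t j) (w t) i by rewrite /A1 local_opB.
  have E2 : A2 = local_op (fun l j => q l (t + h) j - q l t j) (w t) i -
    h * local_op (fun l => q' l t) (w t) i.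
    rewrite /A2 (local_op_coefB (fun l j => q l (t + h) j - q l t j)
      (fun l j => h * q' l t j)); congr (_ - _).
    by rewrite /local_op mulr_sumr; apply: eq_bigr => l _; rewrite mulrA.
  rewrite (_ : _ - _ = (r (t + h) i - r t i - h * r' t i) - A1 - A2); last first.
    by rewrite E1 E2 /rho; ring.
  rewrite /B !mulrDl; apply: le_trans (ler_normB _ _) _; apply: lerD.
    apply: le_trans (ler_normB _ _) _; apply: lerD => //.
    have -> : N%:R * (Ql * Lw) * h ^+ 2 = N%:R * (Ql * `|h| * (Lw * `|h|)).
      by rewrite -sqr_normr; ring.
    by apply: local_op_le.
  have -> : N%:R * (Cq * Wb) * h ^+ 2 = N%:R * (Cq * h ^+ 2 * Wb) by ring.
  by apply: local_op_le.
move=> /choice[w' w'P].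
have w'k : smooth_family k w'.
  apply: (IH rho) => // [l| |t|t i].
  - exact: smooth_familyW.
  - have wk : smooth_family k w by apply: (IH r) => // [l|]; exact: smooth_familyW.
    apply: smooth_familyD => //.
    apply: (@smooth_family_ext _ _ _ (fun t i => -1 * local_op (fun l => q' l t) (w t) i)).
      by move=> t i; rewrite mulN1r.
    apply: smooth_familyM; last first.
      apply: smooth_family_bigsum => l; apply: smooth_familyM => //.
      exact: smooth_family_reindex.
    by apply: (@smooth_family_cst _ _ _ _ 1) => i; rewrite normrN normr1.
  - by have [] := w'P t.
  - by have [] := w'P t.
exists w' => //; exists (C * B) => t h i.
by have [_ _] := w'P t; apply.
Qed.

End LocalOperators.

(** * Scalar inequalities across the scales of [e] *)

Section ScalarEstimates.
Variables (R : realType) (e : R).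
Hypotheses (e_gt0 : 0 < e) (e_small : e <= 1 / 1000).

Lemma ler_of_sqr (a c : R) : 0 <= c -> a ^+ 2 <= c ^+ 2 -> a <= c.
Proof. by move=> c0 ac; rewrite leNgt; apply/negP => ca; nra. Qed.

Lemma epow_gt0 k : 0 < e ^+ k. Proof. exact: exprn_gt0. Qed.
Arguments epow_gt0 k%_N.

Lemma epowS_le k : e ^+ k.+1 <= e ^+ k / 1000.
Proof. by rewrite exprSr ler_pM2l ?epow_gt0//; move: e_small; lra. Qed.

Lemma epowD_le j k : e ^+ (j + k) <= e ^+ j / 1000 ^+ k.
Proof.
elim: k => [|k IH]; first by rewrite addn0 expr0 divr1.
rewrite addnS; apply: le_trans (epowS_le _) _.
by rewrite exprS invfM mulrCA [X in _ <= X]mulrC ler_wpM2r ?invr_ge0.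
Qed.

Arguments epowD_le (j k)%_N.

Lemma dist1_le_sqr (b : R) : 0 <= b -> `|b - 1| <= `|1 - b ^+ 2|.
Proof.
move=> b0; rewrite (_ : 1 - b ^+ 2 = (1 - b) * (1 + b)); last by ring.
by rewrite normrM distrC ler_peMr// ger0_norm; lra.
Qed.

Lemma inv_ge_tangent (b : R) : 0 < b -> 2 - b <= b^-1.
Proof.
move=> b0; rewrite -(ler_pM2l b0) divff ?gt_eqF//.
by have := sqr_ge0 (b - 1); rewrite -subr_ge0 => ?; nra.
Qed.

Section FixedBeta.
Variable b : R.
Hypotheses (b_ge : e ^+ 4 / 2 <= b) (b_le : b <= 3 / 2).
(** The distance of [b] to its fold value 1; up to the coupling it is [sqrt (1 - mu)]. *)
Let eb : R := `|1 - b ^+ 2|.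

Lemma b_gt0 : 0 < b. Proof. by have := epow_gt0 4; move: b_ge; lra. Qed.

Lemma eb_ge0 : 0 <= eb. Proof. exact: normr_ge0. Qed.

Lemma eb_sqr : eb ^+ 2 = (1 - b ^+ 2) ^+ 2. Proof. exact: sqr_normr. Qed.

Lemma eb_le : eb <= 5 / 4.
Proof. have b0 := b_gt0; have b3 := b_le; rewrite /eb ler_norml; apply/andP; split; nra. Qed.

Lemma b_near1 : 1 - eb <= b <= 1 + eb.
Proof.
have := dist1_le_sqr (ltW b_gt0); rewrite -/eb ler_norml => /andP[? ?].
by apply/andP; split; lra.
Qed.

Lemma eb_ge_small : b <= 1 / 2 -> 3 / 4 <= eb.
Proof.
move=> b12; have b0 := b_gt0; have b3 := b_le; rewrite /eb; apply: le_trans (ler_norm _); nra.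
Qed.

(** A lower bound for the coupling term of site 2, with [s = U 1 + U 3]. Replacing [b^-1] by its
    tangent at 1 preserves the excess [e ^+ 6 / 4], which is all that survives at the fold
    [b = 1]. *)
Lemma nu_ge (s : R) : 2 + e ^+ 6 / 4 <= s -> s <= 5 ->
  2 + e ^+ 6 / 4 - 5 * eb <= s / b.
Proof.
move=> s2 s5; have /andP[_ b1] := b_near1.
have s0 : 0 <= s by have := epow_gt0 6; lra.
have eb0 := eb_ge0.
apply: le_trans (ler_wpM2l s0 (inv_ge_tangent b_gt0)).
by nra.
Qed.

Lemma nu_le (s : R) : 1 / 2 <= b -> s <= 2 + 2 * eb + 2 * e ^+ 5 -> 0 <= s <= 5 ->
  s / b <= 2 + 12 * eb + 2 * e ^+ 5.
Proof.
move=> b12 s2 /andP[s0 s5]; have /andP[b1 _] := b_near1; have b0 := b_gt0.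
have bV : b^-1 <= 1 + 2 * eb.
  rewrite -(ler_pM2l b0) divff ?gt_eqF//; have := eb_ge0; nra.
apply: le_trans (ler_wpM2l s0 bV) _; have := eb_ge0; nra.
Qed.

(** At [eb = 0] the contributions of order [e ^+ 12] cancel and the excess [e ^+ 6 / 4] of [p]
    remains, whence the [e ^+ 18]. The cross term [7 * e ^+ 12 * eb] is absorbed by completing the
    square. *)
Lemma rad_ge (p s u : R) : 2 + e ^+ 6 / 4 - 5 * eb <= p ->
  0 <= s <= 2 * (1 + eb + e ^+ 8) -> 1 <= u ->
  eb ^+ 2 / 2 + e ^+ 18 / 8 <= (1 - b ^+ 2) ^+ 2 + e ^+ 12 * (p - s / u).
Proof.
move=> p2 /andP[s0 s2] u1; rewrite -eb_sqr.
have su : s / u <= s by rewrite ler_piMr// invf_le1; lra.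
have h : 2 + e ^+ 6 / 4 - 5 * eb - 2 * (1 + eb + e ^+ 8) <= p - s / u by lra.
have := ler_wpM2l (ltW (epow_gt0 12)) h.
have := sqr_ge0 (eb - 7 * e ^+ 12).
have := epowD_le 18 2; have := epowD_le 18 6; have := epow_gt0 18.
by lra.
Qed.

(** The neighbours of site 1 sum to at most about 1 instead of 2, so a full multiple of [e ^+ 12]
    survives at the fold. *)
Lemma rad1_ge (p s u : R) : 2 + e ^+ 6 / 4 - 5 * eb <= p ->
  s <= 1 + eb -> 1 <= u ->
  eb ^+ 2 / 2 + e ^+ 12 / 2 <= (1 - b ^+ 2) ^+ 2 + e ^+ 12 * (p - s / u).
Proof.
move=> p2 s2 u1; rewrite -eb_sqr.
have su : s / u <= 1 + eb.
  by rewrite ler_pdivrMr; [have := eb_ge0; nra|lra].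
have e6 := epow_gt0 6.
have h : 2 - 5 * eb - (1 + eb) <= p - s / u by lra.
have := ler_wpM2l (ltW (epow_gt0 12)) h.
have := sqr_ge0 (eb - 6 * e ^+ 12).
have := epowD_le 12 12; have := epow_gt0 12.
by lra.
Qed.

(* [sqrt rad] dominates the coupling [e ^+ 12] at every scale of [b]. *)
Lemma coupling_le (x : R) : 0 <= x -> eb ^+ 2 / 2 + e ^+ 18 / 8 <= x ^+ 2 ->
  [/\ e ^+ 12 <= 3 * e ^+ 3 * x, e ^+ 12 / b <= 6 * e ^+ 3 * x,
      e ^+ 12 / b ^+ 2 <= 12 * e ^+ 3 * x, 1 / b <= 6 * x / e ^+ 13 &
      eb <= 3 / 2 * x].
Proof.
move=> x0 xge; have b0 := b_gt0; have eb0 := eb_ge0.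
have x9 : e ^+ 9 <= 3 * x.
  apply: ler_of_sqr; first lra.
  have := sqr_ge0 eb; have := epow_gt0 18; lra.
have xeb : eb <= 3 / 2 * x.
  apply: ler_of_sqr; first lra.
  have := sqr_ge0 eb; have := epow_gt0 18; lra.
have e3 := epow_gt0 3.
have x12 : e ^+ 12 <= 3 * e ^+ 3 * x by have := ler_wpM2l (ltW e3) x9; lra.
have bge := b_ge; have ble := b_le.
have [b12|b12] := leP b (1 / 2).
  have x1 : 1 / 2 <= x by have := eb_ge_small b12; lra.
  have bV : b^-1 <= 2 / e ^+ 4.
    by rewrite -(ler_pM2l b0) divff ?gt_eqF// mulrA ler_pdivlMr ?epow_gt0//; lra.
  have e4 := epow_gt0 4.
  have h1 : e ^+ 12 / b <= 2 * e ^+ 8.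
    apply: le_trans (ler_wpM2l (ltW (epow_gt0 12)) bV) _.
    by rewrite mulrA ler_pdivrMr//; lra.
  have h2 : e ^+ 12 / b ^+ 2 <= 4 * e ^+ 4.
    rewrite expr2 invfM mulrA; apply: le_trans (ler_wpM2r _ h1) _.
      by rewrite invr_ge0 ltW.
    apply: le_trans (ler_wpM2l _ bV) _; first by rewrite mulr_ge0// ltW ?epow_gt0.
    by rewrite mulrA ler_pdivrMr//; lra.
  have x3 := ler_wpM2l (ltW e3) x1.
  have := epowD_le 3 5; have := epowD_le 3 1.
  split=> //; [lra|lra|].
  rewrite div1r; apply: le_trans bV _; rewrite ler_pdivrMr// mulrAC ler_pdivlMr ?epow_gt0//.
  have := epowD_le 4 9; have := ler_wpM2l (ltW e4) x1; clear - b12 x1 e4; lra.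
have bV : b^-1 <= 2 by rewrite -(ler_pM2l b0) divff ?gt_eqF//; lra.
have h1 : e ^+ 12 / b <= 2 * e ^+ 12.
  by have := ler_wpM2l (ltW (epow_gt0 12)) bV; lra.
have bV0 : 0 <= b^-1 by rewrite invr_ge0 ltW.
have h2 : e ^+ 12 / b ^+ 2 <= 4 * e ^+ 12.
  rewrite expr2 invfM mulrA; apply: le_trans (ler_wpM2r bV0 h1) _.
  by have := ler_wpM2l (ltW (epow_gt0 12)) bV; lra.
split=> //; [(clear - x12 h1 h2; lra)|(clear - x12 h1 h2; lra)|].
rewrite div1r; apply: le_trans bV _; rewrite ler_pdivlMr ?epow_gt0//.
by have := epowD_le 9 4; have := epow_gt0 9; lra.
Qed.

(** Since [1 + x <= (1 + x / 2) ^+ 2]. The halving of [w] provides the room by which an iteration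
    step maps the box into its interior. *)
Lemma root_upper (x t w c : R) : 0 <= w -> 0 <= x -> 0 <= t -> x ^+ 2 <= w ^+ 2 ->
  t ^+ 2 = 1 + x -> 1 + w / 2 <= c -> t <= c.
Proof.
move=> w0 x0 t0 xw tx wc; apply: le_trans wc.
have {}xw : x <= w by exact: ler_of_sqr.
apply: ler_of_sqr; first lra.
by rewrite tx; have := sqr_ge0 w; lra.
Qed.

(** For such [b] the coupling is still of order [e ^+ 8]. As [eb >= 3 / 4] there, the crude margin
    [1 / 4] is harmless after the halving in [root_upper]. *)
Lemma rad_le_small (p s u : R) : b <= 1 / 2 -> p <= 5 -> -1 <= s -> 1 <= u ->
  (1 - b ^+ 2) ^+ 2 + e ^+ 12 * (p / b - s / u) <= (eb + 1 / 4) ^+ 2.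
Proof.
move=> b12 p5 s0 u1; rewrite -eb_sqr.
have su : -1 <= s / u by rewrite ler_pdivlMr; lra.
have pb : p / b <= 10 / e ^+ 4.
  rewrite ler_pdivrMr ?b_gt0// mulrAC ler_pdivlMr ?epow_gt0//.
  by have := ler_wpM2r (ltW (epow_gt0 4)) p5; move: b_ge; lra.
have h : p / b - s / u <= 10 / e ^+ 4 + 1 by lra.
have := ler_wpM2l (ltW (epow_gt0 12)) h.
rewrite (_ : e ^+ 12 * (10 / e ^+ 4 + 1) = 10 * e ^+ 8 + e ^+ 12); last first.
  by field; rewrite gt_eqF.
have := epowD_le 0 8; have := epowD_le 0 12; rewrite expr0.
have := eb_ge_small b12; lra.
Qed.

(** The constants 2 in the bounds of [p] and of [s / u] cancel, so [e ^+ 12] multiplies [16 * eb]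
    and a term of order [e ^+ 5]; these fit into the cross term and the last square of
    [(eb + e ^+ 8) ^+ 2]. *)
Lemma rad_le (p s u : R) : 1 / 2 <= b -> p <= 2 + 12 * eb + 2 * e ^+ 5 ->
  2 - 2 * eb <= s -> 0 <= s -> 1 <= u <= 1 + eb + e ^+ 8 ->
  (1 - b ^+ 2) ^+ 2 + e ^+ 12 * (p - s / u) <= (eb + e ^+ 8) ^+ 2.
Proof.
move=> b12 p2 s2 s0 /andP[u1 u2]; rewrite -eb_sqr; have eb0 := eb_ge0.
have e8 := epow_gt0 8.
have su : 2 - 4 * eb - 2 * e ^+ 8 <= s / u.
  rewrite ler_pdivlMr; last lra.
  have [h|h] := leP (2 - 4 * eb - 2 * e ^+ 8) 0; first nra.
  apply: le_trans (ler_wpM2l (ltW h) u2) _; nra.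
have h : p - s / u <= 16 * eb + 2 * e ^+ 5 + 2 * e ^+ 8 by lra.
have := ler_wpM2l (ltW (epow_gt0 12)) h.
have := ler_wpM2r eb0 (epowD_le 8 4).
have := epowD_le 16 1; have := epowD_le 16 4; have := epow_gt0 16.
have := mulr_ge0 eb0 (ltW e8); lra.
Qed.

Lemma rad1_le (p s u : R) : 1 / 2 <= b -> p <= 2 + 12 * eb + 2 * e ^+ 5 ->
  -1 <= s -> 1 <= u ->
  (1 - b ^+ 2) ^+ 2 + e ^+ 12 * (p - s / u) <= (eb + e ^+ 5) ^+ 2.
Proof.
move=> b12 p2 s2 u1; rewrite -eb_sqr; have eb0 := eb_ge0.
have su : -1 <= s / u by rewrite ler_pdivlMr; lra.
have e5 := epow_gt0 5.
have h : p - s / u <= 12 * eb + 3 + 2 * e ^+ 5 by lra.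
have := ler_wpM2l (ltW (epow_gt0 12)) h.
have := ler_wpM2r eb0 (epowD_le 5 7).
have := epowD_le 10 2; have := epowD_le 10 7; have := epow_gt0 10.
have := mulr_ge0 eb0 (ltW e5); lra.
Qed.

End FixedBeta.
End ScalarEstimates.

(** * Lower bounds and Lipschitz bounds for one iteration step *)

Section StepEstimates.
Variables (R : realType) (e : R).
Hypotheses (e_gt0 : 0 < e) (e_small : e <= 1 / 1000).
Implicit Types a b : R.

Let epow := epow_gt0 e_gt0.
Arguments epow k%_N.
Let epowD := epowD_le e_gt0 e_small.
Arguments epowD (j k)%_N.

Lemma sqr_le (x y : R) : 0 <= x -> x <= y -> x ^+ 2 <= y ^+ 2.
Proof. by move=> *; nra. Qed.

(** The two terms balance at the scale [a = e ^+ 4] of the fold of site 0; on either side of it one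
    of them alone reaches [e ^+ 8 / 2]. *)
Lemma floor_ge a : 0 < a -> e ^+ 8 / 2 <= a ^+ 2 / 2 + e ^+ 12 / (2 * a).
Proof.
move=> a0; have e4 := epow 4; have d0 : 0 <= e ^+ 12 / (2 * a).
  by rewrite divr_ge0 ?(ltW (epow 12)) ?mulr_ge0 ?(ltW a0).
have [h|h] := leP (e ^+ 4) a.
  have : e ^+ 4 ^+ 2 <= a ^+ 2 by apply: sqr_le => //; exact: ltW.
  lra.
have : e ^+ 8 / 2 <= e ^+ 12 / (2 * a).
  rewrite ler_pdivlMr ?mulr_gt0//; have := ler_wpM2l (ltW (epow 8)) (ltW h); lra.
by have := sqr_ge0 a; lra.
Qed.

(** Without its last two terms this is the parameter read off at site 0, less [2 * e ^+ 12]. Sites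
    left of 0 are smaller than [a] by a factor [e ^+ 3], so those two terms are a small fraction of
    [a ^+ 2]. *)
Lemma den_ge a u y g : e ^+ 12 / 2 <= a <= 1 ->
  `|u| <= e ^+ 3 * a -> `|y| <= e ^+ 3 * a -> 1 <= g ->
  a ^+ 2 / 2 + e ^+ 12 / (2 * a) <=
    2 * a ^+ 2 - a ^+ 4 + e ^+ 12 * (y + g) / a - 2 * u ^+ 2 + u ^+ 4.
Proof.
move=> /andP[a1 a2] ua ya g1; have a0 : 0 < a by have := epow 12; lra.
have yg : 1 / 2 <= y + g.
  move: ya; rewrite ler_norml => /andP[ya _].
  have := ler_wpM2l (ltW (epow 3)) a2; have := epowD 0 3; rewrite expr0; lra.
have h1 : e ^+ 12 / (2 * a) <= e ^+ 12 * (y + g) / a.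
  rewrite invfM mulrA ler_wpM2r ?invr_ge0 ?(ltW a0)//.
  by have := ler_wpM2l (ltW (epow 12)) yg; lra.
have u2 : u ^+ 2 <= (e ^+ 3 * a) ^+ 2.
  by rewrite -[u ^+ 2]sqr_normr; apply: sqr_le.
have a22 : a ^+ 2 <= 1 by rewrite expr2; nra.
have := ler_wpM2l (sqr_ge0 a) a22; have := ler_wpM2r (sqr_ge0 a) (epowD 0 6).
rewrite expr0; have := sqr_ge0 (u ^+ 2); have := sqr_ge0 a; lra.
Qed.

Lemma root_lip (x x' t t' r r' : R) : 0 <= x -> 0 <= x' -> 1 <= t -> 1 <= t' ->
  t ^+ 2 = 1 + x -> t' ^+ 2 = 1 + x' -> x ^+ 2 = r -> x' ^+ 2 = r' ->
  2 * x * `|t - t'| <= `|r - r'|.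
Proof.
move=> x0 x'0 t1 t'1 tx tx' xr xr'.
have -> : r - r' = (t - t') * ((t + t') * (x + x')).
  rewrite -xr -xr'; have -> : x = t ^+ 2 - 1 by lra.
  have -> : x' = t' ^+ 2 - 1 by lra.
  by ring.
rewrite normrM mulrC ler_wpM2l// ger0_norm; first nra.
by apply: mulr_ge0; lra.
Qed.

Lemma ratio_lip (s s' u u' D M : R) : 1 <= u -> 1 <= u' -> `|s'| <= D ->
  `|s - s'| <= 2 * M -> `|u - u'| <= M -> `|s / u - s' / u'| <= (2 + D) * M.
Proof.
move=> u1 u'1 sD ss uu; have u0 : 0 < u by lra.
have u'0 : 0 < u' by lra.
rewrite (_ : s / u - s' / u' = (s - s') / u - s' * (u - u') / (u * u')); last first.
  by field; rewrite !gt_eqF.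
have M0 := le_trans (normr_ge0 _) uu; have D0 := le_trans (normr_ge0 _) sD.
apply: le_trans (ler_normB _ _) _; rewrite [leRHS]mulrDl; apply: lerD.
  by rewrite normrM (@ger0_norm _ u^-1) ?invr_ge0 ?ler_pdivrMr ?(ltW u0)//; nra.
rewrite !normrM (@ger0_norm _ (u * u')^-1) ?invr_ge0 ?mulr_ge0 ?(ltW u0) ?(ltW u'0)//.
rewrite ler_pdivrMr ?mulr_gt0//.
apply: (@le_trans _ _ (D * M)); first by rewrite ler_pM.
by rewrite ler_peMr ?mulr_ge0//; nra.
Qed.

Lemma quotient_lip (s s' u u' D M : R) : 0 < u -> 0 < u' -> `|s| <= D ->
  `|s - s'| <= 2 * M ->
  `|s / u - s' / u'| <= 2 * M / u' + D * `|u - u'| / (u * u').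
Proof.
move=> u0 u'0 sD ss.
rewrite (_ : s / u - s' / u' = (s - s') / u' - s * (u - u') / (u * u')); last first.
  by field; rewrite !gt_eqF.
apply: le_trans (ler_normB _ _) _; apply: lerD.
  by rewrite normrM (@ger0_norm _ u'^-1) ?invr_ge0 ?(ltW u'0)// ler_wpM2r ?invr_ge0 ?(ltW u'0).
rewrite !normrM (@ger0_norm _ (u * u')^-1) ?invr_ge0 ?mulr_ge0 ?(ltW u0) ?(ltW u'0)//.
by rewrite ler_wpM2r ?invr_ge0 ?mulr_ge0 ?(ltW u0) ?(ltW u'0)// ler_wpM2r.
Qed.

(** By [coupling_le] the coupling costs at most [x / 2] per unit of [M], and [root_lip] divides by
    [2 * x]: the contraction constant is the same at every distance from the fold. *)
Lemma rad_lip b b' (p p' s s' u u' M x : R) :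
  e ^+ 4 / 2 <= b <= 3 / 2 -> e ^+ 4 / 2 <= b' <= 3 / 2 ->
  `|p'| <= 5 -> `|s'| <= 5 -> 1 <= u -> 1 <= u' ->
  `|p - p'| <= 2 * M -> `|s - s'| <= 2 * M -> `|u - u'| <= M ->
  0 <= x -> `|1 - b ^+ 2| ^+ 2 / 2 + e ^+ 18 / 8 <= x ^+ 2 ->
  `|((1 - b ^+ 2) ^+ 2 + e ^+ 12 * (p / b - s / u))
    - ((1 - b' ^+ 2) ^+ 2 + e ^+ 12 * (p' / b' - s' / u'))|
  <= x / 2 * M + 40 * `|b - b'|.
Proof.
move=> /andP[b1 b2] /andP[b1' b2'] p5 s5 u1 u1' pp ss uu x0 xge.
have e4 := epow 4; have b0 : 0 < b by lra.
have b'0 : 0 < b' by lra.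
have M0 := le_trans (normr_ge0 _) uu.
rewrite distrC.
rewrite (_ : _ - _ = (b - b') * ((b + b') * (2 - b ^+ 2 - b' ^+ 2))
   + e ^+ 12 * ((p' / b' - p / b) + (s / u - s' / u'))); last by ring.
have h1 : `|(b - b') * ((b + b') * (2 - b ^+ 2 - b' ^+ 2))| <= 15 * `|b - b'|.
  rewrite normrM mulrC ler_wpM2r// ler_norml; apply/andP; split; clear - b1 b2 b1' b2'; nra.
have h2 := ratio_lip u1 u1' s5 ss uu.
have h3 : `|p' / b' - p / b| <= 2 * M / b + 5 * `|b - b'| / (b * b').
  by rewrite (distrC b) [b * b']mulrC; apply: quotient_lip => //; rewrite distrC.
have bb : e ^+ 12 / (b * b') <= 4 * e ^+ 4.
  rewrite ler_pdivrMr ?mulr_gt0//.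
  have : e ^+ 4 / 2 * (e ^+ 4 / 2) <= b * b' by apply: ler_pM => //; clear - e4 b0; lra.
  move=> h; have := ler_wpM2l (ltW e4) h; clear - h3; lra.
have [c1 c2 _ _ _] := coupling_le e_gt0 e_small b1 b2 x0 xge.
apply: le_trans (ler_normD _ _) _; rewrite [X in _ + X <= _]normrM (gtr0_norm (epow 12)).
have h4 : `|(p' / b' - p / b) + (s / u - s' / u')| <=
   2 * M / b + 5 * `|b - b'| / (b * b') + (2 + 5) * M.
  by apply: le_trans (ler_normD _ _) (lerD h3 h2).
have := ler_wpM2l (ltW (epow 12)) h4.
rewrite (_ : e ^+ 12 * (_ + _) = 2 * (e ^+ 12 / b * M) +
   5 * (e ^+ 12 / (b * b') * `|b - b'|) + 7 * (e ^+ 12 * M)); last by ring.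
have := ler_wpM2r M0 c1; have := ler_wpM2r M0 c2.
have := ler_wpM2r (normr_ge0 (b - b')) bb.
have := ler_wpM2r (normr_ge0 (b - b')) (epowD 0 4).
have := ler_wpM2r (mulr_ge0 x0 M0) (epowD 0 3).
rewrite expr0; have := mulr_ge0 x0 M0; have := normr_ge0 (b - b').
clear - h1; lra.
Qed.

(** The quotient rule in the form [(t - t') den = - e ^+ 12 (s - s') - t' (den - den')]. The bound
    [e ^+ 3 * a'] on [t'] compensates the large variation of the denominator for small [a];
    [a' <= 2 * a] allows products such as [a * a'] to be measured against [F], which is built from
    [a]. *)
Lemma left_lip a a' (s s' y y' g g' u u' t t' M : R) :
  e ^+ 12 / 2 <= a <= 1 -> e ^+ 12 / 2 <= a' <= 1 -> a' <= 2 * a ->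
  `|u| <= e ^+ 3 * a -> `|y| <= e ^+ 3 * a -> 1 <= g -> g <= 5 / 2 ->
  `|u'| <= e ^+ 3 * a' -> `|t'| <= e ^+ 3 * a' ->
  `|s - s'| <= 2 * M -> `|y - y'| <= M -> `|g - g'| <= M -> `|u - u'| <= M ->
  t * (2 * a ^+ 2 - a ^+ 4 + e ^+ 12 * (y + g) / a - 2 * u ^+ 2 + u ^+ 4) =
     - e ^+ 12 * s ->
  t' * (2 * a' ^+ 2 - a' ^+ 4 + e ^+ 12 * (y' + g') / a' - 2 * u' ^+ 2 + u' ^+ 4) =
     - e ^+ 12 * s' ->
  `|t - t'| <= M / 2 + 40 / e ^+ 9 * `|a - a'|.
Proof.
move=> ab ab' aa ua ya g1 g2 ua' ta' ss yy gg uu E E'.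
have D := den_ge ab ua ya g1.
move: ab ab' => /andP[a1 a2] /andP[a1' a2'].
have a0 : 0 < a by have := epow 12; clear - a1 a2; lra.
have a'0 : 0 < a' by have := epow 12; clear - a2 a1'; lra.
have fl := floor_ge a0; have e8 := epow 8; have e3 := epow 3.
have M0 := le_trans (normr_ge0 _) uu; have da := normr_ge0 (a - a').
set den := 2 * a ^+ 2 - _ + _ - _ + _ in D E.
set den' := 2 * a' ^+ 2 - _ + _ - _ + _ in E'.
set F := a ^+ 2 / 2 + _ in D fl.
have F0 : 0 < F by clear - e8 fl; lra.
have h1 : `|2 * (a ^+ 2 - a' ^+ 2) - (a ^+ 4 - a' ^+ 4)| <= 4 * `|a - a'|.
  rewrite (_ : _ - _ = (a - a') * ((a + a') * (2 - a ^+ 2 - a' ^+ 2))); last by ring.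
  rewrite normrM mulrC ler_wpM2r// ler_norml; apply/andP; split; clear - a2 a2' a0 a'0; nra.
have h2 : `|(y + g) / a - (y' + g') / a'| <= 2 * M / a' + 4 * `|a - a'| / (a * a').
  apply: quotient_lip => //.
    apply: le_trans (ler_normD _ _) _; rewrite (@ger0_norm _ g); last (clear - ya g1; lra).
    have := ler_wpM2l (ltW e3) a2; have := epowD 0 3; rewrite expr0; clear - ya g2; lra.
  rewrite opprD addrACA; apply: le_trans (ler_normD _ _) _; clear - yy gg; lra.
have h3 : `|- 2 * (u ^+ 2 - u' ^+ 2) + (u ^+ 4 - u' ^+ 4)| <= 9 * e ^+ 3 * a * M.
  rewrite (_ : - 2 * _ + _ = (u - u') * ((u + u') * (u ^+ 2 + u' ^+ 2 - 2))); last by ring.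
  rewrite normrM mulrC ler_pM// normrM.
  have uu1 : `|u + u'| <= 3 * e ^+ 3 * a.
    apply: le_trans (ler_normD _ _) _; have := ler_wpM2l (ltW e3) aa; clear - ua ua'; lra.
  have uu2 : `|u ^+ 2 + u' ^+ 2 - 2| <= 3.
    have v1 : `|u| <= 1.
      have := ler_wpM2l (ltW e3) a2; have := epowD 0 3; rewrite expr0; clear - ua; lra.
    have v2 : `|u'| <= 1.
      have := ler_wpM2l (ltW e3) a2'; have := epowD 0 3; rewrite expr0; clear - ua'; lra.
    have w1 : u ^+ 2 <= 1 by rewrite -sqr_normr expr_le1.
    have w2 : u' ^+ 2 <= 1 by rewrite -sqr_normr expr_le1.
    have := sqr_ge0 u; have := sqr_ge0 u' => q1 q2.
    by rewrite ler_norml; apply/andP; split; clear - w1 w2 q1 q2; lra.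
  by have := ler_pM (normr_ge0 _) (normr_ge0 _) uu1 uu2; clear - uu2; lra.
have dd : `|den - den'| <= 4 * `|a - a'| +
    e ^+ 12 * (2 * M / a' + 4 * `|a - a'| / (a * a')) + 9 * e ^+ 3 * a * M.
  rewrite (_ : den - den' = (2 * (a ^+ 2 - a' ^+ 2) - (a ^+ 4 - a' ^+ 4)) +
    e ^+ 12 * ((y + g) / a - (y' + g') / a') +
    (- 2 * (u ^+ 2 - u' ^+ 2) + (u ^+ 4 - u' ^+ 4))); last by rewrite /den /den'; ring.
  apply: le_trans (ler_normD _ _) _; apply: lerD => //.
  apply: le_trans (ler_normD _ _) _; apply: lerD => //.
  by rewrite normrM (gtr0_norm (epow 12)) ler_wpM2l// (ltW (epow 12)).
have key : `|t - t'| * den <= e ^+ 12 * (2 * M) + e ^+ 3 * a' * `|den - den'|.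
  rewrite -[X in _ * X]gtr0_norm; last (clear - D F0; lra).
  rewrite -normrM (_ : (t - t') * den = - (e ^+ 12 * (s - s')) - t' * (den - den')); last first.
    by rewrite !mulrBr mulrBl E E'; ring.
  apply: le_trans (ler_normB _ _) _; apply: lerD.
    by rewrite normrN normrM (gtr0_norm (epow 12)) ler_wpM2l// (ltW (epow 12)).
  by rewrite normrM ler_wpM2r.
have ea0 : 0 <= e ^+ 3 * a' by rewrite mulr_ge0 ?(ltW e3) ?(ltW a'0).
have k2 := ler_wpM2l ea0 dd.
rewrite (_ : _ * _ * (_ + _) = e ^+ 3 * (4 * (a' * `|a - a'|) + 2 * (e ^+ 12 * M)
   + 4 * (e ^+ 12 / a * `|a - a'|) + 9 * e ^+ 3 * (a * a' * M))) in k2; last first.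
  by field; rewrite !gt_eqF.
have F1 : e ^+ 12 <= 2 * e ^+ 4 * F by have := ler_wpM2l (ltW (epow 4)) fl; clear - k2; lra.
have F2 : e ^+ 12 / a <= 2 * F.
  by have := sqr_ge0 a; rewrite /F invfM; clear - F1; lra.
have F3 : a * a' <= 4 * F.
  have := ler_wpM2l (ltW a0) aa; have : 0 <= e ^+ 12 / (2 * a).
    by rewrite divr_ge0 ?(ltW (epow 12)) ?mulr_ge0 ?(ltW a0).
  rewrite /F; clear - F2; lra.
have F4 : a' <= 2 / e ^+ 8 * F.
  by rewrite mulrAC ler_pdivlMr//; have := ler_wpM2r (ltW e8) a2'; clear - fl; lra.
have k3 : e ^+ 3 * (4 * (a' * `|a - a'|) + 2 * (e ^+ 12 * M)
   + 4 * (e ^+ 12 / a * `|a - a'|) + 9 * e ^+ 3 * (a * a' * M)) <=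
  e ^+ 3 * (4 * (2 / e ^+ 8 * F * `|a - a'|) + 2 * (2 * e ^+ 4 * F * M)
   + 4 * (2 * F * `|a - a'|) + 9 * e ^+ 3 * (4 * F * M)).
  rewrite ler_wpM2l ?(ltW e3)//.
  have := ler_wpM2r da F4; have := ler_wpM2r M0 F1; have := ler_wpM2r da F2.
  have := ler_wpM2l (ltW e3) (ler_wpM2r M0 F3).
  clear - F4; lra.
have k4 := ler_wpM2r M0 F1.
rewrite -(ler_pM2r F0).
apply: le_trans (ler_wpM2l (normr_ge0 _) D) _.
apply: (le_trans key).
have FM := mulr_ge0 (ltW F0) M0; have Fa := mulr_ge0 (ltW F0) da.
have e9V : e^-1 ^+ 5 * (F * `|a - a'|) <= e^-1 ^+ 9 * (F * `|a - a'|).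
  rewrite ler_wpM2r// !exprVn lef_pV2 ?posrE ?epow//.
  by have := epowD 5 4; have := epow 5; clear - Fa; lra.
have e0V : F * `|a - a'| <= e^-1 ^+ 9 * (F * `|a - a'|).
  rewrite ler_peMl// exprVn invf_ge1 ?epow//.
  by have := epowD 0 9; rewrite expr0; clear - e9V; lra.
have E8 : e ^+ 3 * (4 * (2 / e ^+ 8 * F * `|a - a'|)) = 8 * (e^-1 ^+ 5 * (F * `|a - a'|)).
  by rewrite exprVn; field; rewrite gt_eqF.
have E9 : 40 / e ^+ 9 * `|a - a'| * F = 40 * (e^-1 ^+ 9 * (F * `|a - a'|)).
  by rewrite exprVn; field; rewrite gt_eqF.
have q4 := ler_wpM2r FM (epowD 0 4); have q7 := ler_wpM2r FM (epowD 0 7).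
have q3 := ler_wpM2r Fa (epowD 0 3); have q6 := ler_wpM2r FM (epowD 0 6).
rewrite !expr0 in q3 q4 q6 q7.
rewrite !(mulrDr (e ^+ 3)) E8 in k3.
rewrite [leRHS]mulrDl E9.
move: (`|den - den'|) k2 k3 k4 e9V e0V q3 q4 q6 q7 FM Fa => z k2 k3 k4 e9V e0V q3 q4 q6 q7 FM Fa.
clear - k2 k3 k4 e9V e0V q3 q4 q6 q7 FM Fa.
clear - k2 k3 k4 e9V e0V q3 q4 q6 q7 FM Fa; lra.
Qed.

End StepEstimates.

(* [lia] preprocesses every hypothesis, so the real ones are cleared first. *)
Ltac int_lia :=
  match goal with K : realType |- _ =>
    repeat match goal with H : ?P |- _ => lazymatch P with context [K] => clear H end end
  end; lia.

(** * The iteration map and its invariant box *)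

Section Steps.
Variable R : realType.
Implicit Types (e a b : R) (U V : int -> R) (n : int).

(* [step] solves the lattice equation at the site [n] for [U n], after [mu] has
   been eliminated through the equation at the site 0 (to the left) or 2 (to the
   right): [den] is the linear coefficient on the left, and [rad] is the value
   of [(U n ^+ 2 - 1) ^+ 2] on the right. *)
Definition rad e b U n :=
  (1 - b ^+ 2) ^+ 2 + e ^+ 12 * ((U 1 + U 3) / b - (U (n - 1) + U (n + 1)) / U n).

Definition den e a U n :=
  2 * a ^+ 2 - a ^+ 4 + e ^+ 12 * (U (-1) + U 1) / a - 2 * U n ^+ 2 + U n ^+ 4.

Definition step e a b U n :=
  if n < 0 then - e ^+ 12 * (U (n - 1) + U (n + 1)) / den e a U n
  else if n == 0 then - a
  else if n == 2 then b
  else Num.sqrt (1 + Num.sqrt (rad e b U n)).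

(** The sides are chosen for the sign of the gap: the left parameter is at least 1 for
    [a = e ^+ 12 / 2] and [a = 1], and the right one is at most 0 for [b = e ^+ 4 / 2] and
    [b = 3 / 2]. *)
Definition in_rect e a b :=
  (e ^+ 12 / 2 <= a <= 1) /\ (e ^+ 4 / 2 <= b <= 3 / 2).

(** [eta] shrinks the box: solutions lie in the one with [eta = e ^+ 16], and this margin later
    absorbs nearby orbits. The lower bound [1 + e ^+ 6 / 4] at site 1 is the excess that keeps [mu]
    away from 1. *)
Definition box e eta a b U : Prop :=
  [/\ U 0 = - a, U 2 = b,
   1 + e ^+ 6 / 4 + eta <= U 1 <= 1 + `|1 - b ^+ 2| + e ^+ 5 - eta,
   forall n, n < 0 -> `|U n| <= e ^+ 3 * a - eta &
   forall n, 3 <= n -> 1 + eta <= U n <= 1 + `|1 - b ^+ 2| + e ^+ 8 - eta].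

Lemma int_cases n : n < 0 \/ n = 0 \/ n = 1 \/ n = 2 \/ 3 <= n.
Proof.
have [n0|n0] := ltP n 0; first by left.
have [->|n1] := eqVneq n 0; first by right; left.
have [->|n2] := eqVneq n 1; first by right; right; left.
have [->|n3] := eqVneq n 2; first by right; right; right; left.
by do 4 right; lia.
Qed.

Variable e : R.
Hypotheses (e_gt0 : 0 < e) (e_small : e <= 1 / 1000).

Let epow := epow_gt0 e_gt0.
Arguments epow k%_N.
Let epowD := epowD_le e_gt0 e_small.
Arguments epowD (j k)%_N.

Lemma in_rect_gt0 a b : in_rect e a b -> 0 < a /\ 0 < b.
Proof.
case=> /andP[a1 _] /andP[b1 _].
by have := epow 12; have := epow 4; split; lra.
Qed.

Lemma boxW eta a b U : 0 <= eta -> box e eta a b U -> box e 0 a b U.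
Proof.
move=> eta0 [U0 U2 /andP[? ?] Um Up]; split=> //.
- by apply/andP; split; lra.
- by move=> n /Um; lra.
- by move=> n /Up/andP[? ?]; apply/andP; split; lra.
Qed.

Section InBox.
Variables (a b : R) (U : int -> R).
Hypotheses (ab : in_rect e a b) (bU : box e 0 a b U).
Let eb : R := `|1 - b ^+ 2|.

Lemma box_right n : 2 <= n -> 1 - eb <= U n <= 1 + eb + e ^+ 8.
Proof.
have [_ /andP[b1 b2]] := ab.
move=> n2; have [U0 U2 _ _ Up] := bU.
have eb0 : 0 <= eb := normr_ge0 _.
have [->|n3] := eqVneq n 2.
  rewrite U2; have := b_near1 e_gt0 b1; rewrite -/eb => /andP[? ?].
  by have := epow 8 => ?; apply/andP; split; lra.
have /andP[? ?] : 1 + 0 <= U n <= 1 + eb + e ^+ 8 - 0 by apply: Up; int_lia.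
by apply/andP; split; lra.
Qed.

Lemma box_U1 : 1 + e ^+ 6 / 4 <= U 1 <= 1 + eb + e ^+ 5.
Proof. by have [_ _ /andP[? ?] _ _] := bU; rewrite /eb; apply/andP; split; lra. Qed.

Lemma box_eb : 0 <= eb <= 5 / 4.
Proof.
have [_ /andP[b1 b2]] := ab; rewrite normr_ge0; exact: (eb_le e_gt0 b1 b2).
Qed.

Lemma box_ge1 n : n = 1 \/ 3 <= n -> 1 <= U n <= 5 / 2.
Proof.
have /andP[? ?] := box_U1; have /andP[? ?] := box_eb; have := epow 6 => ?.
have p5 := epowD 0 5; have p8 := epowD 0 8; rewrite !expr0 in p5 p8.
case=> [->|n3]; first by apply/andP; split; lra.
have [_ _ _ _ /(_ n n3)] := bU; rewrite -/eb => /andP[? ?].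
by apply/andP; split; lra.
Qed.

Lemma box_left n : n <= 0 -> `|U n| <= a.
Proof.
have [/andP[a1 a2] _] := ab; have [a0 _] := in_rect_gt0 ab.
have [U0 _ _ Um _] := bU; move=> n0; have [->|n1] := eqVneq n 0.
  by rewrite U0 normrN ger0_norm// ltW.
have := Um n; have -> : n < 0 by int_lia.
move=> /(_ isT); have := ler_wpM2r (ltW a0) (epowD 0 3); rewrite expr0.
by have := epow 3; lra.
Qed.

Lemma box_neg n : n < 0 -> `|U n| <= e ^+ 3 * a.
Proof. by have [_ _ _ Um _] := bU; move=> /Um; lra. Qed.

Lemma box_sum13 : 2 + e ^+ 6 / 4 <= U 1 + U 3 <= 5.
Proof.
have /andP[? _] := box_U1; have /andP[_ ?] := box_ge1 (or_introl erefl).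
have /andP[? ?] : 1 <= U 3 <= 5 / 2 by apply: box_ge1; right.
by apply/andP; split; lra.
Qed.

Lemma box_neighbours n : 1 <= n -> n != 2 -> -1 <= U (n - 1) + U (n + 1) <= 5.
Proof.
move=> n1 n2; have [/andP[a1 a2] /andP[b1 b2]] := ab.
have [a0 b0] := in_rect_gt0 ab.
have p8 := epowD 0 8; rewrite expr0 in p8; have /andP[? ?] := box_eb.
have [->|n3] := eqVneq n 1.
  have [U0 U2 _ _ _] := bU.
  by rewrite subrr (_ : 1 + 1 = 2)// U0 U2; apply/andP; split; clear - a2 b2 a0 b0 p8 U2; lra.
have /andP[? ?] : 1 - eb <= U (n - 1) <= 1 + eb + e ^+ 8 by apply: box_right; int_lia.
have /andP[? ?] : 1 - eb <= U (n + 1) <= 1 + eb + e ^+ 8 by apply: box_right; int_lia.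
by apply/andP; split; lra.
Qed.

Lemma box_rad_ge n : 3 <= n -> eb ^+ 2 / 2 + e ^+ 18 / 8 <= rad e b U n.
Proof.
move=> n3; have [_ /andP[b1 b2]] := ab; have /andP[s1 s2] := box_sum13.
apply: rad_ge => //; first exact: nu_ge.
  have [a0 b0] := in_rect_gt0 ab; have [_ U2 _ _ Up] := bU.
  have ge0 (m : int) : 2 <= m -> 0 <= U m <= 1 + eb + e ^+ 8.
    move=> m2; have /andP[_ ->] := box_right m2; rewrite andbT.
    have [->|m3] := eqVneq m 2; first by rewrite U2 ltW.
    have /andP[? _] : 1 <= U m <= 5 / 2 by apply: box_ge1; right; int_lia.
    by lra.
  have /andP[? ?] : 0 <= U (n - 1) <= 1 + eb + e ^+ 8 by apply: ge0; int_lia.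
  have /andP[? ?] : 0 <= U (n + 1) <= 1 + eb + e ^+ 8 by apply: ge0; int_lia.
  by rewrite -/eb; apply/andP; split; lra.
by have /andP[] : 1 <= U n <= 5 / 2 by apply: box_ge1; right.
Qed.

Lemma box_rad1_ge : eb ^+ 2 / 2 + e ^+ 12 / 2 <= rad e b U 1.
Proof.
have [_ /andP[b1 b2]] := ab; have /andP[s1 s2] := box_sum13.
apply: rad1_ge => //; first exact: nu_ge.
  have [a0 b0] := in_rect_gt0 ab; have [U0 U2 _ _ Up] := bU.
  rewrite subrr (_ : 1 + 1 = 2)// U0 U2; have := b_near1 e_gt0 b1 => /andP[_ ?].
  by lra.
by have /andP[] : 1 <= U 1 <= 5 / 2 by apply: box_ge1; left.
Qed.

Lemma box_rad_pos n : n = 1 \/ 3 <= n -> eb ^+ 2 / 2 + e ^+ 18 / 8 <= rad e b U n.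
Proof.
case=> [->|]; last exact: box_rad_ge.
by have := box_rad1_ge; have := epowD 12 6; have := epow 12; lra.
Qed.

Lemma box_den_ge n : n < 0 -> a ^+ 2 / 2 + e ^+ 12 / (2 * a) <= den e a U n.
Proof.
move=> n0; have [aa _] := ab; apply: den_ge => //; first exact: box_neg.
  exact: box_neg.
by have /andP[] : 1 <= U 1 <= 5 / 2 by apply: box_ge1; left.
Qed.

Lemma box_floor : e ^+ 8 / 2 <= a ^+ 2 / 2 + e ^+ 12 / (2 * a).
Proof. by have [a0 _] := in_rect_gt0 ab; apply: floor_ge. Qed.

Lemma step_root n : n = 1 \/ 3 <= n ->
  exists x, [/\ 0 <= x, x ^+ 2 = rad e b U n, 1 <= step e a b U n &
    step e a b U n ^+ 2 = 1 + x].
Proof.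
move=> n13; exists (Num.sqrt (rad e b U n)).
have r0 : 0 <= rad e b U n.
  apply: le_trans (box_rad_pos n13); have := epow 18; have := sqr_ge0 eb; lra.
have -> : step e a b U n = Num.sqrt (1 + Num.sqrt (rad e b U n)).
  by rewrite /step; case: n13 => [->//|n3]; rewrite !ifF//; int_lia.
have x0 := sqrtr_ge0 (rad e b U n).
have y0 : 0 <= 1 + Num.sqrt (rad e b U n) by lra.
split=> //; rewrite ?sqr_sqrtr//.
by rewrite -[leLHS]sqrtr1 ler_wsqrtr//; lra.
Qed.

Lemma step_left n : n < 0 ->
  step e a b U n * den e a U n = - e ^+ 12 * (U (n - 1) + U (n + 1)).
Proof.
move=> n0; rewrite /step n0 divfK// gt_eqF//.
by have := box_den_ge n0; have := box_floor; have := epow 8; lra.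
Qed.

(** On the right the room comes from the halving in [root_upper], on the left from the quotient by
    [den]. The size of the margin is dictated by the left sites, whose bound [e ^+ 3 * a] may be as
    small as [e ^+ 15 / 2]. *)
Lemma step_box : box e (e ^+ 16) a b (step e a b U).
Proof.
have [/andP[a1 a2] /andP[b1 b2]] := ab; have [a0 b0] := in_rect_gt0 ab.
have /andP[eb0 eb1] := box_eb; have /andP[s1 s2] := box_sum13.
have /andP[u11 u12] := box_U1.
have e16 := epow 16.
have pP : 1 / 2 <= b -> (U 1 + U 3) / b <= 2 + 12 * eb + 2 * e ^+ 5.
  move=> b12; apply: (nu_le e_gt0) => //; last by have := epow 6 => ?; apply/andP; split; lra.
  have [_ _ _ _ /(_ 3 (lexx _))] := bU; rewrite -/eb => /andP[_ ?].
  by have := epowD 5 3; have := epow 5; lra.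
split=> //.
- have [x [x0 xr t1 tx]] := step_root (or_introl erefl).
  have xge := box_rad1_ge; rewrite -xr in xge.
  have [n1 n2] : -1 <= U (1 - 1) + U (1 + 1) /\ U (1 - 1) + U (1 + 1) <= 5.
    by apply/andP; apply: box_neighbours.
  have /andP[v1 v2] := box_ge1 (or_introl erefl).
  apply/andP; split.
    have x6 : 7 / 10 * e ^+ 6 <= x.
      apply: ler_of_sqr => //; have := sqr_ge0 eb; have := epow 12; clear - xge n1 n2 v1 v2; lra.
    apply: ler_of_sqr; first (clear - x0 xr t1 tx v2; lra).
    rewrite tx; have := epowD 6 10; have := epowD 6 6; have := epow 6.
    have := epowD 16 6; have := epowD 16 16; have := epow 16.
    clear - xge n2 v1 v2 x6; lra.
  have [b12|b12] := leP b (1 / 2).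
    apply: (@root_upper _ x _ (eb + 1 / 4)) => //; try (clear - eb0 eb1 xr t1; lra).
      by rewrite xr; apply: rad_le_small.
    have := eb_ge_small e_gt0 b1 b2 b12; rewrite -/eb.
    by have := epowD 0 16; have := epow 5; rewrite expr0; clear - xge n1 n2 v1 v2; lra.
  apply: (@root_upper _ x _ (eb + e ^+ 5)) => //; have e5 := epow 5; try (clear - u12 xr t1 v1; lra).
    by rewrite xr; apply: rad1_le => //; [exact: ltW|apply: pP; exact: ltW].
  by have := epowD 5 11; rewrite -/eb; clear - eb0 eb1 u11 u12 e16 pP; lra.
- move=> n n0; have n1 : `|U (n - 1)| <= a by apply: box_left; int_lia.
  have n2 : `|U (n + 1)| <= a by apply: box_left; int_lia.
  have den8 : e ^+ 8 / 2 <= den e a U n by apply: le_trans box_floor (box_den_ge n0).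
  have e8 := epow 8; have d0 : 0 < den e a U n by lra.
  have : `|step e a b U n| * den e a U n <= e ^+ 12 * (2 * a).
    rewrite -[X in _ * X](gtr0_norm d0) -normrM step_left// normrM normrN.
    rewrite (gtr0_norm (epow 12)) ler_wpM2l ?(ltW (epow 12))//.
    by apply: le_trans (ler_normD _ _) _; lra.
  have := ler_wpM2l (normr_ge0 (step e a b U n)) den8 => h1 h2.
  have {h1 h2}h : `|step e a b U n| <= 4 * e ^+ 4 * a.
    rewrite -(ler_pM2r (_ : 0 < e ^+ 8 / 2)); first (clear - den8 e8 d0 h1 h2; lra).
    by rewrite divr_gt0.
  have := ler_wpM2r (ltW a0) (epowD 3 1); have := epowD 15 1.
  by have := ler_wpM2l (ltW (epow 3)) a1; have := epow 15; clear - n2 den8 e8 d0 h; lra.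
- move=> n n3; have [x [x0 xr t1 tx]] := step_root (or_intror n3).
  have xge := box_rad_ge n3; rewrite -xr in xge.
  have [w1 w2] : -1 <= U (n - 1) + U (n + 1) /\ U (n - 1) + U (n + 1) <= 5.
    by apply/andP; apply: box_neighbours; int_lia.
  have /andP[v1 v2] := box_ge1 (or_intror n3).
  apply/andP; split.
    have x9 : e ^+ 9 / 3 <= x.
      apply: ler_of_sqr => //; have := sqr_ge0 eb; have := epow 18; clear - tx xge w2; lra.
    apply: ler_of_sqr; first (clear - x0 xr t1 v1; lra).
    rewrite tx; have := epowD 9 7; have := epow 9.
    have := epowD 16 16; have := epow 16; clear - tx xge x9; lra.
  have [b12|b12] := leP b (1 / 2).
    apply: (@root_upper _ x _ (eb + 1 / 4)) => //; try (clear - eb0 xr t1; lra).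
      by rewrite xr; apply: rad_le_small.
    have := eb_ge_small e_gt0 b1 b2 b12; rewrite -/eb.
    by have := epowD 0 16; have := epow 8; rewrite expr0; clear - tx w1 w2; lra.
  have e8 := epow 8.
  apply: (@root_upper _ x _ (eb + e ^+ 8)) => //; try (clear - eb0 t1 tx e8; lra).
    have /andP[w3 _] : 1 - eb <= U (n - 1) <= 1 + eb + e ^+ 8 by apply: box_right; int_lia.
    have /andP[w4 _] : 1 - eb <= U (n + 1) <= 1 + eb + e ^+ 8 by apply: box_right; int_lia.
    have /andP[_ w5] : 1 - eb <= U n <= 1 + eb + e ^+ 8 by apply: box_right; int_lia.
    have w6 : 0 <= U (n - 1).
      have [->|m3] := eqVneq n 3; first by have [_ -> _ _ _] := bU; exact: ltW.
      have /andP[] : 1 <= U (n - 1) <= 5 / 2 by apply: box_ge1; right; int_lia.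
      clear - b12 e8 w3 w4 w5; lra.
    have /andP[w7 _] : 1 <= U (n + 1) <= 5 / 2 by apply: box_ge1; right; int_lia.
    rewrite xr; apply: rad_le => //; rewrite -/eb; [exact: ltW|apply: pP; exact: ltW| | |].
    - by clear - b12 e8 w3 w4 w5; lra.
    - by clear - w3 w4 w5 w6 w7; lra.
    - by apply/andP; split.
  by have := epowD 8 8; rewrite -/eb; clear - eb0 v1 v2 b12 e8; lra.
Qed.

End InBox.
End Steps.

(** * Two-sided solutions: existence, uniqueness, dependence on [(a, b)] *)

Section Solutions.
Variables (R : realType) (e : R).
Hypotheses (e_gt0 : 0 < e) (e_small : e <= 1 / 1000).
Implicit Types (a b mu : R) (U V : int -> R) (n : int).

Let epow := epow_gt0 e_gt0.
Arguments epow k%_N.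
Let epowD := epowD_le e_gt0 e_small.
Arguments epowD (j k)%_N.

(** The factor 1/2 holds in [U]; the constant in the parameters is the reciprocal of the smallest
    root, which is of order [e ^+ 9]. *)
Lemma step_lip a b a' b' U V (M : R) :
  in_rect e a b -> in_rect e a' b' -> a' <= 2 * a ->
  box e 0 a b U -> box e 0 a' b' V -> (forall n, `|U n - V n| <= M) ->
  forall n, `|step e a b U n - step e a' b' V n| <=
    M / 2 + 100 / e ^+ 9 * (`|a - a'| + `|b - b'|).
Proof.
move=> ab ab' aa bU bV UV n.
have M0 := le_trans (normr_ge0 _) (UV 0).
have da := normr_ge0 (a - a'); have db := normr_ge0 (b - b').
have e9 : 1 <= 1 / e ^+ 9.
  by rewrite ler_pdivlMr ?epow// mul1r; have := epowD 0 9; rewrite expr0; lra.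
have sums m k : `|U m + U k - (V m + V k)| <= 2 * M.
  rewrite opprD addrACA; apply: le_trans (ler_normD _ _) _.
  by have := UV m; have := UV k; lra.
have U1 : 1 <= U 1 <= 5 / 2 by apply: (box_ge1 e_gt0 e_small ab bU); left.
have V1 : 1 <= V 1 <= 5 / 2 by apply: (box_ge1 e_gt0 e_small ab' bV); left.
have roots : n = 1 \/ 3 <= n -> `|step e a b U n - step e a' b' V n| <=
    M / 2 + 100 / e ^+ 9 * (`|a - a'| + `|b - b'|).
  move=> n13.
  have [x [x0 xr t1 tx]] := step_root e_gt0 e_small ab bU n13.
  have [x' [x'0 xr' t1' tx']] := step_root e_gt0 e_small ab' bV n13.
  have h := root_lip x0 x'0 t1 t1' tx tx' xr xr'.
  have xge := box_rad_pos e_gt0 e_small ab bU n13; rewrite -xr in xge.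
  have [abl abr] := ab; have [abl' abr'] := ab'.
  have /andP[u1 _] := box_ge1 e_gt0 e_small ab bU n13.
  have /andP[v1 _] := box_ge1 e_gt0 e_small ab' bV n13.
  have [q1 q2] : 1 <= n /\ n != 2 by case: n13 => [->//|]; split; int_lia.
  have p5 : `|V 1 + V 3| <= 5.
    have /andP[s1 s2] := box_sum13 e_gt0 e_small ab' bV; have e6 := epow 6.
    by rewrite ger0_norm; clear - s1 s2 e6; lra.
  have s5 : `|V (n - 1) + V (n + 1)| <= 5.
    have /andP[s1 s2] := box_neighbours e_gt0 e_small ab' bV q1 q2.
    by rewrite ler_norml; apply/andP; split; clear - s1 s2; lra.
  have := rad_lip e_gt0 e_small abr abr' p5 s5 u1 v1 (sums _ _) (sums _ _) (UV n) x0 xge.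
  move=> /(le_trans h) {}h.
  have x9 : e ^+ 9 / 3 <= x.
    by apply: ler_of_sqr => //; have := sqr_ge0 (`|1 - b ^+ 2|); have := epow 18; clear - xge; lra.
  have ep := epow 9; have xp : 0 < x by clear - ep x9; lra.
  have hx : x * `|step e a b U n - step e a' b' V n| <=
      x * (M / 2 + 100 / e ^+ 9 * (`|a - a'| + `|b - b'|)).
    have : 100 / 3 * (`|a - a'| + `|b - b'|) <=
        x * (100 / e ^+ 9 * (`|a - a'| + `|b - b'|)).
      rewrite mulrA ler_wpM2r ?addr_ge0// mulrCA mulrA ler_pdivlMr//; clear - h x9; lra.
    by have := mulr_ge0 x0 M0; clear - da db h; lra.
  by move: hx; rewrite ler_pM2l.
have [n0|[nE|[nE|[nE|n3]]]] := int_cases n;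
  [|rewrite nE /step/=|by apply: roots; left|rewrite nE /step/=|by apply: roots; right].
- have [ab1 ab2] := ab; have [ab1' ab2'] := ab'.
  have /andP[u1 u2] := U1; have /andP[v1 v2] := V1.
  have h : `|step e a b U n - step e a' b' V n| <= M / 2 + 40 / e ^+ 9 * `|a - a'|.
    apply: (left_lip e_gt0 e_small ab1 ab1' aa
      (box_neg bU n0) (box_neg bU (n := -1) isT) u1 u2 (box_neg bV n0) _
      (sums (n - 1) (n + 1)) (UV (-1)) (UV 1) (UV n)
      (step_left e_gt0 e_small ab bU n0) (step_left e_gt0 e_small ab' bV n0)).
    have [_ _ _ /(_ n n0) + _] := step_box e_gt0 e_small ab' bV.
    by have := epow 16; clear - v2; lra.
  have := mulr_ge0 (ltW (lt_le_trans ltr01 e9)) da.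
  by have := mulr_ge0 (ltW (lt_le_trans ltr01 e9)) db; clear - h; lra.
- rewrite -opprD normrN.
  have := ler_wpM2r da e9; have := ler_wpM2r db e9; lra.
- have := ler_wpM2r da e9; have := ler_wpM2r db e9; lra.
Qed.

(** The stationary lattice equation for [d = - e ^+ 12], with its sign reversed. *)
Definition lattice_eq mu U n :=
  e ^+ 12 * (U (n + 1) + U (n - 1) - 2 * U n) + mu * U n - 2 * U n ^+ 3 + U n ^+ 5.

(* All equations of the lattice hold, except that the parameters to the left
   and to the right of the interface need not agree. *)
Definition two_sided_sol a b U muL muR :=
  [/\ box e 0 a b U, forall n, n <= 0 -> lattice_eq muL U n = 0 &
      forall n, 1 <= n -> lattice_eq muR U n = 0].

(** The parameter solved for at site 0, where [U 0 = - a], and then at site 2, where [U 2 = b]. For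
    fixed neighbours the first has a minimum in [a] at the scale [e ^+ 4], the second a maximum in
    [b] near 1: these are the two folds. *)
Definition left_mu a U := 2 * a ^+ 2 - a ^+ 4 + e ^+ 12 * (U (-1) + U 1) / a + 2 * e ^+ 12.
Definition right_mu b U := 1 - (1 - b ^+ 2) ^+ 2 - e ^+ 12 * ((U 1 + U 3) / b - 2).

Lemma two_sided_mu a b U muL muR : in_rect e a b ->
  two_sided_sol a b U muL muR -> muL = left_mu a U /\ muR = right_mu b U.
Proof.
move=> ab [[U0 U2 _ _ _] Um Up]; have [a0 b0] := in_rect_gt0 e_gt0 ab.
have an0 : a != 0 by rewrite gt_eqF.
have bn0 : b != 0 by rewrite gt_eqF.
split.
  have := Um 0 (lexx _); rewrite /lattice_eq add0r sub0r U0 => h.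
  apply: (mulIf an0); rewrite /left_mu.
  have -> : (2 * a ^+ 2 - a ^+ 4 + e ^+ 12 * (U (-1) + U 1) / a + 2 * e ^+ 12) * a =
    2 * a ^+ 3 - a ^+ 5 + e ^+ 12 * (U (-1) + U 1) + 2 * e ^+ 12 * a by field.
  by lra.
have := Up 2 isT; rewrite /lattice_eq (_ : 2 + 1 = 3)// (_ : 2 - 1 = 1)// U2 => h.
apply: (mulIf bn0); rewrite /right_mu.
have -> : (1 - (1 - b ^+ 2) ^+ 2 - e ^+ 12 * ((U 1 + U 3) / b - 2)) * b =
  (1 - (1 - b ^+ 2) ^+ 2) * b - e ^+ 12 * (U 1 + U 3 - 2 * b) by field.
by lra.
Qed.

Lemma sqrt_nested (t r : R) : 1 <= t -> (t ^+ 2 - 1) ^+ 2 = r ->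
  Num.sqrt (1 + Num.sqrt r) = t.
Proof.
move=> t1 <-; rewrite sqrtr_sqr ger0_norm; last nra.
by rewrite addrC subrK sqrtr_sqr ger0_norm//; lra.
Qed.

(** Inserting the parameters of [two_sided_mu] turns the equation at each site into the fixed-point
    equation; [step_two_sided] is the converse. *)
Lemma two_sided_step a b U muL muR : in_rect e a b ->
  two_sided_sol a b U muL muR -> forall n, step e a b U n = U n.
Proof.
move=> ab sU; have [muLE muRE] := two_sided_mu ab sU.
have [bU Um Up] := sU; have [U0 U2 _ _ _] := bU => n.
have [a0 b0] := in_rect_gt0 e_gt0 ab.
have roots : n = 1 \/ 3 <= n -> step e a b U n = U n.
  move=> n13; have /andP[u1 _] := box_ge1 e_gt0 e_small ab bU n13.
  have -> : step e a b U n = Num.sqrt (1 + Num.sqrt (rad e b U n)).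
    by rewrite /step; case: n13 => [->//|n3]; rewrite !ifF//; int_lia.
  apply: sqrt_nested => //; have := Up n; have -> : 1 <= n by int_lia.
  move=> /(_ isT); rewrite muRE /lattice_eq /right_mu /rad => h.
  have un0 : U n != 0 by rewrite gt_eqF//; lra.
  apply: (mulIf un0).
  have -> : ((1 - b ^+ 2) ^+ 2 + e ^+ 12 * ((U 1 + U 3) / b -
     (U (n - 1) + U (n + 1)) / U n)) * U n = (1 - b ^+ 2) ^+ 2 * U n +
     e ^+ 12 * ((U 1 + U 3) / b * U n - (U (n - 1) + U (n + 1))).
    by field; rewrite un0 gt_eqF.
  by lra.
have [n0|[nE|[nE|[nE|n3]]]] := int_cases n;
  [|by rewrite nE /step/=|by apply: roots; left|by rewrite nE /step/=|by apply: roots; right].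
rewrite /step n0; have := box_den_ge e_gt0 e_small ab bU n0.
have := box_floor e_gt0 ab; have := epow 8 => e8 fl dge.
have dn0 : den e a U n != 0 by rewrite gt_eqF//; lra.
apply: (mulIf dn0); rewrite divfK//.
have := Um n (ltW n0); rewrite muLE /lattice_eq /left_mu /den; lra.
Qed.

Lemma step_two_sided a b U : in_rect e a b -> box e 0 a b U ->
  (forall n, step e a b U n = U n) ->
  two_sided_sol a b U (left_mu a U) (right_mu b U).
Proof.
move=> ab bU sU; have [U0 U2 _ _ _] := bU.
have [a0 b0] := in_rect_gt0 e_gt0 ab.
have roots n : n = 1 \/ 3 <= n -> lattice_eq (right_mu b U) U n = 0.
  move=> n13; have /andP[u1 _] := box_ge1 e_gt0 e_small ab bU n13.
  have [x [x0 xr _ +]] := step_root e_gt0 e_small ab bU n13; rewrite sU => tx.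
  have un0 : U n != 0 by rewrite gt_eqF//; lra.
  have : (U n ^+ 2 - 1) ^+ 2 * U n = rad e b U n * U n by rewrite tx addrC addKr xr.
  rewrite /rad /lattice_eq /right_mu.
  have -> : ((1 - b ^+ 2) ^+ 2 + e ^+ 12 * ((U 1 + U 3) / b -
     (U (n - 1) + U (n + 1)) / U n)) * U n = (1 - b ^+ 2) ^+ 2 * U n +
     e ^+ 12 * ((U 1 + U 3) / b * U n - (U (n - 1) + U (n + 1))).
    by field; rewrite un0 gt_eqF.
  by lra.
split=> // n; have [n0|[nE|[nE|[nE|n3]]]] := int_cases n; try by int_lia.
- move=> _; have := step_left e_gt0 e_small ab bU n0.
  by rewrite sU /den /lattice_eq /left_mu; lra.
- move=> _; rewrite nE /lattice_eq add0r sub0r U0 /left_mu.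
  by field; rewrite gt_eqF.
- by move=> _; apply: roots; left.
- move=> _; rewrite nE /lattice_eq (_ : 2 + 1 = 3)// (_ : 2 - 1 = 1)// U2 /right_mu.
  by field; rewrite gt_eqF.
- by move=> _; apply: roots; right.
Qed.

Lemma two_sided_exists a b : in_rect e a b ->
  exists U, two_sided_sol a b U (left_mu a U) (right_mu b U).
Proof.
move=> ab; have [/andP[a1 a2] /andP[b1 b2]] := ab; have [a0 b0] := in_rect_gt0 e_gt0 ab.
pose eb := `|1 - b ^+ 2|.
have eb0 : 0 <= eb := normr_ge0 _.
have eb1 : eb <= 5 / 4 := eb_le e_gt0 b1 b2.
(* [lo] and [hi] coincide at sites 0 and 2, which pins the values [- a] and [b]. *)
pose lo n := if n < 0 then - (e ^+ 3 * a) else if n == 0 then - a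
  else if n == 1 then 1 + e ^+ 6 / 4 else if n == 2 then b else 1.
pose hi n := if n < 0 then e ^+ 3 * a else if n == 0 then - a
  else if n == 1 then 1 + eb + e ^+ 5 else if n == 2 then b else 1 + eb + e ^+ 8.
have ge3F n : 3 <= n -> [/\ (n < 0) = false, (n == 0) = false, (n == 1) = false & (n == 2) = false].
  by move=> n3; split; int_lia.
have KboxE U : (forall n, lo n <= U n <= hi n) -> box e 0 a b U.
  move=> UK; split.
  - by have := UK 0; rewrite /lo /hi/= => /le_anti.
  - by have := UK 2; rewrite /lo /hi/= => /le_anti.
  - by have := UK 1; rewrite /lo /hi/= addr0 subr0.
  - by move=> n n0; have := UK n; rewrite /lo /hi n0 subr0 ler_norml.
  - move=> n n3; have := UK n; rewrite addr0 subr0 /lo /hi.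
    by have [-> -> -> ->] := ge3F n n3.
have boxKE U : box e 0 a b U -> forall n, lo n <= U n <= hi n.
  move=> [U0 U2 U1 Um Up] n; rewrite /lo /hi.
  have [n0|[->|[->|[->|n3]]]] := int_cases n => /=.
  - by have := Um n n0; rewrite n0 subr0 ler_norml.
  - by rewrite U0 lexx.
  - by move: U1; rewrite addr0 subr0.
  - by rewrite U2 lexx.
  - have := Up n n3; rewrite addr0 subr0.
    by have [-> -> -> ->] := ge3F n n3.
have pw k : e ^+ k.+1 <= 1 by rewrite exprn_ile1 ?(ltW e_gt0)//; move: e_small; lra.
have lohi n : lo n <= hi n /\ hi n - lo n <= 5.
  have p3 := epow 3; have p5 := epow 5; have p8 := epow 8; have p6 := epow 6.
  have := pw 4%N; have := pw 7%N; have := pw 2%N; have := pw 5%N => q6 q3 q8 q5.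
  have q65 : e ^+ 6 <= e ^+ 5.
    by have := epowS_le e_gt0 e_small 5%N; clear - e_gt0 e_small p5; lra.
  have ea0 := mulr_ge0 (ltW p3) (ltW a0).
  have ea1 := ler_wpM2l (ltW p3) a2.
  rewrite /lo /hi; clear - p3 p5 p8 p6 q6 q3 q8 q5 q65 ea0 ea1 eb0 eb1 a2 a0 pw; clear pw.
  move: (e ^+ 3 * a) (e ^+ 3) (e ^+ 5) (e ^+ 6) (e ^+ 8) p3 p5 p8 p6 q6 q3 q8 q5 q65 ea0 ea1.
  move=> y3 y y5 y6 y8 p3 p5 p8 p6 q6 q3 q8 q5 q65 ea0 ea1.
  do 4 (case: ifP => _; first by split; lra).
  by split; lra.
have stepK U : (forall n, lo n <= U n <= hi n) ->
    forall n, lo n <= step e a b U n <= hi n.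
  move=> UK; apply: boxKE; apply: (boxW (ltW (epow 16))).
  by apply: step_box => //; exact: KboxE.
have stepC U V : (forall n, lo n <= U n <= hi n) -> (forall n, lo n <= V n <= hi n) ->
    forall M : R, (forall n, `|U n - V n| <= M) ->
    forall n, `|step e a b U n - step e a b V n| <= M / 2.
  move=> UK VK M UV n; have a2a : a <= 2 * a by clear - b2 a0; lra.
  have := step_lip ab ab a2a (KboxE _ UK) (KboxE _ VK) UV n.
  by rewrite !subrr normr0 addr0 mulr0 addr0.
have [U UK sU] := half_contraction_fixpoint (fun n => (lohi n).1)
  (fun n => (lohi n).2) stepK stepC.
by exists U; apply: step_two_sided => //; exact: KboxE.
Qed.

(** Two fixed points for different parameters are compared by [step_lip] and the bootstrap; its a
    priori bound 5 is twice the bound [5 / 2] on the entries of a box. *)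
Lemma two_sided_lip a b a' b' U V muL muR muL' muR' :
  in_rect e a b -> in_rect e a' b' -> a' <= 2 * a ->
  two_sided_sol a b U muL muR -> two_sided_sol a' b' V muL' muR' ->
  forall n, `|U n - V n| <= 200 / e ^+ 9 * (`|a - a'| + `|b - b'|).
Proof.
move=> ab ab' aa sU sV n.
have [bU _ _] := sU; have [bV _ _] := sV.
have bnd W c d (cd : in_rect e c d) : box e 0 c d W -> forall m, `|W m| <= 5 / 2.
  move=> bW m; have [/andP[c1 c2] /andP[d1 d2]] := cd.
  have [c0 d0] := in_rect_gt0 e_gt0 cd.
  have [m0|m1] := leP m 0; first by have := box_left e_gt0 e_small cd bW m0; lra.
  have [mE|m2] := eqVneq m 2.
    by rewrite mE; have [_ -> _ _ _] := bW; rewrite gtr0_norm//; lra.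
  have /andP[? ?] : 1 <= W m <= 5 / 2.
    by apply: (box_ge1 e_gt0 e_small cd bW); int_lia.
  by rewrite ger0_norm//; lra.
have -> : 200 / e ^+ 9 * (`|a - a'| + `|b - b'|) =
  2 * (100 / e ^+ 9 * (`|a - a'| + `|b - b'|)) by ring.
apply: (@half_bootstrap _ int (fun n => U n - V n) 5) => [m|M UV m].
  by apply: le_trans (ler_normB _ _) _; have := bnd _ _ _ ab bU m; have := bnd _ _ _ ab' bV m; lra.
rewrite -(two_sided_step ab sU) -(two_sided_step ab' sV).
exact: step_lip.
Qed.

Lemma two_sided_unique a b U V muL muR muL' muR' : in_rect e a b ->
  two_sided_sol a b U muL muR -> two_sided_sol a b V muL' muR' -> U = V.
Proof.
move=> ab sU sV; apply/funext => n; apply/eqP; rewrite -subr_eq0 -normr_le0.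
have [a0 _] := in_rect_gt0 e_gt0 ab.
have := two_sided_lip ab ab _ sU sV n; rewrite !subrr normr0 addr0 mulr0; apply; lra.
Qed.

(** The power [e ^+ 12] comes from the division by [a], which is only known to be at least
    [e ^+ 12 / 2]. *)
Lemma two_sided_mu_lip a b a' b' U V muL muR muL' muR' :
  in_rect e a b -> in_rect e a' b' -> a' <= 2 * a ->
  two_sided_sol a b U muL muR -> two_sided_sol a' b' V muL' muR' ->
  `|muL - muL'| <= 1000 / e ^+ 12 * (`|a - a'| + `|b - b'|) /\
  `|muR - muR'| <= 1000 / e ^+ 12 * (`|a - a'| + `|b - b'|).
Proof.
move=> ab ab' aa sU sV; have UV := two_sided_lip ab ab' aa sU sV.
have [-> ->] := two_sided_mu ab sU; have [-> ->] := two_sided_mu ab' sV.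
have [bU _ _] := sU; have [bV _ _] := sV.
have [a0 b0] := in_rect_gt0 e_gt0 ab; have [a'0 b'0] := in_rect_gt0 e_gt0 ab'.
have [/andP[a1 a2] /andP[b1 b2]] := ab; have [/andP[a1' a2'] /andP[b1' b2']] := ab'.
have da := normr_ge0 (a - a'); have db := normr_ge0 (b - b').
set D := `|a - a'| + `|b - b'| in UV *.
have D0 : 0 <= D by exact: addr_ge0.
have e12 := epow 12; have e4 := epow 4.
have V1 : 1 <= 1 / e ^+ 12.
  by rewrite ler_pdivlMr// mul1r; have := epowD 0 12; rewrite expr0; clear - D0; lra.
have e3 : 200 / e ^+ 9 * D <= 1 / e ^+ 12 * D.
  rewrite ler_wpM2r// ler_pdivrMr ?epow// mul1r mulrC ler_pdivlMr//.
  by have := epowD 9 3; have := epow 9; clear - D0; lra.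
have sums m k : `|U m + U k - (V m + V k)| <= 2 * (1 / e ^+ 12 * D).
  rewrite opprD addrACA; apply: le_trans (ler_normD _ _) _.
  by have := UV m; have := UV k; clear - e3; lra.
have VD : D <= 1 / e ^+ 12 * D by rewrite ler_peMl.
have ne0 : e != 0 by rewrite gt_eqF.
split.
  have h1 : `|2 * (a ^+ 2 - a' ^+ 2) - (a ^+ 4 - a' ^+ 4)| <= 4 * `|a - a'|.
    rewrite (_ : _ - _ = (a - a') * ((a + a') * (2 - a ^+ 2 - a' ^+ 2))); last by ring.
    rewrite normrM mulrC ler_wpM2r// ler_norml; apply/andP; split; clear - a1 a2 a1' a2'; nra.
  have s4 : `|U (-1) + U 1| <= 4.
    have y1 := @box_neg _ _ _ _ _ bU (-1) isT.
    have /andP[g1 g2] := box_ge1 e_gt0 e_small ab bU (or_introl erefl).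
    have ea := ler_wpM2l (ltW (epow 3)) a2; have := epowD 0 3; rewrite expr0 => e3'.
    apply: le_trans (ler_normD _ _) _; rewrite (@ger0_norm _ (U 1)).
      by clear - y1 g1 g2 e3' ea; lra.
    by clear - y1 g1; lra.
  have h2 := quotient_lip a0 a'0 s4 (sums (-1) 1).
  rewrite /left_mu (_ : _ - _ = 2 * (a ^+ 2 - a' ^+ 2) - (a ^+ 4 - a' ^+ 4) +
    e ^+ 12 * ((U (-1) + U 1) / a - (V (-1) + V 1) / a')); last by ring.
  apply: le_trans (ler_normD _ _) _; rewrite [X in _ + X <= _]normrM (gtr0_norm e12).
  have := ler_wpM2l (ltW e12) h2; rewrite mulrDr.
  have q1 : e ^+ 12 * (2 * (2 * (1 / e ^+ 12 * D)) / a') <= 8 * (1 / e ^+ 12 * D).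
    rewrite (_ : _ * (_ / a') = 4 * D / a'); last by field; rewrite ne0 gt_eqF.
    rewrite ler_pdivrMr// (_ : 8 * _ * a' = 8 * a' * D / e ^+ 12); last by field.
    rewrite ler_pdivlMr//; have := ler_wpM2r D0 a1'; clear - h2; lra.
  have q2 : e ^+ 12 * (4 * `|a - a'| / (a * a')) <= 16 * (1 / e ^+ 12 * D).
    rewrite [leLHS]mulrA ler_pdivrMr ?mulr_gt0//.
    rewrite (_ : 16 * _ * _ = 16 * (a * a') * D / e ^+ 12); last by field.
    rewrite ler_pdivlMr//.
    have h : e ^+ 12 / 2 * (e ^+ 12 / 2) <= a * a' by apply: ler_pM => //; clear - e12 e4 V1; lra.
    have hD : `|a - a'| <= D by rewrite /D; clear - db; lra.
    have := ler_wpM2r D0 h; have := ler_wpM2l (ltW (mulr_gt0 e12 e12)) hD; clear - hD; lra.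
  have hD : `|a - a'| <= D by rewrite /D; clear - db; lra.
  by clear - D0 VD h1 q1 q2 hD; lra.
have h1 : `|(b' - b) * ((b + b') * (2 - b ^+ 2 - b' ^+ 2))| <= 15 * `|b - b'|.
  rewrite normrM [X in X * _]distrC mulrC ler_wpM2r// ler_norml; apply/andP; split; clear - b1 b2 b1' b2'; nra.
have s5 : `|U 1 + U 3| <= 5.
  have /andP[p1 p2] := box_sum13 e_gt0 e_small ab bU; have e6 := epow 6.
  by rewrite ger0_norm; clear - p1 p2 e6; lra.
have h2 := quotient_lip b0 b'0 s5 (sums 1 3).
rewrite /right_mu (_ : _ - _ = - ((b' - b) * ((b + b') * (2 - b ^+ 2 - b' ^+ 2))) -
  e ^+ 12 * ((U 1 + U 3) / b - (V 1 + V 3) / b')); last by ring.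
apply: le_trans (ler_normB _ _) _; rewrite normrN [X in _ + X <= _]normrM (gtr0_norm e12).
have := ler_wpM2l (ltW e12) h2; rewrite mulrDr.
have q1 : e ^+ 12 * (2 * (2 * (1 / e ^+ 12 * D)) / b') <= 8 * (1 / e ^+ 12 * D).
  rewrite (_ : _ * (_ / b') = 4 * D / b'); last by field; rewrite ne0 gt_eqF.
  rewrite ler_pdivrMr// (_ : 8 * _ * b' = 8 * b' * D / e ^+ 12); last by field.
  rewrite ler_pdivlMr//; have := ler_wpM2r D0 b1'; have := ler_wpM2r D0 (epowD 4 8).
  by have := mulr_ge0 (ltW e4) D0; clear - h2; lra.
have q2 : e ^+ 12 * (5 * `|b - b'| / (b * b')) <= 20 * (1 / e ^+ 12 * D).
  rewrite [leLHS]mulrA ler_pdivrMr ?mulr_gt0//.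
  rewrite (_ : 20 * _ * _ = 20 * (b * b') * D / e ^+ 12); last by field.
  rewrite ler_pdivlMr//.
  have h : e ^+ 4 / 2 * (e ^+ 4 / 2) <= b * b' by apply: ler_pM => //; clear - e12 e4 V1; lra.
  have hD : `|b - b'| <= D by rewrite /D; clear - da; lra.
  have := ler_wpM2r D0 h; have := ler_wpM2l (ltW (mulr_gt0 e12 e12)) hD.
  by have := ler_wpM2r D0 (epowD 8 16); have := mulr_ge0 (ltW (epow 8)) D0; clear - hD; lra.
have hD : `|b - b'| <= D by rewrite /D; clear - da; lra.
by clear - D0 VD h1 q1 q2 hD; lra.
Qed.

End Solutions.

(** * A priori estimates for the linearised lattice equation *)

Section LinearEstimates.
Variables (R : realType) (e : R).
Hypotheses (e_gt0 : 0 < e) (e_small : e <= 1 / 1000).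
Implicit Types (a b mu : R) (U v : int -> R) (n : int).

Let epow := epow_gt0 e_gt0.
Arguments epow k%_N.
Let epowD := epowD_le e_gt0 e_small.
Arguments epowD (j k)%_N.

Lemma root_ge6 (c x : R) : 0 <= x -> c ^+ 2 / 2 + e ^+ 12 / 2 <= x ^+ 2 -> 2 / 3 * e ^+ 6 <= x.
Proof.
move=> x0 h; apply: ler_of_sqr => //; have := sqr_ge0 c; have := epow 12; lra.
Qed.

Lemma root_ge9 (c x : R) : 0 <= x -> c ^+ 2 / 2 + e ^+ 18 / 8 <= x ^+ 2 -> e ^+ 9 / 3 <= x.
Proof.
move=> x0 h; apply: ler_of_sqr => //; have := sqr_ge0 c; have := epow 18; lra.
Qed.

(** The derivative of [lattice_eq] at [(mu, U)] in the direction [(m, v)]. *)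
Definition lin_eq mu U v m n :=
  e ^+ 12 * (v (n + 1) + v (n - 1) - 2 * v n)
  + (mu - 6 * U n ^+ 2 + 5 * U n ^+ 4) * v n + m * U n.

Section Linearised.
Variables (a b muL muR : R) (U v : int -> R) (ml mr M D : R).
Hypotheses (ab : in_rect e a b) (sU : two_sided_sol e a b U muL muR).
Hypotheses (vD : forall n, `|v n| <= D).
Hypotheses (vL : forall n, n <= 0 -> `|lin_eq muL U v ml n| <= M).
Hypotheses (vR : forall n, 1 <= n -> `|lin_eq muR U v mr n| <= M).

Let a_gt0 : 0 < a. Proof. by have [] := in_rect_gt0 e_gt0 ab. Qed.
Let b_gt0 : 0 < b. Proof. by have [] := in_rect_gt0 e_gt0 ab. Qed.
Let bU : box e 0 a b U. Proof. by have [] := sU. Qed.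
Let M_ge0 : 0 <= M. Proof. exact: le_trans (normr_ge0 _) (vL (lexx 0)). Qed.

(** The linearised equation at site 2 solved for [mr], with [muR] eliminated through the nonlinear
    equation at the same site. *)
Lemma lin_muR : mr = lin_eq muR U v mr 2 / b - e ^+ 12 * (v 1 + v 3) / b
  + e ^+ 12 * (U 1 + U 3) * v 2 / b ^+ 2 + 4 * b * (1 - b ^+ 2) * v 2.
Proof.
have [_ U2 _ _ _] := bU; have [_ muRE] := two_sided_mu e_gt0 ab sU.
rewrite /lin_eq (_ : 2 + 1 = 3)// (_ : 2 - 1 = 1)// U2 muRE /right_mu.
by field; rewrite gt_eqF.
Qed.

Lemma lin_muL : ml = - lin_eq muL U v ml 0 / a + e ^+ 12 * (v (-1) + v 1) / a
  + e ^+ 12 * (U (-1) + U 1) * v 0 / a ^+ 2 - 4 * a * (1 - a ^+ 2) * v 0.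
Proof.
have [U0 _ _ _ _] := bU; have [muLE _] := two_sided_mu e_gt0 ab sU.
rewrite /lin_eq add0r sub0r U0 muLE /left_mu.
by field; rewrite gt_eqF.
Qed.

(** A bootstrap over site 1 and the sites from 3 on. Eliminating [muR] by the lattice equation at
    the site turns the diagonal coefficient into [4 * U k ^+ 2 * x] minus a coupling, which is at
    least [3 * x * U k]. By [coupling_le] the neighbours enter with factors [e ^+ 3 * x], and
    [|1 - b ^+ 2| <= 3 / 2 * x] keeps the factor of [v 2] bounded after division by [x]; only the
    residual [M] pays a negative power of [e]. *)
Lemma lin_right n : n = 1 \/ 3 <= n ->
  `|v n| <= 7 * `|v 2| + e ^+ 6 * `|v 0| + 10 / e ^+ 13 * M.
Proof.
have [_ /andP[b1 b2]] := ab.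
pose I := {k : int | k = 1 \/ 3 <= k}.
suff sup_n (i : I) : `|v (sval i)| <=
    2 * (7 / 2 * `|v 2| + e ^+ 6 / 2 * `|v 0| + 5 / e ^+ 13 * M).
  move=> n13; apply: le_trans (sup_n (exist _ n n13)) _.
  by rewrite le_eqVlt; apply/orP; left; apply/eqP; field; rewrite gt_eqF.
apply: (@half_bootstrap R I (fun i => v (sval i)) D) => [j|S vS [k k13] /=].
  exact: vD.
have S0 := le_trans (normr_ge0 _) (vS i).
have v1S : `|v 1| <= S := vS (exist _ 1 (or_introl erefl)).
have v3S : `|v 3| <= S := vS (exist _ 3 (or_intror isT)).
have [x [x0 xr _ ux]] := step_root e_gt0 e_small ab bU k13.
rewrite (two_sided_step e_gt0 e_small ab sU) in ux.
have xge := box_rad_pos e_gt0 e_small ab bU k13; rewrite -xr in xge.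
have [c1 c2 c3 c4 c5] := coupling_le e_gt0 e_small b1 b2 x0 xge.
have /andP[u1 u2] := box_ge1 e_gt0 e_small ab bU k13.
have [k1 k2] : 1 <= k /\ k != 2 by case: k13 => [->//|?]; split; int_lia.
have q0 := normr_ge0 (v 2); have p0 := normr_ge0 (v 0).
have e12 := epow 12; have e13 := epow 13; have u0 : 0 < U k by clear - k13 S0 v1S v3S x0 xr ux xge c1 c2 c3 c4 c5 u1 u2 k1; lra.
set X := x / e ^+ 13 * M.
have X0 : 0 <= X by rewrite mulr_ge0 ?M_ge0// divr_ge0// ltW.
have Mx : M <= X.
  rewrite ler_peMl ?M_ge0// ler_pdivlMr//.
  have x9 := root_ge9 x0 xge.
  by have := epowD 9 4; have := epow 9; clear - c2 c3 c4 c5 u1 u2 k1 k2 q0 p0 e12 e13 u0 X0 x9; lra.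
have Mb : M / b <= 6 * X.
  have := ler_wpM2r M_ge0 c4; rewrite div1r mulrC => /le_trans; apply.
  by rewrite /X le_eqVlt; apply/orP; left; apply/eqP; ring.
have e3 := epowD 0 3; rewrite expr0 in e3.
have mrB : `|mr| <= 6 * X + 12 * e ^+ 3 * x * S + 60 * e ^+ 3 * x * `|v 2| + 9 * x * `|v 2|.
  have bV : 0 <= b^-1 by rewrite invr_ge0 ltW ?b_gt0.
  rewrite lin_muR; apply: le_trans (ler_normD _ _) _; apply: lerD; last first.
    rewrite !normrM (ger0_norm (ltW b_gt0)) (@ger0_norm _ 4)//.
    have := ler_wpM2r q0 (ler_pM (ltW b_gt0) (normr_ge0 _) b2 c5); clear - c5 u1 u2 k1 k2 q0 p0 e12 e13 u0 X0 Mx Mb e3 bV; lra.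
  apply: le_trans (ler_normD _ _) _; apply: lerD; last first.
    rewrite (_ : _ / _ = e ^+ 12 / b ^+ 2 * ((U 1 + U 3) * v 2)); last by ring.
    have c0 : 0 <= e ^+ 12 / b ^+ 2 by rewrite divr_ge0 ?sqr_ge0 ?(ltW e12).
    rewrite normrM (normrM (U 1 + U 3)) (ger0_norm c0).
    have /andP[s1 s2] := box_sum13 e_gt0 e_small ab bU.
    have s0 : 0 <= U 1 + U 3 by have := epow 6; clear - u2 k1 k2 q0 p0 e12 e13 u0 X0 Mx Mb e3 bV c0 s1; lra.
    rewrite (ger0_norm s0).
    have := ler_pM c0 (mulr_ge0 s0 q0) c3 (ler_wpM2r q0 s2); clear - k1 k2 q0 p0 e12 e13 u0 X0 Mx Mb e3 bV c0 s1 s2; lra.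
  apply: le_trans (ler_normB _ _) _; apply: lerD.
    by rewrite normrM (ger0_norm bV); apply: le_trans (ler_wpM2r bV (vR _)) Mb.
  have c0 : 0 <= e ^+ 12 / b by rewrite mulr_ge0 ?(ltW e12).
  rewrite mulrAC normrM (ger0_norm c0).
  have v13 : `|v 1 + v 3| <= 2 * S by apply: le_trans (ler_normD _ _) _; clear - vS k13 S0 v1S v3S p0 e12 e13 u0 X0 Mx Mb e3; lra.
  by have := ler_pM c0 (normr_ge0 _) c2 v13; clear - u2 k1 k2 q0 p0 e12 e13 u0 Mx Mb e3 bV c0 v13; lra.
have nb : e ^+ 12 * `|v (k + 1) + v (k - 1)| <=
    6 * e ^+ 3 * x * S + 3 * e ^+ 3 * x * `|v 2| + 3 / 2 * (e ^+ 6 * x * `|v 0|).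
  have eS := ler_wpM2r S0 c1; have eq := ler_wpM2r q0 c1.
  have ep0 : 0 <= e ^+ 6 * x * `|v 0| by rewrite !mulr_ge0// ltW// epow.
  (* Site 1 is the one coupled to [v 0]; its root is of order at least [e ^+ 6], so [v 0] enters
     with a factor [e ^+ 6] only. *)
  have [kE|k3] := eqVneq k 1.
    rewrite kE subrr (_ : 1 + 1 = 2)//.
    have xr1 : x ^+ 2 = rad e b U 1 by rewrite xr kE.
    have xg1 := box_rad1_ge e_gt0 e_small ab bU; rewrite -xr1 in xg1.
    have x6 := root_ge6 x0 xg1.
    have := ler_wpM2l (ltW e12) (ler_normD (v 2) (v 0)).
    have := ler_wpM2r p0 (ler_wpM2l (ltW (epow 6)) x6).
    have := mulr_ge0 (mulr_ge0 (ltW (epow 3)) x0) S0; clear - e12 e13 u0 X0 Mx Mb e3 mrB eS eq ep0 kE xr1; lra.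
  have vp : `|v (k + 1)| <= S.
    by apply: (vS (exist _ (k + 1) (or_intror _))); int_lia.
  have vm : `|v (k - 1)| <= S + `|v 2|.
    have [kE|k4] := eqVneq k 3; first by rewrite kE (_ : 3 - 1 = 2)//; clear - k13 S0 v1S v3S x0 xr ux xge c1 c2 c3 c4 c5 u1 u2 k3; lra.
    have : `|v (k - 1)| <= S by apply: (vS (exist _ (k - 1) (or_intror _))); int_lia.
    by clear - q0 p0 u0 X0 Mx Mb e3 mrB eS eq ep0 k3 vp; lra.
  have := ler_wpM2l (ltW e12) (ler_normD (v (k + 1)) (v (k - 1))).
  have := ler_wpM2l (ltW e12) vp; have := ler_wpM2l (ltW e12) vm; clear - e12 e13 u0 X0 Mx Mb e3 mrB eS eq ep0 k3 vp; lra.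
have E : (4 * U k ^+ 2 * x - e ^+ 12 * (U (k - 1) + U (k + 1)) / U k) * v k =
    lin_eq muR U v mr k - e ^+ 12 * (v (k + 1) + v (k - 1)) - mr * U k.
  have [_ _ /(_ k k1)] := sU; rewrite /lattice_eq => h.
  have xE : x = U k ^+ 2 - 1 by clear - ux xge c1 c2 c3 c4 c5 u1 e3 mrB nb h; lra.
  have -> : e ^+ 12 * (U (k - 1) + U (k + 1)) / U k =
     2 * e ^+ 12 - muR + 2 * U k ^+ 2 - U k ^+ 4.
    apply: (mulIf (lt0r_neq0 u0)); rewrite divfK ?(lt0r_neq0 u0)//; clear - k2 q0 p0 e12 e13 u0 Mx Mb e3 mrB nb h; lra.
  by rewrite xE /lin_eq; ring.
have Cge : 3 * x * U k <= 4 * U k ^+ 2 * x - e ^+ 12 * (U (k - 1) + U (k + 1)) / U k.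
  have /andP[_ s5] := box_neighbours e_gt0 e_small ab bU k1 k2.
  have : e ^+ 12 * (U (k - 1) + U (k + 1)) / U k <= 5 * e ^+ 12.
    rewrite ler_pdivrMr//; have := ler_wpM2l (ltW e12) s5.
    have := ler_wpM2l (ltW e12) u1; clear - k2 q0 p0 e12 e13 u0 Mx Mb e3 mrB nb E; lra.
  have xU : x <= x * U k by rewrite ler_peMr.
  have xU2 : x * U k <= x * U k * U k by rewrite ler_peMr// mulr_ge0// ltW.
  have := ler_wpM2r x0 e3; clear - S0 v1S v3S x0 xr ux xge c1 c2 c3 c4 c5 u1 u2 xU xU2; lra.
have xp : 0 < x.
  have x9 := root_ge9 x0 xge.
  by have := epow 9; clear - e12 e13 u0 X0 Mx Mb e3 mrB nb E Cge x9; lra.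
have h1 : 3 * x * U k * `|v k| <= M + e ^+ 12 * `|v (k + 1) + v (k - 1)| + `|mr| * U k.
  apply: le_trans (ler_wpM2r (normr_ge0 _) Cge) _.
  have -> : (4 * U k ^+ 2 * x - e ^+ 12 * (U (k - 1) + U (k + 1)) / U k) * `|v k| =
     `|(4 * U k ^+ 2 * x - e ^+ 12 * (U (k - 1) + U (k + 1)) / U k) * v k|.
    rewrite normrM [X in _ = X * _]ger0_norm//; apply: le_trans Cge.
    by rewrite !mulr_ge0// ltW.
  rewrite E; apply: le_trans (ler_normB _ _) _; rewrite normrM (ger0_norm (ltW u0)).
  apply: lerD => //; apply: le_trans (ler_normB _ _) _.
  by rewrite normrM (ger0_norm (ltW e12)); apply: lerD => //; exact: vR.
set Y := M + e ^+ 12 * `|v (k + 1) + v (k - 1)| in h1.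
have Y0 : 0 <= Y by rewrite addr_ge0 ?M_ge0// mulr_ge0// ltW.
have h2 : 3 * x * `|v k| <= Y + `|mr|.
  rewrite -(ler_pM2r u0) mulrDl.
  have : Y <= Y * U k by rewrite ler_peMr.
  clear - u0 X0 Mx Mb e3 mrB nb E Cge xp h1; lra.
rewrite -(@ler_pM2r _ (3 * x)); last (clear - e13 u0 Mx Mb e3 mrB nb E Cge xp h1; lra).
rewrite [leRHS](_ : _ = (S / 2 + 7 / 2 * `|v 2| + e ^+ 6 / 2 * `|v 0|) * (3 * x) + 15 * X);
  last by rewrite /X; ring.
have q1 := ler_wpM2r (mulr_ge0 x0 S0) e3; have q2 := ler_wpM2r (mulr_ge0 x0 q0) e3.
have xS := mulr_ge0 x0 S0; have xq := mulr_ge0 x0 q0.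
by rewrite /Y in h2; clear E Cge c1 c2 c3 c4 c5; lra.
Qed.

(** The same bootstrap with a diagonal coefficient of at least [9 / 10 * F]. The variation [ml] is
    multiplied by [U k], at most [e ^+ 3 * a], and this [a] cancels one division by [a] in
    [lin_muL]. *)
Lemma lin_left n : n < 0 ->
  `|v n| <= 40 * e ^+ 3 * `|v 0| + 6 * e ^+ 7 * `|v 1| + 6 / e ^+ 8 * M.
Proof.
have [/andP[a1 a2] _] := ab.
pose I := {k : int | k < 0}.
suff sup_n (i : I) : `|v (sval i)| <=
    2 * (20 * e ^+ 3 * `|v 0| + 3 * e ^+ 7 * `|v 1| + 3 / e ^+ 8 * M).
  move=> n0; apply: le_trans (sup_n (exist _ n n0)) _.
  by rewrite le_eqVlt; apply/orP; left; apply/eqP; field; rewrite gt_eqF.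
apply: (@half_bootstrap R I (fun i => v (sval i)) D) => [j|H vH [k k0] /=].
  exact: vD.
have H0 := le_trans (normr_ge0 _) (vH i).
have vm1H : `|v (-1)| <= H := vH (exist _ (-1) isT).
set F := a ^+ 2 / 2 + e ^+ 12 / (2 * a).
have dge : F <= den e a U k := box_den_ge e_gt0 e_small ab bU k0.
have fl : e ^+ 8 / 2 <= F := box_floor e_gt0 ab.
have e8 := epow 8; have e12 := epow 12; have e3 := epow 3.
have F0 : 0 < F by lra.
have a0 := a_gt0.
have F1 : e ^+ 12 <= 2 * e ^+ 4 * F by have := ler_wpM2l (ltW (epow 4)) fl; lra.
have F2 : e ^+ 12 / a <= 2 * F by have := sqr_ge0 a; rewrite /F invfM; lra.
have F3 : a ^+ 2 <= 2 * F.
  have : 0 <= e ^+ 12 / (2 * a) by rewrite divr_ge0 ?(ltW e12)// mulr_ge0// ltW.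
  rewrite /F; lra.
have F4 : 1 <= 2 / e ^+ 8 * F by rewrite mulrAC ler_pdivlMr//; lra.
have p0 := normr_ge0 (v 0); have w0 := normr_ge0 (v 1).
have aV : 0 <= a^-1 by rewrite invr_ge0 ltW.
have un := box_neg bU k0.
have mlB : `|ml| * a <= M + e ^+ 12 * (H + `|v 1|) + 4 * (e ^+ 12 / a) * `|v 0|
    + 4 * a ^+ 2 * `|v 0|.
  have -> : `|ml| * a = `|ml * a| by rewrite normrM (ger0_norm (ltW a0)).
  rewrite lin_muL (_ : (_ - _) * a = - lin_eq muL U v ml 0 + e ^+ 12 * (v (-1) + v 1)
    + e ^+ 12 / a * ((U (-1) + U 1) * v 0) - 4 * a ^+ 2 * ((1 - a ^+ 2) * v 0)); last first.
    by field; rewrite gt_eqF.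
  apply: le_trans (ler_normB _ _) _; apply: lerD; last first.
    have a4 : 0 <= 4 * a ^+ 2 by have := sqr_ge0 a; lra.
    rewrite normrM (normrM (1 - a ^+ 2)) (ger0_norm a4) ler_wpM2l// ler_piMl//.
    by rewrite ger0_norm; clear - a1 a2 I fl e8 e12 e3 F0 a0 F1 F2 F3 F4 p0 w0 aV un; nra.
  apply: le_trans (ler_normD _ _) _; apply: lerD; last first.
    have ea : 0 <= e ^+ 12 / a by rewrite mulr_ge0// ltW.
    rewrite normrM (normrM (U (-1) + U 1)) (ger0_norm ea).
    rewrite [leRHS](_ : _ = e ^+ 12 / a * (4 * `|v 0|)); last by ring.
    rewrite ler_wpM2l// ler_wpM2r//.
    have y1 := box_neg bU (n := -1) isT.
    have /andP[g1 g2] := box_ge1 e_gt0 e_small ab bU (or_introl erefl).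
    have ea3 := ler_wpM2l (ltW e3) a2; have := epowD 0 3; rewrite expr0 => e3'.
    apply: le_trans (ler_normD _ _) _; rewrite (@ger0_norm _ (U 1)).
      by lra.
    by lra.
  apply: le_trans (ler_normD _ _) _; rewrite normrN; apply: lerD; first exact: vL.
  rewrite normrM (ger0_norm (ltW e12)) ler_wpM2l ?(ltW e12)//.
  by apply: le_trans (ler_normD _ _) _; lra.
have nb : `|v (k + 1) + v (k - 1)| <= 2 * H + `|v 0|.
  have vm : `|v (k - 1)| <= H by apply: (vH (exist _ (k - 1) _)); int_lia.
  have vp : `|v (k + 1)| <= H + `|v 0|.
    have [kE|k4] := eqVneq k (-1); first by rewrite kE (_ : -1 + 1 = 0)//; clear - H0 vm1H dge fl e8 e12 e3 F0 a0 F1 F2 F3 F4 p0 w0 aV; lra.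
    have : `|v (k + 1)| <= H by apply: (vH (exist _ (k + 1) _)); int_lia.
    clear - e12 e3 F0 a0 F1 F2 F3 F4 p0 w0 aV un mlB vm; lra.
  by apply: le_trans (ler_normD _ _) _; clear - e3 F0 a0 F1 F2 F3 F4 p0 w0 aV un mlB vm vp; lra.
have E : (den e a U k - 4 * U k ^+ 2 + 4 * U k ^+ 4) * v k =
    lin_eq muL U v ml k - e ^+ 12 * (v (k + 1) + v (k - 1)) - ml * U k.
  have [muLE _] := two_sided_mu e_gt0 ab sU.
  by rewrite /lin_eq /den muLE /left_mu; ring.
have Cge : 9 / 10 * F <= den e a U k - 4 * U k ^+ 2 + 4 * U k ^+ 4.
  have u2 : U k ^+ 2 <= (e ^+ 3 * a) ^+ 2.
    by rewrite -[U k ^+ 2]sqr_normr; apply: sqr_le.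
  have := ler_wpM2l (ltW (epow 6)) F3; have := ler_wpM2r (ltW F0) (epowD 0 6).
  by rewrite expr0; have := sqr_ge0 (U k ^+ 2); clear - vm1H dge fl e8 e12 e3 w0 aV un mlB nb E u2; lra.
have h1 : 9 / 10 * F * `|v k| <= M + e ^+ 12 * `|v (k + 1) + v (k - 1)| + `|ml| * (e ^+ 3 * a).
  apply: le_trans (ler_wpM2r (normr_ge0 _) Cge) _.
  have -> : (den e a U k - 4 * U k ^+ 2 + 4 * U k ^+ 4) * `|v k| =
     `|(den e a U k - 4 * U k ^+ 2 + 4 * U k ^+ 4) * v k|.
    by rewrite normrM [X in _ = X * _]ger0_norm//; apply: le_trans Cge; lra.
  rewrite E; apply: le_trans (ler_normB _ _) _.
  apply: lerD; last by rewrite normrM ler_wpM2l.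
  apply: le_trans (ler_normB _ _) _; rewrite normrM (ger0_norm (ltW e12)).
  by apply: lerD => //; apply: vL; exact: ltW.
have h2 := ler_wpM2l (ltW e3) mlB; have h3 := ler_wpM2l (ltW e12) nb.
have h4 : e ^+ 12 * (2 * H + `|v 0|) <= 2 * e ^+ 4 * F * (2 * H + `|v 0|).
  by rewrite ler_wpM2r//; clear - H0 F2 F3 F4 p0 w0 aV un mlB nb E Cge h1; lra.
have h5 : e ^+ 3 * (e ^+ 12 * (H + `|v 1|)) <= e ^+ 3 * (2 * e ^+ 4 * F * (H + `|v 1|)).
  by rewrite ler_wpM2l ?(ltW e3)// ler_wpM2r//; clear - H0 F3 F4 p0 w0 aV un mlB nb E Cge h1 h2; lra.
have h6 := ler_wpM2l (ltW e3) (ler_wpM2r p0 F2).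
have h7 := ler_wpM2l (ltW e3) (ler_wpM2r p0 F3).
set X := 1 / e ^+ 8 * M * F.
have MX : M <= 2 * X.
  by have := ler_wpM2r M_ge0 F4; rewrite mul1r /X; clear - un mlB nb E Cge h1 h2 h3 h4 h5 h6 h7 X; lra.
have e3X : e ^+ 3 * M <= 1 / 1000 * M.
  by rewrite ler_wpM2r ?M_ge0//; have := epowD 0 3; rewrite expr0; clear - un mlB nb E Cge h1 h2 h3 h4 h5 h6 h7 X; lra.
rewrite -(ler_pM2r F0).
rewrite [leRHS](_ : _ = (H / 2 + 20 * e ^+ 3 * `|v 0| + 3 * e ^+ 7 * `|v 1|) * F + 3 * X);
  last by rewrite /X; ring.
have FH := mulr_ge0 (ltW F0) H0; have Fp := mulr_ge0 (ltW F0) p0; have Fw := mulr_ge0 (ltW F0) w0.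
have q1 := ler_wpM2r FH (epowD 0 4); have q2 := ler_wpM2r Fp (epowD 3 1).
have q3 := ler_wpM2r FH (epowD 0 7); rewrite !expr0 in q1 q3.
have q4 := mulr_ge0 (ltW e3) Fp; have q5 := mulr_ge0 (ltW (epow 7)) Fw.
have M0 := M_ge0.
clear - Cge h1 h2 h3 h4 h5 h6 h7 X MX e3X FH Fp Fw q2 q1 q3 q4 q5 M0; lra.
Qed.

End Linearised.
End LinearEstimates.

(** * Growth of the gap along rays, by ranges of [a] *)

Section Transversality.
Variables (R : realType) (e : R).
Hypotheses (e_gt0 : 0 < e) (e_small : e <= 1 / 1000).

Let epow := epow_gt0 e_gt0.
Arguments epow k%_N.
Let epowD := epowD_le e_gt0 e_small.
Arguments epowD (j k)%_N.

(** Below the fold [- e ^+ 12 * w / a ^+ 2] dominates the derivative of [left_mu], and [a - e ^+ 4]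
    is negative as well. In each range of [a] the target [31 * e ^+ 8] is chosen to exceed the loss
    [30 * e ^+ 8] of [last_term_le]. *)
Lemma gap_tiny_a (a w B : R) : 0 < a -> a <= e ^+ 4 / 100 -> 99 / 100 <= w -> 0 <= B <= 1 ->
  31 * e ^+ 8 <= (a - e ^+ 4) * (4 * a * (1 - a ^+ 2) - e ^+ 12 * w / a ^+ 2)
    - e ^+ 12 / a * (8 * B + 50 * e ^+ 3 * `|a - e ^+ 4|).
Proof.
move=> a0 ae w1 /andP[B0 B1]; have e4 := epow 4; have e8 := epow 8; have e3 := epow 3.
have a20 : 0 < a ^+ 2 by rewrite exprn_gt0.
set t := e ^+ 12 / a ^+ 2; have t0 : 0 < t by rewrite divr_gt0 ?epow.
have tE : t * a ^+ 2 = e ^+ 12 by rewrite /t divfK ?gt_eqF.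
have -> : e ^+ 12 * w / a ^+ 2 = t * w by rewrite /t; ring.
have -> : e ^+ 12 / a = t * a by rewrite /t; field; rewrite gt_eqF.
have aE : `|a - e ^+ 4| = e ^+ 4 - a by rewrite ler0_norm; lra.
rewrite aE; set A := e ^+ 4 - a.
have A1 : 99 / 100 * e ^+ 4 <= A by rewrite /A; lra.
have A0 : 0 <= A by lra.
have a2 : a ^+ 2 <= e ^+ 8 / 100 ^+ 2.
  have : a ^+ 2 <= (e ^+ 4 / 100) ^+ 2 by apply: sqr_le => //; exact: ltW.
  lra.
have t4 : 100 ^+ 2 * e ^+ 8 <= t * e ^+ 4.
  rewrite -(ler_pM2r a20) [leRHS]mulrAC tE.
  have := ler_wpM2l (ltW e8) a2; lra.
have at1 : 4 * a <= t / 1000.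
  rewrite -(ler_pM2r a20) [leRHS]mulrAC tE.
  have := ler_pM (ltW a0) (ltW a20) ae a2; have := epow 12; lra.
have ta : t * a <= t * e ^+ 4 / 100 by have := ler_wpM2l (ltW t0) ae; clear - at1; lra.
have h1 : A * (t * (98 / 100)) <= (a - e ^+ 4) * (4 * a * (1 - a ^+ 2) - t * w).
  have -> : (a - e ^+ 4) * (4 * a * (1 - a ^+ 2) - t * w) =
     A * (t * w - 4 * a * (1 - a ^+ 2)) by rewrite /A; ring.
  rewrite ler_wpM2l//; have := ler_wpM2l (ltW t0) w1.
  have := mulr_ge0 (ltW a0) (ltW a20); clear - t0 at1; lra.
have h2 := ler_wpM2r (ltW t0) A1.
have h3 : t * a * (8 * B) <= 8 * (t * a).
  by have := mulr_gt0 t0 a0 => ta0; have := ler_wpM2l (ltW ta0) B1; clear - h2; lra.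
have h4 : t * a * (50 * e ^+ 3 * A) <= t * a / 10.
  have e31 : 50 * e ^+ 3 * A <= 1 / 10.
    have A4 : A <= 1 by have := epowD 0 4; rewrite expr0 /A; clear - B a0; lra.
    have := ler_pM (ltW e3) A0 (epowD 0 3) A4; rewrite expr0; clear - A4; lra.
  by have := ler_wpM2l (ltW (mulr_gt0 t0 a0)) e31; clear - e31; lra.
clear - a20 a2 t4 ta h1 h2 h3 h4; lra.
Qed.

(** At the fold of site 0 the [a]-term has no sign but is of order [e ^+ 8], whereas away from
    [b = 1] the [b]-term is of the order of [b], hence at least of order [e ^+ 4]. *)
Lemma gap_small_a (a b w B : R) : e ^+ 4 / 100 <= a <= 100 * e ^+ 4 ->
  e ^+ 4 / 2 <= b -> 28 / 100 <= B -> B <= 1 -> 99 / 100 <= w <= 3 ->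
  31 * e ^+ 8 <= (a - e ^+ 4) * (4 * a * (1 - a ^+ 2) - e ^+ 12 * w / a ^+ 2)
    + 4 * b * (1 + b) * B ^+ 2 - e ^+ 12 / a * (8 * B + 50 * e ^+ 3 * `|a - e ^+ 4|).
Proof.
move=> /andP[a1 a2] b1 B1 B2 /andP[w1 w2].
have e4 := epow 4; have e8 := epow 8; have e3 := epow 3.
have a0 : 0 < a by lra.
have A1 : `|a - e ^+ 4| <= 100 * e ^+ 4 by rewrite ler_norml; apply/andP; split; lra.
have p4 : e ^+ 4 <= 1 / 1000 ^+ 4 by have := epowD 0 4; rewrite expr0.
have aV : a^-1 <= 100 / e ^+ 4.
  by rewrite -(ler_pM2l a0) divff ?gt_eqF// mulrA ler_pdivlMr//; clear - B a1; lra.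
have aV0 : 0 <= a^-1 by rewrite invr_ge0 ltW.
have da : e ^+ 12 / a <= 100 * e ^+ 8.
  apply: le_trans (ler_wpM2l (ltW (epow 12)) aV) _.
  by rewrite mulrA ler_pdivrMr//; clear - p4 aV; lra.
have da0 : 0 <= e ^+ 12 / a by rewrite mulr_ge0// ltW// epow.
have da2 : e ^+ 12 * w / a ^+ 2 <= 3 * 100 ^+ 2 * e ^+ 4.
  rewrite expr2 invfM mulrA mulrAC.
  have h := ler_pM da0 aV0 da aV.
  have -> : e ^+ 12 * w / a / a = e ^+ 12 / a / a * w by ring.
  apply: (@le_trans _ _ (100 * e ^+ 8 * (100 / e ^+ 4) * w)).
    by rewrite ler_wpM2r//; clear - B2 w1; lra.
  have -> : 100 * e ^+ 8 * (100 / e ^+ 4) * w = 100 ^+ 2 * e ^+ 4 * w.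
    by field; rewrite gt_eqF.
  by have := ler_wpM2l (ltW e4) w2; clear - h; lra.
have da20 : 0 <= e ^+ 12 * w / a ^+ 2.
  by rewrite divr_ge0 ?sqr_ge0// mulr_ge0 ?(ltW (epow 12))//; clear - B2 w1; lra.
have h1 : `|(a - e ^+ 4) * (4 * a * (1 - a ^+ 2) - e ^+ 12 * w / a ^+ 2)|
    <= 100 * e ^+ 4 * (4 * 100 ^+ 2 * e ^+ 4).
  rewrite normrM ler_pM// ler_norml.
  have a21 : 0 <= a ^+ 2 <= 1 by rewrite sqr_ge0 expr2; clear - a1 a2 p4; nra.
  have : 0 <= 4 * a * (1 - a ^+ 2) <= 4 * a.
    by case/andP: a21 => ? ?; apply/andP; split; nra.
  by move=> /andP[? ?]; apply/andP; split; lra.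
have h2 : 31 / 100 * b <= 4 * b * (1 + b) * B ^+ 2.
  have B22 : 78 / 1000 <= B ^+ 2 by clear - b1 B1; nra.
  have b0 : 0 < b by clear - a2 b1 a0; lra.
  have := ler_wpM2l (ltW b0) B22.
  have := mulr_ge0 (ltW (mulr_gt0 b0 b0)) (sqr_ge0 B); clear - B22 b0; lra.
have h3 : e ^+ 12 / a * (8 * B + 50 * e ^+ 3 * `|a - e ^+ 4|) <= 100 * e ^+ 8 * 9.
  apply: ler_pM => //; first by have := mulr_ge0 (ltW e3) (normr_ge0 (a - e ^+ 4)); clear - B1; lra.
  have := ler_pM (ltW e3) (normr_ge0 _) (epowD 0 3) A1; rewrite expr0; clear - B2 p4; lra.
have := ler_norm (- ((a - e ^+ 4) * (4 * a * (1 - a ^+ 2) - e ^+ 12 * w / a ^+ 2))).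
rewrite normrN => h4; have := epowD 4 4; lra.
Qed.

(** Above the fold [4 * a] dominates the derivative of [left_mu], and the product is of order
    [a ^+ 2]. *)
Lemma gap_medium_a (a w B : R) : 100 * e ^+ 4 <= a <= 1 / 2 -> 0 <= w <= 3 ->
  0 <= B <= 1 ->
  31 * e ^+ 8 <= (a - e ^+ 4) * (4 * a * (1 - a ^+ 2) - e ^+ 12 * w / a ^+ 2)
    - e ^+ 12 / a * (8 * B + 50 * e ^+ 3 * `|a - e ^+ 4|).
Proof.
move=> /andP[a1 a2] /andP[w0 w1] /andP[B0 B1].
have e4 := epow 4; have e8 := epow 8; have e3 := epow 3.
have a0 : 0 < a by lra.
have a20 : 0 < a ^+ 2 by rewrite exprn_gt0.
have a2e : 100 ^+ 2 * e ^+ 8 <= a ^+ 2.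
  have : (100 * e ^+ 4) ^+ 2 <= a ^+ 2 by apply: sqr_le => //; lra.
  lra.
have a3e : 100 ^+ 3 * e ^+ 12 <= a * a ^+ 2.
  have x4 : 0 <= 100 * e ^+ 4 by lra.
  have x8 : 0 <= 100 ^+ 2 * e ^+ 8 by lra.
  by have := ler_pM x4 x8 a1 a2e; lra.
have da : e ^+ 12 / a <= a ^+ 2 / 100 ^+ 3 by rewrite ler_pdivrMr//; lra.
have da0 : 0 <= e ^+ 12 / a by rewrite divr_ge0 ?(ltW (epow 12)) ?(ltW a0).
have da2 : e ^+ 12 * w / a ^+ 2 <= a / 1000.
  rewrite ler_pdivrMr//; have := ler_wpM2l (ltW (epow 12)) w1; have := epow 12; lra.
have a21 : a ^+ 2 <= 1 / 4 by rewrite expr2; clear - a1 a2; nra.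
have h1 : a * (99 / 100) * (a * (29 / 10)) <=
    (a - e ^+ 4) * (4 * a * (1 - a ^+ 2) - e ^+ 12 * w / a ^+ 2).
  apply: ler_pM; [(clear - a1 a0; lra)|(clear - a1 a0; lra)|(clear - a1 a0; lra)|].
  by have := ler_wpM2l (ltW a0) a21; clear - a0 da2; lra.
have h3 : e ^+ 12 / a * (8 * B + 50 * e ^+ 3 * `|a - e ^+ 4|) <= a ^+ 2 / 100 ^+ 3 * 9.
  apply: ler_pM => //; first by have := mulr_ge0 (ltW e3) (normr_ge0 (a - e ^+ 4)); clear - B0; lra.
  have A1 : `|a - e ^+ 4| <= 1 by rewrite ler_norml; apply/andP; split; clear - a1 a2 e4; lra.
  have := ler_pM (ltW e3) (normr_ge0 _) (epowD 0 3) A1; rewrite expr0; clear - B1; lra.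
clear - a2e da da0 h1 h3; lra.
Qed.

(** Here [1 - a ^+ 2] may be small, but it is at least [e ^+ 6], and the coupling terms are of order
    [e ^+ 12]. *)
Lemma gap_large_a (a w B : R) : 1 / 2 <= a <= 1 -> 0 <= w <= 3 -> 0 <= B <= 1 ->
  e ^+ 12 <= (1 - a ^+ 2) ^+ 2 ->
  31 * e ^+ 8 <= (a - e ^+ 4) * (4 * a * (1 - a ^+ 2) - e ^+ 12 * w / a ^+ 2)
    - e ^+ 12 / a * (8 * B + 50 * e ^+ 3 * `|a - e ^+ 4|).
Proof.
move=> /andP[a1 a2] /andP[w0 w1] /andP[B0 B1] ha.
have e4 := epow 4; have e8 := epow 8; have e3 := epow 3; have e12 := epow 12.
have p4 : e ^+ 4 <= 1 / 1000 ^+ 4 by have := epowD 0 4; rewrite expr0.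
have a0 : 0 < a by lra.
have a20 : 0 < a ^+ 2 by rewrite exprn_gt0.
have e6 : e ^+ 6 <= 1 - a ^+ 2 by apply: ler_of_sqr; [(clear - a2 ha a0; nra)|(clear - a2 ha a0; lra)].
have da : e ^+ 12 / a <= 2 * e ^+ 12 by rewrite ler_pdivrMr//; have := ler_wpM2l (ltW e12) a1; clear - a20 e6; lra.
have da0 : 0 <= e ^+ 12 / a by rewrite divr_ge0 ?(ltW (epow 12)) ?(ltW a0).
have da2 : e ^+ 12 * w / a ^+ 2 <= 12 * e ^+ 12.
  rewrite ler_pdivrMr//; have := ler_wpM2l (ltW e12) w1.
  have a22 : 1 / 4 <= a ^+ 2 by rewrite expr2; clear - a1 w0; nra.
  by have := ler_wpM2l (ltW e12) a22; clear - a22; lra.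
have q6 := epowD 6 6; have q8 := epowD 6 2; have p6 := epow 6.
have h1 : 49 / 100 * (e ^+ 6) <=
    (a - e ^+ 4) * (4 * a * (1 - a ^+ 2) - e ^+ 12 * w / a ^+ 2).
  apply: ler_pM; [(clear - a1 p4 p6; lra)|(clear - a1 p4 p6; lra)|(clear - a1 p4 p6; lra)|].
  by have := ler_pM _ _ a1 e6; rewrite (ltW p6) => /(_ _ isT); clear - da da0 da2 q6; lra.
have h3 : e ^+ 12 / a * (8 * B + 50 * e ^+ 3 * `|a - e ^+ 4|) <= 2 * e ^+ 12 * 9.
  apply: ler_pM => //; first by have := mulr_ge0 (ltW e3) (normr_ge0 (a - e ^+ 4)); clear - B0; lra.
  have A1 : `|a - e ^+ 4| <= 1 by rewrite ler_norml; apply/andP; split; clear - a1 a2 e4 p4; lra.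
  have := ler_pM (ltW e3) (normr_ge0 _) (epowD 0 3) A1; rewrite expr0; clear - B1; lra.
clear - q6 q8 p6 h1 h3; lra.
Qed.

(** At the scale of the first fold [mu] is tiny, which forces [(1 - b ^+ 2) ^+ 2 >= 1 / 2]. *)
Lemma far_from_second_fold (a b w s mu : R) : e ^+ 4 / 100 <= a <= 100 * e ^+ 4 ->
  e ^+ 4 / 2 <= b <= 3 / 2 -> w <= 3 -> s <= 5 ->
  mu = 2 * a ^+ 2 - a ^+ 4 + e ^+ 12 * w / a + 2 * e ^+ 12 ->
  mu = 1 - (1 - b ^+ 2) ^+ 2 - e ^+ 12 * (s / b - 2) ->
  28 / 100 <= `|b - 1|.
Proof.
move=> /andP[a1 a2] /andP[b1 b2] w3 s5.
have e8 := epow 8; have e4 := epow 4; have e12 := epow 12.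
have a0 : 0 < a by lra.
have b0 : 0 < b by lra.
have aV : e ^+ 12 * w / a <= 300 * e ^+ 8.
  rewrite ler_pdivrMr//; have := ler_wpM2l (ltW e12) w3.
  have := ler_wpM2l (ltW e8) a1; lra.
have gzb : e ^+ 12 * (s / b) <= 10 * e ^+ 8.
  rewrite mulrA ler_pdivrMr//.
  have := ler_wpM2l (ltW e12) s5; have := ler_wpM2l (ltW e8) b1; lra.
have p4 := epowD 0 4; have p8 := epowD 0 8; have p12 := epowD 8 4; rewrite expr0 in p4 p8.
have a22 : a ^+ 2 <= 1 / 100 by rewrite expr2; clear - a1 a2 p8; nra.
have a40 := sqr_ge0 (a ^+ 2).
move: aV gzb; set A := _ / a; set B := e ^+ 12 * (s / b) => aV gzb muL muR.
have nu : 1 / 2 <= (1 - b ^+ 2) ^+ 2.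
  by rewrite mulrBr -/B in muR; clear - p8 a22 a40 aV gzb muL muR; lra.
clear muL muR aV gzb; rewrite leNgt; apply/negP; rewrite ltr_norml => /andP[h1 h2].
have c1 : 1 - b ^+ 2 <= 7 / 10 by clear - nu h1 h2; nra.
have c2 : - (7 / 10) <= 1 - b ^+ 2 by clear - nu h1 h2; nra.
by move: (1 - b ^+ 2) c1 c2 nu => c c1 c2 nu; clear - nu c1 c2; nra.
Qed.

(** The coupling being nonnegative, [2 * a ^+ 2 - a ^+ 4 + 2 * e ^+ 12 <= mu <= 1]. *)
Lemma first_site_gap (a w mu : R) : 0 < a -> 0 <= w -> mu <= 1 ->
  mu = 2 * a ^+ 2 - a ^+ 4 + e ^+ 12 * w / a + 2 * e ^+ 12 ->
  e ^+ 12 <= (1 - a ^+ 2) ^+ 2.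
Proof.
move=> a0 w0 mu1 muL; have e12 := epow 12.
have : 0 <= e ^+ 12 * w / a by rewrite divr_ge0 ?(ltW a0)// mulr_ge0// ltW.
by move: (_ / a) muL => x muL; lra.
Qed.

Lemma third_term_le (b s : R) : 0 < b -> 0 <= s <= 5 ->
  e ^+ 12 * s * (b - 1) / b ^+ 2 <= 5 * e ^+ 12.
Proof.
move=> b0 /andP[s0 s5]; have e12 := epow 12.
have b20 : 0 < b ^+ 2 by rewrite exprn_gt0.
rewrite ler_pdivrMr//; have [h|h] := leP b 1.
  apply: (@le_trans _ _ 0); last by rewrite mulr_ge0 ?(ltW b20)//; lra.
  by rewrite mulr_ge0_le0 ?subr_le0// mulr_ge0 ?(ltW e12).
have b1b : b - 1 <= b ^+ 2 by rewrite expr2; nra.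
have bm : 0 <= b - 1 by lra.
have := ler_wpM2l (ltW e12) (ler_pM s0 bm s5 b1b); lra.
Qed.

Lemma last_term_le (b A B : R) : e ^+ 4 / 2 <= b -> 0 <= A <= 1 -> B <= 1 ->
  0 <= B -> e ^+ 12 / b * (14 * B + 2 * e ^+ 6 * A) <= 30 * e ^+ 8.
Proof.
move=> b1 /andP[A0 A1] B1 B0; have e4 := epow 4; have e8 := epow 8; have e12 := epow 12.
have b0 : 0 < b by lra.
have db : e ^+ 12 / b <= 2 * e ^+ 8.
  by rewrite ler_pdivrMr//; have := ler_wpM2l (ltW e8) b1; lra.
have db0 : 0 <= e ^+ 12 / b by rewrite divr_ge0 ?(ltW e12) ?(ltW b0).
have e6A : e ^+ 6 * A <= 1 / 1000.
  by have := ler_pM (ltW (epow 6)) A0 (epowD 0 6) A1; rewrite expr0; lra.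
have e6A0 : 0 <= e ^+ 6 * A by rewrite mulr_ge0// ltW// epow.
have l0 : 0 <= 14 * B + 2 * e ^+ 6 * A by lra.
have l15 : 14 * B + 2 * e ^+ 6 * A <= 15 by lra.
by have := ler_pM db0 l0 db l15; clear - l15; lra.
Qed.

(* The parameter gap increases along rays from the centre [(e^4, 1)] at its
   zeros: near the fold of the site [0] the [b]-term wins, near the fold of the
   site [2] the [a]-term does. *)
Lemma radial_gap (a b y g z mu : R) : in_rect e a b -> `|y| <= e ^+ 3 * a ->
  1 <= g <= 5 / 2 -> 1 <= z <= 5 / 2 -> mu <= 1 ->
  mu = 2 * a ^+ 2 - a ^+ 4 + e ^+ 12 * (y + g) / a + 2 * e ^+ 12 ->
  mu = 1 - (1 - b ^+ 2) ^+ 2 - e ^+ 12 * ((g + z) / b - 2) ->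
  e ^+ 12 <= (a - e ^+ 4) * (4 * a * (1 - a ^+ 2) - e ^+ 12 * (y + g) / a ^+ 2)
    + 4 * b * (1 + b) * (b - 1) ^+ 2 - e ^+ 12 * (g + z) * (b - 1) / b ^+ 2
    - e ^+ 12 / a * (8 * `|b - 1| + 50 * e ^+ 3 * `|a - e ^+ 4|)
    - e ^+ 12 / b * (14 * `|b - 1| + 2 * e ^+ 6 * `|a - e ^+ 4|).
Proof.
move=> ab ya /andP[g1 g2] /andP[z1 z2] mu1.
have [a0 b0] := in_rect_gt0 e_gt0 ab.
have [/andP[a1 a2] b12] := ab; have /andP[b1 b2] := b12.
have e4 := epow 4; have e8 := epow 8; have e3 := epow 3.
have p4 : e ^+ 4 <= 1 / 1000 ^+ 4 by have := epowD 0 4; rewrite expr0.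
have p8 : e ^+ 12 <= e ^+ 8 / 1000 ^+ 4 := epowD 8 4.
have p3 : e ^+ 3 <= 1 / 1000 ^+ 3 by have := epowD 0 3; rewrite expr0.
have Ai : 0 <= `|a - e ^+ 4| <= 1.
  by rewrite normr_ge0 ler_norml; apply/andP; split; clear - a0 a2 e4 p4; lra.
have B1 : `|b - 1| <= 1 by rewrite ler_norml; apply/andP; split; clear - b1 b2 e4; lra.
have Bi : 0 <= `|b - 1| <= 1 by rewrite normr_ge0.
have ya3 : `|y| <= 1 / 100 by have := ler_pM (ltW e3) (ltW a0) p3 a2; clear - ya; lra.
have w1 : 99 / 100 <= y + g <= 3.
  by move: ya3; rewrite ler_norml => /andP[y1 y2]; apply/andP; split; clear - e_gt0 e_small epow epowD y1 y2 g1 g2; lra.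
have w2 : 0 <= y + g <= 3 by case/andP: w1 => h1 ->; rewrite andbT; clear - e_gt0 e_small epow epowD h1; lra.
have [w99 w3] := andP w1; have [w0 _] := andP w2.
have gz : 0 <= g + z <= 5 by apply/andP; split; clear - g1 g2 z1 z2; lra.
have T2 : 0 <= 4 * b * (1 + b) * (b - 1) ^+ 2.
  by rewrite mulr_ge0 ?sqr_ge0// mulr_ge0//; clear - b1 e4; lra.
have e3b := third_term_le b0 gz.
have e2b := last_term_le b1 Ai B1 (normr_ge0 (b - 1)).
have fin2 (x1 x2 x3 x4 x5 : R) : x3 <= 5 * e ^+ 12 -> x5 <= 30 * e ^+ 8 ->
    31 * e ^+ 8 <= x1 + x2 - x4 -> e ^+ 12 <= x1 + x2 - x3 - x4 - x5.
  by clear - e_gt0 e_small epow epowD p8 e8; lra.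
have fin1 (x1 x2 x3 x4 x5 : R) : 0 <= x2 -> x3 <= 5 * e ^+ 12 -> x5 <= 30 * e ^+ 8 ->
    31 * e ^+ 8 <= x1 - x4 -> e ^+ 12 <= x1 + x2 - x3 - x4 - x5.
  by move=> x20 x3e x5e h; apply: fin2 => //; apply: (le_trans h); rewrite lerD2r lerDl.
have [h1|h1] := leP a (e ^+ 4 / 100).
  by move=> _ _; exact: fin1 T2 e3b e2b (gap_tiny_a a0 h1 w99 Bi).
have [h2|h2] := leP a (100 * e ^+ 4).
  have ha : e ^+ 4 / 100 <= a <= 100 * e ^+ 4 by rewrite (ltW h1).
  move=> muL muR; have [_ gz5] := andP gz.
  have Bge := far_from_second_fold ha b12 w3 gz5 muL muR.
  rewrite -(sqr_normr (b - 1)).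
  exact: fin2 e3b e2b (gap_small_a ha b1 Bge B1 w1).
have [h3|h3] := leP a (1 / 2).
  have ha : 100 * e ^+ 4 <= a <= 1 / 2 by rewrite (ltW h2).
  by move=> _ _; exact: fin1 T2 e3b e2b (gap_medium_a ha w2 Bi).
have ha : 1 / 2 <= a <= 1 by rewrite (ltW h3).
move=> muL _.
exact: fin1 T2 e3b e2b (gap_large_a ha w2 Bi (first_site_gap a0 w0 mu1 muL)).
Qed.

End Transversality.

(** * The linearised gap *)

Section LinearGap.
Variables (R : realType) (e : R).
Hypotheses (e_gt0 : 0 < e) (e_small : e <= 1 / 1000).
Implicit Types (a b mu : R) (U v : int -> R) (n : int).

Let epow := epow_gt0 e_gt0.
Arguments epow k%_N.
Let epowD := epowD_le e_gt0 e_small.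
Arguments epowD (j k)%_N.

Lemma le_inv_epow j k (M : R) : 0 <= M -> (j <= k)%N -> M / e ^+ j <= M / e ^+ k.
Proof.
move=> M0 jk; rewrite ler_wpM2l// lef_pV2 ?posrE ?epow//.
apply: ler_wiXn2l => //; first exact: ltW.
by move: e_small; lra.
Qed.

(** The excess [e ^+ 6 / 4] in the coupling at site 2 is worth [e ^+ 18 / 4]; completing the square
    absorbs the term [5 * e ^+ 12 * c] at the cost of a multiple of [e ^+ 24]. *)
Lemma right_mu_le a b U : in_rect e a b -> box e 0 a b U ->
  right_mu e b U <= 1 - e ^+ 18 / 8.
Proof.
move=> ab bU; have [_ /andP[b1 b2]] := ab; have /andP[s1 s2] := box_sum13 e_gt0 e_small ab bU.
have := nu_ge e_gt0 b1 s1 s2; rewrite /right_mu.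
have := eb_sqr b; set c := `|1 - b ^+ 2| => cE h.
have c0 : 0 <= c := normr_ge0 _.
have := ler_wpM2l (ltW (epow 12)) h.
have := sqr_ge0 (2 * c - 5 * e ^+ 12); have := epowD 18 6; have := epow 18.
by have := sqr_ge0 c; clear - e_gt0 e_small epow epowD cE; lra.
Qed.

(** [v] follows the ray from the centre with speed [r] up to the error [M]; the sign at site 0 is
    reversed because [U 0 = - a]. The main term is [radial_gap], and the errors are divided by at
    most [e ^+ 13]. *)
Lemma linear_gap a b mu U v ml mr r M D :
  in_rect e a b -> two_sided_sol e a b U mu mu -> (forall n, `|v n| <= D) ->
  0 <= r -> `|v 0 + r * (a - e ^+ 4)| <= M -> `|v 2 - r * (b - 1)| <= M ->
  (forall n, n <= 0 -> `|lin_eq e mu U v ml n| <= M) ->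
  (forall n, 1 <= n -> `|lin_eq e mu U v mr n| <= M) ->
  e ^+ 12 * r - 100 / e ^+ 13 * M <= ml - mr.
Proof.
move=> ab sU vD r0 v0M v2M vL vR.
have [a0 b0] := in_rect_gt0 e_gt0 ab; have [bU _ _] := sU.
have [/andP[a1 a2] /andP[b1 b2]] := ab.
have M0 := le_trans (normr_ge0 _) v0M.
have /andP[u1 u1'] := box_ge1 e_gt0 e_small ab bU (or_introl erefl).
have /andP[u3 u3'] : 1 <= U 3 <= 5 / 2 by apply: (box_ge1 e_gt0 e_small ab bU); right.
have um1 := box_neg bU (n := -1) isT.
have [muLE muRE] := two_sided_mu e_gt0 ab sU.
have mu1 : mu <= 1.
  rewrite muRE; have := right_mu_le ab bU; have := epow 18.
  clear - e_gt0 e_small epow epowD; lra.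
have u13 : 1 <= U 1 <= 5 / 2 by rewrite u1.
have u33 : 1 <= U 3 <= 5 / 2 by rewrite u3.
have gap := radial_gap e_gt0 e_small ab um1 u13 u33 mu1 muLE muRE.
have l1 := lin_right e_gt0 e_small ab sU vD vL vR (or_introl erefl).
have l3 : `|v 3| <= 7 * `|v 2| + e ^+ 6 * `|v 0| + 10 / e ^+ 13 * M.
  by apply: (lin_right e_gt0 e_small ab sU vD vL vR); right.
have lm1 : `|v (-1)| <= 40 * e ^+ 3 * `|v 0| + 6 * e ^+ 7 * `|v 1| + 6 / e ^+ 8 * M.
  by apply: (lin_left e_gt0 e_small ab sU vD vL).
have := lin_muL e_gt0 v ml ab sU; have := lin_muR e_gt0 v mr ab sU.
have := vL 0 (lexx _); have := vR 2 isT.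
clear muLE muRE vL vR.
move: (lin_eq _ _ _ _ _ 2) (lin_eq _ _ _ _ _ 0) => g2 g0 g2M g0M.
move: gap; set A := `|a - e ^+ 4|; set B := `|b - 1|.
have A0 : 0 <= A := normr_ge0 _.
have B0 : 0 <= B := normr_ge0 _.
have e12 := epow 12; have e13 := epow 13; have e3 := epow 3.
set X := 1 / e ^+ 13 * M.
have X0 : 0 <= X by rewrite mulr_ge0// divr_ge0// ltW.
have v0B : `|v 0| <= r * A + M.
  rewrite -[v 0](addrK (r * (a - e ^+ 4))); apply: le_trans (ler_normB _ _) _.
  by rewrite normrM (ger0_norm r0) addrC lerD2l.
have v2B : `|v 2| <= r * B + M.
  rewrite -[v 2](subrK (r * (b - 1))); apply: le_trans (ler_normD _ _) _.
  by rewrite normrM (ger0_norm r0) addrC lerD2l.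
have small k : e ^+ k.+1 <= 1 / 1000.
  have := epowS_le e_gt0 e_small k; have : e ^+ k <= 1.
    by rewrite exprn_ile1 ?(ltW e_gt0)//; move: e_small; clear - v2B; lra.
  clear - v2B; lra.
have MX k : (k <= 12)%N -> M / e ^+ k <= X / 1000.
  move=> k12; apply: (le_trans (le_inv_epow M0 k12)).
  rewrite ler_pdivrMr// /X (_ : _ / 1000 * _ = M / 1000 / e); last by field; rewrite gt_eqF.
  rewrite ler_pdivlMr//; have := ler_wpM2l M0 e_small; clear - k12; lra.
have M1 : M <= X / 1000 by have := MX 0%N isT; rewrite expr0 divr1.
have rA : 0 <= r * A by rewrite mulr_ge0.
have rB : 0 <= r * B by rewrite mulr_ge0.
have s1 : 7 * `|v 2| + e ^+ 6 * `|v 0| + 10 / e ^+ 13 * M <=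
    r * (7 * B + e ^+ 6 * A) + 11 * X.
  have q := ler_wpM2l (ltW (epow 6)) v0B; have q2 := ler_wpM2r M0 (small 5%N).
  have -> : 10 / e ^+ 13 * M = 10 * X by rewrite /X; ring.
  clear - e_gt0 e_small epow epowD q q2 v2B M1 rA X0; lra.
have {}l1 := le_trans l1 s1; have {}l3 := le_trans l3 s1.
have sm1 : `|v (-1)| <= r * (41 * e ^+ 3 * A + B / 1000) + X.
  apply: (le_trans lm1).
  have q := ler_wpM2l (ltW (epow 3)) v0B; have q2 := ler_wpM2r M0 (small 2%N).
  have q3 := ler_wpM2l (ltW (epow 7)) l1; have q4 := ler_wpM2r X0 (small 6%N).
  have q5 := ler_wpM2r rB (epowD 0 7); have q6 := ler_wpM2r rA (epowD 3 10).
  have q7 := mulr_ge0 (ltW e3) rA.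
  have -> : 6 / e ^+ 8 * M = 6 * (M / e ^+ 8) by ring.
  have q8 := MX 8%N isT; rewrite expr0 in q5.
  clear - e_gt0 e_small epow epowD q q2 q3 q4 q5 q6 q7 q8 M1 X0 rB; lra.
(* The bounds at sites -1 and 1 add up to the coefficients [8] and [50 * e ^+ 3] of [radial_gap];
   those at sites 1 and 3 give [14] and [2 * e ^+ 6]. *)
have t1 : `|v (-1) + v 1| <= r * (8 * B + 50 * e ^+ 3 * A) + 12 * X.
  apply: le_trans (ler_normD _ _) _.
  have q6 := ler_wpM2r rA (epowD 3 3); have q7 := mulr_ge0 (ltW e3) rA.
  clear - e_gt0 e_small epow epowD q6 q7 sm1 l1 rA rB X0; lra.
have t2 : `|v 1 + v 3| <= r * (14 * B + 2 * e ^+ 6 * A) + 22 * X.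
  by apply: le_trans (ler_normD _ _) _; clear - e_gt0 e_small epow epowD l1 l3 X0 rA rB; lra.
have da : 0 <= e ^+ 12 / a <= 2.
  rewrite divr_ge0 ?(ltW e12) ?(ltW a0)// ler_pdivrMr//; clear - e_gt0 e_small epow epowD a1; lra.
have db : 0 <= e ^+ 12 / b <= 2.
  rewrite divr_ge0 ?(ltW e12) ?(ltW b0)// ler_pdivrMr//.
  by have := epowD 4 8; have := epow 4; clear - e_gt0 e_small epow epowD b1; lra.
case/andP: da => da0 da2; case/andP: db => db0 db2.
have n1 : - (e ^+ 12 / a * (r * (8 * B + 50 * e ^+ 3 * A)) + 24 * X) <=
    e ^+ 12 * (v (-1) + v 1) / a.
  have : `|e ^+ 12 / a * (v (-1) + v 1)| <=
      e ^+ 12 / a * (r * (8 * B + 50 * e ^+ 3 * A)) + 24 * X.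
    rewrite normrM (ger0_norm da0); apply: le_trans (ler_wpM2l da0 t1) _.
    by rewrite mulrDr lerD2l; have := ler_wpM2r X0 da2; clear - e_gt0 e_small epow epowD; lra.
  by rewrite (mulrAC _ (v (-1) + v 1)) ler_norml => /andP[].
have n2 : - (e ^+ 12 / b * (r * (14 * B + 2 * e ^+ 6 * A)) + 44 * X) <=
    e ^+ 12 * (v 1 + v 3) / b.
  have : `|e ^+ 12 / b * (v 1 + v 3)| <=
      e ^+ 12 / b * (r * (14 * B + 2 * e ^+ 6 * A)) + 44 * X.
    rewrite normrM (ger0_norm db0); apply: le_trans (ler_wpM2l db0 t2) _.
    by rewrite mulrDr lerD2l; have := ler_wpM2r X0 db2; clear - e_gt0 e_small epow epowD; lra.
  by rewrite (mulrAC _ (v 1 + v 3)) ler_norml => /andP[].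
have aV : a^-1 <= 2 / e ^+ 12.
  by rewrite -(ler_pM2l a0) divff ?gt_eqF// mulrA ler_pdivlMr//; clear - e_gt0 e_small epow epowD a1; lra.
have bV : b^-1 <= 2 / e ^+ 4.
  by rewrite -(ler_pM2l b0) divff ?gt_eqF// mulrA ler_pdivlMr ?epow//; clear - e_gt0 e_small epow epowD b1; lra.
have aV0 : 0 <= a^-1 by rewrite invr_ge0 ltW.
have bV0 : 0 <= b^-1 by rewrite invr_ge0 ltW.
have n3 : `|g0 / a| <= X.
  rewrite normrM (ger0_norm aV0); apply: le_trans (ler_pM _ aV0 g0M aV) _ => //.
  by rewrite mulrCA; have := MX 12%N isT; clear - e_gt0 e_small epow epowD X0; lra.
have n4 : `|g2 / b| <= X.
  rewrite normrM (ger0_norm bV0); apply: le_trans (ler_pM _ bV0 g2M bV) _ => //.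
  by rewrite mulrCA; have := MX 4%N isT; clear - e_gt0 e_small epow epowD X0; lra.
have wB : 0 <= U (-1) + U 1 <= 3.
  have := ler_pM (ltW e3) (ltW a0) (epowD 0 3) a2; rewrite expr0.
  move: um1; rewrite ler_norml => /andP[h1 h2] h3.
  by clear - e_gt0 e_small epow epowD h1 h2 h3 u1 u1'; apply/andP; split; lra.
have n5 : `|(v 0 + r * (a - e ^+ 4)) * (e ^+ 12 * (U (-1) + U 1) / a ^+ 2 - 4 * a * (1 - a ^+ 2))|
    <= X.
  have c0 : 0 <= e ^+ 12 * (U (-1) + U 1) / a ^+ 2 <= 12 / e ^+ 12.
    case/andP: wB => w0 w3; apply/andP; split.
      by rewrite divr_ge0 ?sqr_ge0// mulr_ge0// ltW.
    have -> : e ^+ 12 * (U (-1) + U 1) / a ^+ 2 = e ^+ 12 / a * (U (-1) + U 1) * a^-1.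
      by field; rewrite gt_eqF.
    have := ler_pM (mulr_ge0 da0 w0) aV0 (ler_pM da0 w0 da2 w3) aV; clear - e_gt0 e_small epow epowD; lra.
  have c1 : 0 <= 4 * a * (1 - a ^+ 2) <= 4.
    have a21 : 0 <= a ^+ 2 <= 1 by rewrite sqr_ge0 expr2; clear - e_gt0 e_small epow epowD a0 a2; nra.
    by case/andP: a21 => h1 h2; clear - e_gt0 e_small epow epowD h1 h2 a0 a2; apply/andP; split; nra.
  have one : 1 <= 1 / e ^+ 12 by rewrite ler_pdivlMr//; have := small 11%N; clear - e_gt0 e_small epow epowD; lra.
  have c2 : `|e ^+ 12 * (U (-1) + U 1) / a ^+ 2 - 4 * a * (1 - a ^+ 2)| <= 16 / e ^+ 12.
    case/andP: c0 => h1 h2; case/andP: c1 => h3 h4; rewrite ler_norml.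
    by clear - e_gt0 e_small epow epowD h1 h2 h3 h4 one; apply/andP; split; lra.
  rewrite normrM; apply: le_trans (ler_pM (normr_ge0 _) (normr_ge0 _) v0M c2) _.
  by rewrite mulrCA; have := MX 12%N isT; clear - e_gt0 e_small epow epowD X0; lra.
have n6 : `|(v 2 - r * (b - 1)) * (e ^+ 12 * (U 1 + U 3) / b ^+ 2 + 4 * b * (1 - b ^+ 2))|
    <= X.
  have c0 : 0 <= e ^+ 12 * (U 1 + U 3) / b ^+ 2 <= 20 / e ^+ 4.
    have s0 : 0 <= U 1 + U 3 by clear - e_gt0 e_small epow epowD u1 u3; lra.
    apply/andP; split.
      by rewrite divr_ge0 ?sqr_ge0// mulr_ge0// ltW.
    have -> : e ^+ 12 * (U 1 + U 3) / b ^+ 2 = e ^+ 12 / b * (U 1 + U 3) * b^-1.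
      by field; rewrite gt_eqF.
    have s5 : U 1 + U 3 <= 5 by clear - e_gt0 e_small epow epowD u1' u3'; lra.
    have := ler_pM (mulr_ge0 db0 s0) bV0 (ler_pM db0 s0 db2 s5) bV; clear - e_gt0 e_small epow epowD; lra.
  have c1 : `|4 * b * (1 - b ^+ 2)| <= 8.
    have b22 : b ^+ 2 <= 9 / 4 by clear - e_gt0 e_small epow epowD b0 b2; nra.
    have b23 : 0 <= b ^+ 2 by exact: sqr_ge0.
    by rewrite ler_norml; clear - e_gt0 e_small epow epowD b22 b23 b0 b2; apply/andP; split; nra.
  have one : 1 <= 1 / e ^+ 4 by rewrite ler_pdivlMr ?epow//; have := small 3%N; clear - e_gt0 e_small epow epowD; lra.
  have c2 : `|e ^+ 12 * (U 1 + U 3) / b ^+ 2 + 4 * b * (1 - b ^+ 2)| <= 28 / e ^+ 4.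
    apply: le_trans (ler_normD _ _) _; case/andP: c0 => c01 c02.
    by rewrite (ger0_norm c01); clear - e_gt0 e_small epow epowD c02 c1 one; lra.
  rewrite normrM; apply: le_trans (ler_pM (normr_ge0 _) (normr_ge0 _) v2M c2) _.
  by rewrite mulrCA; have := MX 4%N isT; clear - e_gt0 e_small epow epowD X0; lra.
move=> gap mrE mlE.
have E : ml - mr = r * ((a - e ^+ 4) * (4 * a * (1 - a ^+ 2) - e ^+ 12 * (U (-1) + U 1) / a ^+ 2)
    + 4 * b * (1 + b) * (b - 1) ^+ 2 - e ^+ 12 * (U 1 + U 3) * (b - 1) / b ^+ 2)
  + (v 0 + r * (a - e ^+ 4)) * (e ^+ 12 * (U (-1) + U 1) / a ^+ 2 - 4 * a * (1 - a ^+ 2))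
  - (v 2 - r * (b - 1)) * (e ^+ 12 * (U 1 + U 3) / b ^+ 2 + 4 * b * (1 - b ^+ 2))
  + e ^+ 12 * (v (-1) + v 1) / a + e ^+ 12 * (v 1 + v 3) / b - g0 / a - g2 / b.
  by rewrite mlE mrE; field; rewrite !gt_eqF.
have := ler_wpM2l r0 gap.
have -> : 100 / e ^+ 13 * M = 100 * X by rewrite /X; ring.
rewrite E; clear E mlE mrE gap.
move: n3 n4 n5 n6 n1 n2; rewrite !ler_norml.
set G := (a - e ^+ 4) * _; set P5 := (v 0 + _) * _; set P6 := (v 2 - _) * _.
set Q1 := e ^+ 12 * (v (-1) + v 1) / a; set Q2 := e ^+ 12 * (v 1 + v 3) / b.
set Q3 := g0 / a; set Q4 := g2 / b; set T2 := 4 * b * _ * _; set T3 := _ / b ^+ 2.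
set Z1 := e ^+ 12 / a; set Z2 := e ^+ 12 / b.
move=> /andP[y1 y2] /andP[y3 y4] /andP[y5 y6] /andP[y7 y8] y9 y10.
have -> : r * (G + T2 - T3 - Z1 * (8 * B + 50 * e ^+ 3 * A) - Z2 * (14 * B + 2 * e ^+ 6 * A))
  = r * (G + T2 - T3) - Z1 * (r * (8 * B + 50 * e ^+ 3 * A))
    - Z2 * (r * (14 * B + 2 * e ^+ 6 * A)) by ring.
move: (Z1 * _) (Z2 * _) (r * (G + _ - _)) y9 y10 => W1 W2 W3 y9 y10 y11.
rewrite mulrC; clear - e_gt0 e_small epow epowD y1 y2 y3 y4 y5 y6 y7 y8 y9 y10 y11 X0; lra.
Qed.

End LinearGap.

(** * The linear system bordered by the ray condition *)

Section BorderedSystem.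
Variables (R : realType) (e : R).
Hypotheses (e_gt0 : 0 < e) (e_small : e <= 1 / 1000).
Implicit Types (a b mu : R) (U v w : int -> R) (n : int).

Let epow := epow_gt0 e_gt0.
Arguments epow k%_N.
Let epowD := epowD_le e_gt0 e_small.
Arguments epowD (j k)%_N.

Lemma box_norm_le a b U n : in_rect e a b -> box e 0 a b U -> `|U n| <= 5 / 2.
Proof.
move=> ab bU; have [/andP[a1 a2] /andP[b1 b2]] := ab.
have [a0 b0] := in_rect_gt0 e_gt0 ab.
have [m0|m1] := leP n 0; first by have := box_left e_gt0 e_small ab bU m0; lra.
have [mE|m2] := eqVneq n 2.
  by rewrite mE; have [_ -> _ _ _] := bU; rewrite gtr0_norm//; lra.
have /andP[h1 h2] : 1 <= U n <= 5 / 2.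
  by apply: (box_ge1 e_gt0 e_small ab bU); int_lia.
by rewrite ger0_norm//; clear - h1 e_gt0 e_small epow epowD; lra.
Qed.

Lemma lattice_taylor mu m U w n : `|U n| <= 5 / 2 -> `|w n| <= 5 ->
  `|lattice_eq e (mu + m) (fun k => U k + w k) n - lattice_eq e mu U n
    - lin_eq e mu U w m n| <= `|m| * `|w n| + 1000 * `|w n| ^+ 2.
Proof.
move=> u1 w1; rewrite /lattice_eq /lin_eq.
rewrite (_ : _ - _ - _ = m * w n + w n ^+ 2 * (10 * U n ^+ 3 - 6 * U n
  + (10 * U n ^+ 2 - 2) * w n + 5 * U n * w n ^+ 2 + w n ^+ 3)); last by ring.
apply: le_trans (ler_normD _ _) _; rewrite normrM lerD2l normrM.
rewrite mulrC (ger0_norm (sqr_ge0 _)) sqr_normr ler_wpM2r ?sqr_ge0//.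
move: (U n) (w n) u1 w1 => u x; rewrite !ler_norml => /andP[u1 u2] /andP[x1 x2].
have u20 : 0 <= u ^+ 2 <= 25 / 4 by rewrite sqr_ge0; nra.
have x20 : 0 <= x ^+ 2 <= 25 by rewrite sqr_ge0; nra.
case/andP: u20 => u20 u21; case/andP: x20 => x20 x21.
have u3 : - (125 / 8) <= u ^+ 3 <= 125 / 8 by rewrite exprS; apply/andP; split; nra.
have x3 : - 125 <= x ^+ 3 <= 125 by rewrite exprS; apply/andP; split; nra.
have q1 : - (605 / 2) <= (10 * u ^+ 2 - 2) * x <= 605 / 2 by apply/andP; split; clear - x1 x2 u21; nra.
have q2 : - (625 / 2) <= 5 * u * x ^+ 2 <= 625 / 2 by apply/andP; split; clear - x21 x3 q1; nra.
case/andP: u3 => u3 u3'; case/andP: x3 => x3 x3'; case/andP: q1 => q1 q1'.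
case/andP: q2 => q2 q2'.
by apply/andP; split; clear - e_gt0 e_small epow epowD u1 u2 u3 u3' x3 x3' q1 q1' q2 q2'; lra.
Qed.

Lemma lin_eqZ mu U v m (t : R) n :
  lin_eq e mu U (fun k => t * v k) (t * m) n = t * lin_eq e mu U v m n.
Proof. by rewrite /lin_eq; ring. Qed.

(** With a single parameter variation the left side of [linear_gap] drops out, and it reads
    [e ^+ 12 * q <= 100 / e ^+ 13 * M] for the speed [q = r / rho]; hence the power 25. The two
    border conditions then bound [v 0] and [v 2], and these bound all the other sites and [m]. *)
Lemma bordered_bound a b mu U (rho c s : R) v m r M D :
  in_rect e a b -> two_sided_sol e a b U mu mu ->
  a - e ^+ 4 = rho * c -> b - 1 = rho * s -> 0 < rho <= 2 ->
  (forall n, `|v n| <= D) -> (forall n, `|lin_eq e mu U v m n| <= M) ->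
  `|v 0 + c * r| <= M -> `|v 2 - s * r| <= M ->
  [/\ forall n, `|v n| <= 1000 / e ^+ 25 * M, `|m| <= 1000 / e ^+ 25 * M &
      `|r| <= 1000 / e ^+ 25 * M].
Proof.
move=> ab sU aE bE /andP[rho0 rho2] vD vM v0M v2M.
have M0 := le_trans (normr_ge0 _) v0M.
have [a0 b0] := in_rect_gt0 e_gt0 ab; have [bU _ _] := sU.
have [/andP[a1 a2] /andP[b1 b2]] := ab.
pose q := r / rho.
have rE : r = rho * q by rewrite /q mulrCA divff ?gt_eqF// mulr1.
have caE : c * r = q * (a - e ^+ 4) by rewrite aE rE; ring.
have sbE : s * r = q * (b - 1) by rewrite bE rE; ring.
rewrite caE in v0M; rewrite sbE in v2M.
have e12 := epow 12; have e13 := epow 13; have e25 := epow 25.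
set Y := 1 / e ^+ 25 * M.
have Y0 : 0 <= Y by rewrite mulr_ge0// divr_ge0// ltW.
have YE k : (k <= 25)%N -> M / e ^+ k <= Y.
  by move=> k25; rewrite /Y mulrAC mul1r; exact: le_inv_epow.
have qB : `|q| <= 100 * Y.
  (* [linear_gap] asks for a nonnegative speed; multiplying by [t = 1] or [t = -1] reduces both
     signs of [q] to this case. *)
  have sgap t : `|t| = 1 -> 0 <= t * q -> t * q <= 100 * Y.
    move=> t1 tq0.
    have h1 : forall n, `|t * v n| <= D by move=> n; rewrite normrM t1 mul1r.
    have h2 : `|t * v 0 + t * q * (a - e ^+ 4)| <= M.
      by rewrite -mulrA -mulrDr normrM t1 mul1r.
    have h3 : `|t * v 2 - t * q * (b - 1)| <= M.
      by rewrite -mulrA -mulrBr normrM t1 mul1r.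
    have h4 n : `|lin_eq e mu U (fun k => t * v k) (t * m) n| <= M.
      by rewrite lin_eqZ normrM t1 mul1r.
    have := linear_gap e_gt0 e_small ab sU h1 tq0 h2 h3 (fun n _ => h4 n) (fun n _ => h4 n).
    rewrite subrr => h.
    rewrite -(ler_pM2l e12); apply: (@le_trans _ _ (100 / e ^+ 13 * M)).
      by clear - h e_gt0 e_small epow epowD; lra.
    by rewrite le_eqVlt; apply/orP; left; apply/eqP; rewrite /Y; field; rewrite gt_eqF.
  have [q0|q0] := leP 0 q; first by rewrite ger0_norm//; have := sgap 1 (normr1 _); rewrite !mul1r; apply.
  rewrite ltr0_norm//; have := sgap (-1); rewrite normrN normr1 !mulN1r; apply=> //.
  by rewrite oppr_ge0 ltW.
have MY : M <= Y by have := YE 0%N isT; rewrite expr0 divr1.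
have A1 : `|a - e ^+ 4| <= 1.
  have e4 := epow 4; have p4 := epowD 0 4; rewrite expr0 in p4.
  by clear - a0 a2 e4 p4 e_gt0 e_small epow epowD; rewrite ler_norml; apply/andP; split; lra.
have B1 : `|b - 1| <= 1.
  by clear - b0 b2 e_gt0 e_small epow epowD; rewrite ler_norml; apply/andP; split; lra.
have v0B : `|v 0| <= 101 * Y.
  rewrite -[v 0](addrK (q * (a - e ^+ 4))); apply: le_trans (ler_normB _ _) _.
  have := ler_pM (normr_ge0 _) (normr_ge0 _) qB A1; rewrite (normrM q).
  by clear - v0M MY e_gt0 e_small epow epowD; lra.
have v2B : `|v 2| <= 101 * Y.
  rewrite -[v 2](subrK (q * (b - 1))); apply: le_trans (ler_normD _ _) _.
  have := ler_pM (normr_ge0 _) (normr_ge0 _) qB B1; rewrite (normrM q).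
  by clear - v2M MY e_gt0 e_small epow epowD; lra.
have small k : e ^+ k.+1 <= 1 / 1000.
  have := epowS_le e_gt0 e_small k; have : e ^+ k <= 1.
    by rewrite exprn_ile1 ?(ltW e_gt0)//; move: e_small; clear - v2B; lra.
  by clear - e_gt0 e_small epow epowD; lra.
have R1 n : n = 1 \/ 3 <= n -> `|v n| <= 800 * Y.
  move=> n13; have := lin_right e_gt0 e_small ab sU vD (fun n _ => vM n) (fun n _ => vM n) n13.
  have := ler_pM (ltW (epow 6)) (normr_ge0 _) (small 5%N) v0B.
  have -> : 10 / e ^+ 13 * M = 10 * (M / e ^+ 13) by ring.
  by have := YE 13%N isT; clear - v2B Y0 e_gt0 e_small epow epowD; lra.
have v1B := R1 1 (or_introl erefl).
have v3B : `|v 3| <= 800 * Y by apply: R1; right.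
split.
- move=> n; rewrite (_ : _ * M = 1000 * Y); last by rewrite /Y; ring.
  have [n0|[nE|[nE|[nE|n3]]]] := int_cases n.
  + have := lin_left e_gt0 e_small ab sU vD (fun n _ => vM n) n0.
    have := ler_pM (ltW (epow 3)) (normr_ge0 _) (small 2%N) v0B.
    have := ler_pM (ltW (epow 7)) (normr_ge0 _) (small 6%N) v1B.
    have -> : 6 / e ^+ 8 * M = 6 * (M / e ^+ 8) by ring.
    by have := YE 8%N isT; clear - Y0 e_gt0 e_small epow epowD; lra.
  + by rewrite nE; clear - v0B Y0 e_gt0 e_small epow epowD; lra.
  + by rewrite nE; clear - v1B Y0 e_gt0 e_small epow epowD; lra.
  + by rewrite nE; clear - v2B Y0 e_gt0 e_small epow epowD; lra.
  + by have := R1 n (or_intror n3); clear - Y0 e_gt0 e_small epow epowD; lra.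
- rewrite (_ : _ * M = 1000 * Y); last by rewrite /Y; ring.
  have bV : b^-1 <= 2 / e ^+ 4.
    rewrite -(ler_pM2l b0) divff ?gt_eqF// mulrA ler_pdivlMr ?epow//.
    by clear - b1 e_gt0 e_small epow epowD; lra.
  have bV0 : 0 <= b^-1 by rewrite invr_ge0 ltW.
  have p8 := small 7%N; have p4 := small 3%N.
  have db : e ^+ 12 / b <= 1 / 100.
    have := ler_wpM2l (ltW e12) bV.
    have -> : e ^+ 12 * (2 / e ^+ 4) = 2 * e ^+ 8 by field; rewrite gt_eqF.
    by clear - p8 e_gt0 e_small epow epowD; lra.
  have db0 : 0 <= e ^+ 12 / b by rewrite mulr_ge0// ltW.
  have dbb : e ^+ 12 / b ^+ 2 <= 1 / 100.
    rewrite expr2 invfM mulrA; have := ler_pM db0 bV0 (_ : e ^+ 12 / b <= 2 * e ^+ 8) bV.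
    have -> : 2 * e ^+ 8 * (2 / e ^+ 4) = 4 * e ^+ 4 by field; rewrite gt_eqF.
    have h : e ^+ 12 / b <= 2 * e ^+ 8.
      rewrite ler_pdivrMr//; have := ler_wpM2l (ltW (epow 8)) b1.
      by clear - e_gt0 e_small epow epowD; lra.
    by move=> /(_ h); clear - p4 e_gt0 e_small epow epowD; lra.
  rewrite (lin_muR e_gt0 v m ab sU).
  have n1 : `|lin_eq e mu U v m 2 / b| <= 2 * Y.
    rewrite normrM (ger0_norm bV0).
    have := ler_pM (normr_ge0 _) bV0 (vM 2) bV; have := YE 4%N isT.
    by clear - e_gt0 e_small epow epowD; lra.
  have n2 : `|e ^+ 12 * (v 1 + v 3) / b| <= 16 * Y.
    rewrite mulrAC normrM (ger0_norm db0).
    have v13 : `|v 1 + v 3| <= 1600 * Y.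
      by apply: le_trans (ler_normD _ _) _; clear - v1B v3B e_gt0 e_small epow epowD; lra.
    have := ler_pM db0 (normr_ge0 _) db v13; clear - e_gt0 e_small epow epowD; lra.
  have n3 : `|e ^+ 12 * (U 1 + U 3) * v 2 / b ^+ 2| <= 6 * Y.
    rewrite (_ : _ / _ = e ^+ 12 / b ^+ 2 * ((U 1 + U 3) * v 2)); last by ring.
    have dbb0 : 0 <= e ^+ 12 / b ^+ 2 by rewrite divr_ge0 ?sqr_ge0// ltW.
    rewrite normrM (normrM (U 1 + U 3)) (ger0_norm dbb0).
    have u13 : `|U 1 + U 3| <= 5.
      have := box_norm_le 1 ab bU; have := box_norm_le 3 ab bU => h1 h2.
      by apply: le_trans (ler_normD _ _) _; clear - h1 h2 e_gt0 e_small epow epowD; lra.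
    have := ler_pM dbb0 (mulr_ge0 (normr_ge0 _) (normr_ge0 _)) dbb
      (ler_pM (normr_ge0 _) (normr_ge0 _) u13 v2B).
    by clear - Y0 e_gt0 e_small epow epowD; lra.
  have n4 : `|4 * b * (1 - b ^+ 2) * v 2| <= 8 * (101 * Y).
    rewrite normrM; apply: ler_pM => //.
    have b22 : b ^+ 2 <= 9 / 4 by clear - b0 b2 e_gt0 e_small epow epowD; nra.
    have b23 : 0 <= b ^+ 2 by exact: sqr_ge0.
    by rewrite ler_norml; clear - b0 b2 b22 b23 e_gt0 e_small epow epowD; apply/andP; split; nra.
  apply: le_trans (ler_normD _ _) _; apply: le_trans (lerD (ler_normD _ _) n4) _.
  apply: le_trans (lerD (lerD (ler_normB _ _) n3) (lexx _)) _.
  by clear - n1 n2 Y0 e_gt0 e_small epow epowD; lra.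
- rewrite (_ : _ * M = 1000 * Y); last by rewrite /Y; ring.
  rewrite rE normrM (gtr0_norm rho0).
  have := ler_pM (ltW rho0) (normr_ge0 _) rho2 qB.
  by clear - Y0 e_gt0 e_small epow epowD; lra.
Qed.

(** The difference quotients move along the ray exactly, with speed 1, and satisfy the linearised
    equations up to a residual of order [|t| / e ^+ 21]. With the factor [100 / e ^+ 13] of
    [linear_gap], [|t| <= e ^+ 50] leaves an error of order [e ^+ 16], below the main term
    [e ^+ 12]. *)
Lemma ray_gap a b mu U : in_rect e a b -> two_sided_sol e a b U mu mu ->
  forall (t : R) V muL muR, t != 0 -> `|t| <= e ^+ 50 ->
  in_rect e (a + t * (a - e ^+ 4)) (b + t * (b - 1)) ->
  two_sided_sol e (a + t * (a - e ^+ 4)) (b + t * (b - 1)) V muL muR ->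
  0 < (muL - muR) / t.
Proof.
move=> ab sU t V muL muR tn0 t50 ab' sV.
have [/andP[a1 a2] /andP[b1 b2]] := ab.
have [a0 b0] := in_rect_gt0 e_gt0 ab; have [bU Um Up] := sU; have [bV Vm Vp] := sV.
have t0 : 0 < `|t| by rewrite normr_gt0.
have A1 : `|a - e ^+ 4| <= 1.
  have e4 := epow 4; have p4 := epowD 0 4; rewrite expr0 in p4.
  by clear - a0 a2 e4 p4 e_gt0 e_small epow epowD; rewrite ler_norml; apply/andP; split; lra.
have B1 : `|b - 1| <= 1.
  by clear - b0 b2 e_gt0 e_small epow epowD; rewrite ler_norml; apply/andP; split; lra.
have daE : `|a - (a + t * (a - e ^+ 4))| <= `|t|.
  by rewrite opprD addrA subrr sub0r normrN normrM ler_piMr.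
have dbE : `|b - (b + t * (b - 1))| <= `|t|.
  by rewrite opprD addrA subrr sub0r normrN normrM ler_piMr.
have aa : a + t * (a - e ^+ 4) <= 2 * a.
  have : t * (a - e ^+ 4) <= `|t|.
    by apply: le_trans (ler_norm _) _; rewrite normrM ler_piMr.
  have := epowD 12 38; have := epow 12; clear - t50 a1 e_gt0 e_small epow epowD; lra.
have UV := two_sided_lip e_gt0 e_small ab ab' aa sU sV.
have [mL mR] := two_sided_mu_lip e_gt0 e_small ab ab' aa sU sV.
have e9 := epow 9; have e12 := epow 12.
set d := `|a - _| + `|b - _| in UV mL mR.
have d2 : d <= 2 * `|t| by rewrite /d; clear - daE dbE e_gt0 e_small epow epowD; lra.
have c9 : 0 <= 200 / e ^+ 9 by rewrite divr_ge0// ltW.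
have c12 : 0 <= 1000 / e ^+ 12 by rewrite divr_ge0// ltW.
pose K1 := 400 / e ^+ 9; pose K2 := 2000 / e ^+ 12.
have UVt n : `|V n - U n| <= K1 * `|t|.
  rewrite distrC; apply: le_trans (UV n) _; have := ler_wpM2l c9 d2.
  by rewrite /K1; clear - e_gt0 e_small epow epowD; lra.
have mLt : `|muL - mu| <= K2 * `|t|.
  rewrite distrC; apply: le_trans mL _; have := ler_wpM2l c12 d2.
  by rewrite /K2; clear - e_gt0 e_small epow epowD; lra.
have mRt : `|muR - mu| <= K2 * `|t|.
  rewrite distrC; apply: le_trans mR _; have := ler_wpM2l c12 d2.
  by rewrite /K2; clear - e_gt0 e_small epow epowD; lra.
have K10 : 0 <= K1 by rewrite divr_ge0// ltW.
have K20 : 0 <= K2 by rewrite divr_ge0// ltW.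
have resid nu n : lattice_eq e nu V n = 0 -> lattice_eq e mu U n = 0 ->
    `|nu - mu| <= K2 * `|t| ->
    `|lin_eq e mu U (fun k => (V k - U k) / t) ((nu - mu) / t) n|
      <= (K2 * K1 + 1000 * K1 ^+ 2) * `|t|.
  move=> Vn Un nut.
  rewrite -(ler_pM2l t0) -normrM -lin_eqZ.
  have -> : t * ((nu - mu) / t) = nu - mu by rewrite mulrCA divff// mulr1.
  have -> : (fun k => t * ((V k - U k) / t)) = (fun k => V k - U k).
    by apply/funext => k; rewrite mulrCA divff// mulr1.
  have w1 : `|V n - U n| <= 5.
    have := box_norm_le n ab bU; have := box_norm_le n ab' bV => h1 h2.
    by apply: le_trans (ler_normB _ _) _; clear - h1 h2 e_gt0 e_small epow epowD; lra.
  have := @lattice_taylor mu (nu - mu) U (fun k => V k - U k) n (box_norm_le n ab bU) w1.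
  have -> : (fun k => U k + (V k - U k)) = V by apply/funext => k; rewrite addrC subrK.
  have -> : mu + (nu - mu) = nu by rewrite addrC subrK.
  rewrite Vn Un subrr sub0r normrN => /le_trans; apply.
  have := ler_pM (normr_ge0 _) (normr_ge0 _) nut (UVt n).
  have := sqr_le (normr_ge0 _) (UVt n).
  by clear - e_gt0 e_small epow epowD; lra.
have h0 : `|(V 0 - U 0) / t + 1 * (a - e ^+ 4)| <= (K2 * K1 + 1000 * K1 ^+ 2) * `|t|.
  have [-> _ _ _ _] := bU; have [-> _ _ _ _] := bV.
  rewrite (_ : _ + _ = 0); last by field.
  by rewrite normr0 mulr_ge0// addr_ge0// mulr_ge0// sqr_ge0.
have h2 : `|(V 2 - U 2) / t - 1 * (b - 1)| <= (K2 * K1 + 1000 * K1 ^+ 2) * `|t|.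
  have [_ -> _ _ _] := bU; have [_ -> _ _ _] := bV.
  rewrite (_ : _ - _ = 0); last by field.
  by rewrite normr0 mulr_ge0// addr_ge0// mulr_ge0// sqr_ge0.
have vD n : `|(V n - U n) / t| <= K1.
  by rewrite normrM normfV ler_pdivrMr.
have := linear_gap e_gt0 e_small ab sU vD ler01 h0 h2
  (fun n hn => resid muL n (Vm n hn) (Um n hn) mLt)
  (fun n hn => resid muR n (Vp n hn) (Up n hn) mRt).
have -> : (muL - mu) / t - (muR - mu) / t = (muL - muR) / t by ring.
apply: lt_le_trans; rewrite mulr1 subr_gt0.
have e21 : (K2 * K1 + 1000 * K1 ^+ 2) <= 100 ^+ 4 / e ^+ 21.
  have : 1 / e ^+ 18 <= 1 / e ^+ 21 / 1000.
    rewrite mulrAC ler_pdivlMr ?epow// (_ : 1 / e ^+ 18 * e ^+ 21 = e ^+ 3); last first.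
      by field; rewrite gt_eqF.
    by have := epowD 0 3; rewrite expr0; clear - e_gt0 e_small epow epowD; lra.
  rewrite /K1 /K2 (_ : _ + _ = 800 * 1000 * (1 / e ^+ 21) + 160 * 1000 * 1000 * (1 / e ^+ 18)).
    by have : 0 < 1 / e ^+ 21 by [rewrite divr_gt0 ?epow]; clear - e_gt0 e_small epow epowD; lra.
  by field; rewrite gt_eqF.
have q := ler_pM _ (normr_ge0 t) e21 t50.
have K0 : 0 <= K2 * K1 + 1000 * K1 ^+ 2 by rewrite addr_ge0// mulr_ge0// sqr_ge0.
have {}q := ler_wpM2l (_ : 0 <= 100 / e ^+ 13) (q K0).
have c13 : 0 <= 100 / e ^+ 13 by rewrite divr_ge0// ltW// epow.
apply: le_lt_trans (q c13) _.
rewrite (_ : _ * _ = 100 ^+ 5 * e ^+ 16); last by field; rewrite gt_eqF.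
have := epowD 12 4; clear - e12 e_gt0 e_small epow epowD; lra.
Qed.

End BorderedSystem.

(** * A zero with a global sign pattern *)

Section SignChange.
Variable R : realType.

Lemma lipschitz_sup_le0 (f : R -> R) (K : R) (A : set R) :
  (forall x y, `|f x - f y| <= K * `|x - y|) -> has_sup A ->
  (forall x, A x -> f x <= 0) -> f (sup A) <= 0.
Proof.
move=> fK supA fA.
have K0 : 0 <= K by have := le_trans (normr_ge0 _) (fK 1 0); rewrite subr0 normr1 mulr1.
apply/ler_addgt0Pr => x x0; rewrite add0r.
have d0 : 0 < x / (K + 1) by rewrite divr_gt0//; lra.
have [y Ay ylt] := sup_adherent d0 supA.
have ysup : y <= sup A by exact: sup_upper_bound.
have := fK (sup A) y; rewrite (ger0_norm (_ : 0 <= sup A - y)) ?subr_ge0//.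
have : K * (sup A - y) <= x.
  apply: (@le_trans _ _ (K * (x / (K + 1)))); first by rewrite ler_wpM2l//; lra.
  by rewrite mulrA ler_pdivrMr; [nra|lra].
by have := fA y Ay; have := ler_norm (f (sup A) - f y); lra.
Qed.

(** Every zero is crossed upwards, so there is only one. [x] is the last point with [f <= 0]. If
    [f y >= 0] for some [y < x], the last such point [z] outside the zone controlled by [x] is a
    zero followed by negative values, against the upward crossing at [z]. *)
Lemma sign_change (f : R -> R) (K L : R) :
  (forall x y, `|f x - f y| <= K * `|x - y|) -> 0 < L -> f 0 < 0 -> 0 < f L ->
  (forall x, 0 < x -> x < L -> f x = 0 -> exists2 eta, 0 < eta &
     forall y, y != x -> `|y - x| <= eta -> 0 < f y / (y - x)) ->
  exists x, [/\ 0 < x < L, f x = 0, forall y, 0 <= y < x -> f y < 0 &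
     forall y, x < y <= L -> 0 < f y].
Proof.
move=> fK L0 f0 fL loc.
have fNK x y : `|(- f x) - (- f y)| <= K * `|x - y|.
  by rewrite -opprD normrN; exact: fK.
pose A := [set x | 0 <= x <= L /\ f x <= 0].
have supA : has_sup A.
  split; first by exists 0; split; [rewrite lexx ltW|exact: ltW].
  by exists L => x [/andP[]].
pose x := sup A; have fx : f x <= 0 by apply: lipschitz_sup_le0 fK supA _ => y [].
have x0 : 0 <= x by apply: sup_upper_bound => //; split; [rewrite lexx ltW|exact: ltW].
have xL : x <= L by apply: ge_sup (proj1 supA) _ => y [/andP[]].
have right y : x < y -> y <= L -> 0 < f y.
  move=> xy yL; rewrite ltNge; apply/negP => fy.
  have : y <= x by apply: sup_upper_bound => //; split=> //; rewrite yL andbT; lra.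
  by rewrite leNgt xy.
have xltL : x < L.
  by rewrite lt_neqAle xL andbT; apply/eqP => xE; move: fx; rewrite xE leNgt fL.
have K0 : 0 <= K by have := le_trans (normr_ge0 _) (fK 1 0); rewrite subr0 normr1 mulr1.
have fx0 : f x = 0.
  apply/eqP; rewrite eq_le fx /=; apply: (@le_add_small _ _ _ K (L - x)).
    by rewrite subr_gt0.
  move=> h /andP[h0 hL]; have : 0 < f (x + h) by apply: right; lra.
  have := fK (x + h) x; rewrite (addrAC x) subrr add0r (gtr0_norm h0).
  by rewrite ler_norml => /andP[_]; lra.
have xgt0 : 0 < x.
  by rewrite lt_neqAle x0 andbT; apply/eqP => xE; move: f0; rewrite [X in f X]xE fx0 ltxx.
exists x; split=> //; first by rewrite xgt0.
  move=> y /andP[y0 yx]; rewrite ltNge; apply/negP => fy.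
  have [eta eta0 etaP] := loc x xgt0 xltL fx0.
  have left z : z < x -> x - z <= eta -> f z < 0.
    move=> zx ze; have := etaP z; rewrite (lt_eqF zx) => /(_ isT).
    rewrite ltr0_norm ?subr_lt0// opprB => /(_ ze).
    by rewrite ltr_ndivlMr ?subr_lt0// mul0r.
  pose A2 := [set z | y <= z <= x - eta /\ 0 <= f z].
  have yeta : y <= x - eta.
    rewrite leNgt; apply/negP => h; have ye : x - y <= eta by lra.
    by have := left y yx ye; clear - fy; lra.
  have supA2 : has_sup A2.
    split; first by exists y; rewrite /A2 /= lexx yeta.
    by exists (x - eta) => z [/andP[]].
  pose z := sup A2.
  have fz : 0 <= f z.
    rewrite -oppr_le0; apply: (lipschitz_sup_le0 fNK supA2) => u [_].
    by rewrite oppr_le0.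
  have zx : z <= x - eta by apply: ge_sup (proj1 supA2) _ => u [/andP[]].
  have yz : y <= z by apply: sup_upper_bound => //; rewrite /A2 /= lexx yeta.
  have between u : z < u -> u < x -> f u < 0.
    move=> zu ux; have [ue|ue] := leP u (x - eta); last by apply: left; clear - ux ue; lra.
    rewrite ltNge; apply/negP => fu.
    have : u <= z by apply: sup_upper_bound => //; rewrite /A2 /= ue fu; split=> //; rewrite andbT; clear - yz zu; lra.
    by rewrite leNgt zu.
  have fz0 : f z = 0.
    apply/eqP; rewrite eq_le fz andbT; apply: (@le_add_small _ _ _ K (x - z)); first (clear - eta0 zx; lra).
    move=> h /andP[h0 hx]; have : f (z + h) < 0 by apply: between; clear - h0 hx; lra.
    have := fK (z + h) z; rewrite (addrAC z) subrr add0r (gtr0_norm h0).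
    by rewrite ler_norml => /andP[+ _]; clear - hx; lra.
  have z0 : 0 < z.
    rewrite lt_neqAle (le_trans y0 yz) andbT; apply/eqP => zE.
    by move: f0; rewrite [X in f X]zE fz0 ltxx.
  have zL : z < L by clear - xltL eta0 zx; lra.
  have [et et0 etP] := loc z z0 zL fz0.
  pose h := Num.min et (x - z) / 2.
  have m0 : 0 < Num.min et (x - z) by rewrite lt_min et0 subr_gt0; clear - eta0 zx; lra.
  have [me mx] : Num.min et (x - z) <= et /\ Num.min et (x - z) <= x - z.
    by split; rewrite ge_min lexx ?orbT.
  have h0 : 0 < h by rewrite /h; clear - m0; lra.
  have := etP (z + h); rewrite (addrAC z) subrr add0r (gtr0_norm h0).
  have -> : z + h != z by rewrite gt_eqF// ltrDl.
  have het : h <= et by rewrite /h; clear - m0 me; lra.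
  move=> /(_ isT het); rewrite pmulr_lgt0 ?invr_gt0//; apply/negP; rewrite -leNgt ltW//.
  by apply: between; rewrite /h; clear - m0 mx; lra.
by move=> y /andP[]; exact: right.
Qed.

End SignChange.

(** * The gap on the rays from the centre *)

Section Rays.
Variables (R : realType) (e : R).
Hypotheses (e_gt0 : 0 < e) (e_small : e <= 1 / 1000).
Implicit Types (a b c s rho : R) (U V : int -> R).

Let epow := epow_gt0 e_gt0.
Arguments epow k%_N.
Let epowD := epowD_le e_gt0 e_small.
Arguments epowD (j k)%_N.

(** The solution over [(a, b)]. The default, the zero sequence, is taken only where no solution
    exists, which [chainP] excludes on the rectangle. *)
Definition chain a b : int -> R :=
  xget (fun=> 0) [set U | two_sided_sol e a b U (left_mu e a U) (right_mu e b U)].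

Definition gap a b := left_mu e a (chain a b) - right_mu e b (chain a b).

Lemma chainP a b : in_rect e a b ->
  two_sided_sol e a b (chain a b) (left_mu e a (chain a b)) (right_mu e b (chain a b)).
Proof.
move=> ab; have [U sU] := two_sided_exists e_gt0 e_small ab.
apply: (@xgetPex _ (fun=> 0)
  [set W | two_sided_sol e a b W (left_mu e a W) (right_mu e b W)]).
by exists U.
Qed.

Lemma chain_box a b : in_rect e a b -> box e 0 a b (chain a b).
Proof. by move=> /chainP[]. Qed.

Lemma gap_eq0_sol a b : in_rect e a b -> gap a b = 0 ->
  two_sided_sol e a b (chain a b) (left_mu e a (chain a b)) (left_mu e a (chain a b)).
Proof. by move=> /chainP + /subr0_eq h; rewrite -h. Qed.

Lemma sol_chain a b U muL muR : in_rect e a b -> two_sided_sol e a b U muL muR ->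
  [/\ U = chain a b, muL = left_mu e a (chain a b) & muR = right_mu e b (chain a b)].
Proof.
move=> ab sU; have UE := two_sided_unique e_gt0 e_small ab sU (chainP ab).
by have [-> ->] := two_sided_mu e_gt0 ab sU; rewrite UE.
Qed.

Lemma chain_lip a b a' b' : in_rect e a b -> in_rect e a' b' -> a' <= 2 * a ->
  forall n, `|chain a b n - chain a' b' n| <= 200 / e ^+ 9 * (`|a - a'| + `|b - b'|).
Proof. by move=> ab ab' aa; exact: (two_sided_lip e_gt0 e_small ab ab' aa (chainP ab) (chainP ab')). Qed.

Lemma gap_lip a b a' b' : in_rect e a b -> in_rect e a' b' ->
  `|gap a b - gap a' b'| <= 2000 / e ^+ 12 * (`|a - a'| + `|b - b'|).
Proof.
(* By symmetry; this supplies the one-sided hypothesis [a' <= 2 * a] of the Lipschitz bounds. *)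
wlog aa : a b a' b' / a' <= a.
  move=> W ab ab'; have [/W|/ltW/W] := leP a' a; first exact.
  by move=> h; rewrite distrC (distrC a) (distrC b); exact: h.
move=> ab ab'; have [a0 _] := in_rect_gt0 e_gt0 ab.
have a2 : a' <= 2 * a by clear - e_gt0 e_small epow epowD aa a0; lra.
have [L Rt] := two_sided_mu_lip e_gt0 e_small ab ab' a2 (chainP ab) (chainP ab').
rewrite /gap.
have -> (x y x' y' : R) : x - y - (x' - y') = (x - x') - (y - y') by ring.
apply: le_trans (ler_normB _ _) _; apply: le_trans (lerD L Rt) _.
by clear - e_gt0 e_small epow epowD; move: (`|a - a'| + `|b - b'|) (e ^+ 12)^-1 => x y; lra.
Qed.

Lemma left_mu_ge a b U : in_rect e a b -> box e 0 a b U -> e ^+ 12 / 2 <= left_mu e a U.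
Proof.
move=> ab bU; have [/andP[a1 a2] _] := ab; have [a0 _] := in_rect_gt0 e_gt0 ab.
have /andP[g1 _] : 1 <= U 1 <= 5 / 2 by apply: (box_ge1 e_gt0 e_small ab bU); left.
have := box_left e_gt0 e_small ab bU (n := -1) isT; have := box_neg bU (n := -1) isT.
have := epowD 0 3; rewrite expr0 => e3 h _.
have {h} : `|U (-1)| <= 1 / 100.
  apply: le_trans h _; apply: (@le_trans _ _ (1 / 1000 ^+ 3 * 1)); last by clear - e_gt0 e_small epow epowD; lra.
  by apply: ler_pM => //; exact: ltW.
rewrite ler_norml => /andP[y1 _]; rewrite /left_mu.
have : e ^+ 12 / 2 <= e ^+ 12 * (U (-1) + U 1) / a.
  rewrite -mulrA ler_pM2l ?epow// ler_pdivlMr//; clear - e_gt0 e_small epow epowD y1 g1 a2; lra.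
have : 0 <= a ^+ 2 * (2 - a ^+ 2) by apply: mulr_ge0; [exact: sqr_ge0|clear - e_gt0 e_small epow epowD a0 a2; nra].
by have := epow 12; clear - e_gt0 e_small epow epowD; move: (_ / a) => w; lra.
Qed.

Lemma gap_boundary a b : in_rect e a b ->
  [\/ a = e ^+ 12 / 2, a = 1, b = e ^+ 4 / 2 | b = 3 / 2] -> 0 < gap a b.
Proof.
move=> ab bd; have bU := chain_box ab; rewrite /gap.
have L0 := left_mu_ge ab bU; have R1 := right_mu_le e_gt0 e_small ab bU.
have [/andP[a1 a2] /andP[b1 b2]] := ab.
have /andP[g1 _] : 1 <= chain a b 1 <= 5 / 2 by apply: (box_ge1 e_gt0 e_small ab bU); left.
have y1 := box_neg bU (n := -1) isT.
have [a0 b0] := in_rect_gt0 e_gt0 ab.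
have /andP[s1 s2] := box_sum13 e_gt0 e_small ab bU.
have := epow 18; have := epow 12; have := epow 6; move=> e6 e12 e18.
have e12' := epowD 0 12; have e3' := epowD 0 3; rewrite expr0 in e12' e3'.
have {}y1 : `|chain a b (-1)| <= 1 / 100.
  apply: le_trans y1 _; apply: (@le_trans _ _ (1 / 1000 ^+ 3 * 1)); last by clear - e_gt0 e_small epow epowD; lra.
  by apply: ler_pM => //; exact: ltW.
move: y1; rewrite ler_norml => /andP[y1 _].
case: bd => [aE|aE|bE|bE].
- have : 9 / 5 <= left_mu e a (chain a b).
    rewrite /left_mu; move: (chain a b (-1)) (chain a b 1) y1 g1 => y g y1 g1.
    have : 9 / 5 <= e ^+ 12 * (y + g) / a.
      rewrite ler_pdivlMr// aE (_ : 9 / 5 * _ = e ^+ 12 * (9 / 10)); last by field.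
      by rewrite ler_pM2l//; clear - e_gt0 e_small epow epowD y1 g1; lra.
    have : 0 <= a ^+ 2 * (2 - a ^+ 2) by apply: mulr_ge0; [exact: sqr_ge0|clear - e_gt0 e_small epow epowD a0 a2; nra].
    by clear - e_gt0 e_small epow epowD e12; move: (_ / a) => w; lra.
  by clear - e_gt0 e_small epow epowD R1 e18; lra.
- have : 1 <= left_mu e a (chain a b).
    rewrite /left_mu; move: (chain a b (-1)) (chain a b 1) y1 g1 => y g y1 g1.
    rewrite aE divr1; have : 0 <= e ^+ 12 * (y + g).
      by apply: mulr_ge0; [exact: ltW|clear - e_gt0 e_small epow epowD y1 g1; lra].
    by clear - e_gt0 e_small epow epowD e12; lra.
  by clear - e_gt0 e_small epow epowD R1 e18; lra.
- suff : right_mu e b (chain a b) <= 0 by clear - e_gt0 e_small epow epowD L0 e12; lra.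
  rewrite /right_mu; move: (chain a b 1 + chain a b 3) s1 => p s1.
  have : 4 * e ^+ 8 <= e ^+ 12 * (p / b).
    rewrite mulrA ler_pdivlMr// bE.
    rewrite (_ : 4 * e ^+ 8 * (e ^+ 4 / 2) = e ^+ 12 * 2); last by field.
    by rewrite ler_pM2l//; clear - e_gt0 e_small epow epowD s1 e6; lra.
  have : b ^+ 2 = e ^+ 8 / 4 by rewrite bE; field.
  have := sqr_ge0 (b ^+ 2); have := epow 8; have := epowD 8 4.
  by clear - e_gt0 e_small epow epowD; move: (_ / b) => w; nra.
- suff : right_mu e b (chain a b) <= 0 by clear - e_gt0 e_small epow epowD L0 e12; lra.
  rewrite /right_mu; move: (chain a b 1 + chain a b 3) s1 => p s1.
  have : 0 <= e ^+ 12 * (p / b).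
    by apply: mulr_ge0; [exact: ltW|apply: divr_ge0; [clear - e_gt0 e_small epow epowD s1 e6; lra|exact: ltW]].
  rewrite bE; clear - e_gt0 e_small epow epowD e12 e12'; move: (_ / (3 / 2)) => w; lra.
Qed.

(** The centre sits at both folds: [left_mu] is near its minimum, at most [6 * e ^+ 8], and
    [right_mu] near its maximum, at least [1 - 3 * e ^+ 12]. *)
Lemma gap_centre : in_rect e (e ^+ 4) 1 /\ gap (e ^+ 4) 1 < 0.
Proof.
have e4 := epow 4; have := epowD 0 4; have := epowD 4 8; rewrite expr0 => e48 e04.
have ab : in_rect e (e ^+ 4) 1 by split; apply/andP; split; clear - e_gt0 e_small epow epowD e48 e04 e4; lra.
split=> //; have bU := chain_box ab; rewrite /gap.
have /andP[g1 g2] : 1 <= chain (e ^+ 4) 1 1 <= 5 / 2 by apply: (box_ge1 e_gt0 e_small ab bU); left.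
have y1 := box_left e_gt0 e_small ab bU (n := -1) isT.
have /andP[s1 s2] := box_sum13 e_gt0 e_small ab bU.
have : left_mu e (e ^+ 4) (chain (e ^+ 4) 1) <= 6 * e ^+ 8.
  rewrite /left_mu; have : e ^+ 12 * (chain (e ^+ 4) 1 (-1) + chain (e ^+ 4) 1 1) / e ^+ 4 <= 3 * e ^+ 8.
    rewrite ler_pdivrMr// (_ : 3 * e ^+ 8 * e ^+ 4 = e ^+ 12 * 3); last by ring.
    rewrite ler_pM2l ?epow//; move: y1; rewrite ler_norml => /andP[_].
    by clear - e_gt0 e_small epow epowD g2 e04; lra.
  have : e ^+ 4 ^+ 2 = e ^+ 8 by ring.
  have := sqr_ge0 (e ^+ 8); have := epow 8; have := epowD 8 4.
  have -> : e ^+ 4 ^+ 4 = e ^+ 8 ^+ 2 by ring.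
  by clear - e_gt0 e_small epow epowD; move: (_ / e ^+ 4) => w; lra.
have : 1 - 3 * e ^+ 12 <= right_mu e 1 (chain (e ^+ 4) 1).
  rewrite /right_mu divr1; have := epow 12; have := epow 6.
  by clear - e_gt0 e_small epow epowD s2; rewrite expr1n subrr expr0n /=; nra.
have := epowD 0 8; have := epowD 0 12; rewrite expr0; clear - e_gt0 e_small epow epowD; lra.
Qed.

Definition clamp (lo hi x : R) := Num.max lo (Num.min x hi).

Lemma clamp_in lo hi x : lo <= hi -> lo <= clamp lo hi x <= hi.
Proof. by move=> lh; rewrite /clamp le_max lexx /= ge_max lh ge_min lexx orbT. Qed.

Lemma clamp_lip lo hi x y : `|clamp lo hi x - clamp lo hi y| <= `|x - y|.
Proof.
have h1 := ler_norm (x - y); have h2 := ler_norm (y - x); rewrite (distrC y) in h2.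
rewrite /clamp ler_norml !maxEle; case: (leP x hi) => ?; case: (leP y hi) => ?;
  do ?[case: ifPn; rewrite -?ltNge => ?]; apply/andP; split; clear epow epowD; lra.
Qed.

Lemma clamp_id lo hi x : lo <= x <= hi -> clamp lo hi x = x.
Proof. by move=> /andP[h1 h2]; rewrite /clamp (min_idPl h2) (max_idPr h1). Qed.

Lemma clamp_hi lo hi x : lo <= hi -> hi <= x -> clamp lo hi x = hi.
Proof. by move=> lh h; rewrite /clamp (min_idPr h) (max_idPr lh). Qed.

Lemma clamp_lo lo hi x : x <= lo -> clamp lo hi x = lo.
Proof. by move=> h; rewrite /clamp; apply/max_idPl; rewrite ge_min h. Qed.

Lemma clamp_interior lo hi x : lo <= hi -> clamp lo hi x != lo -> clamp lo hi x != hi ->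
  lo < x < hi.
Proof.
move=> lh; have [xl|xl] := leP x lo; first by rewrite clamp_lo// eqxx.
by have [xh|//] := leP hi x; rewrite clamp_hi// eqxx.
Qed.

Let ca := clamp (e ^+ 12 / 2) 1.
Let cb := clamp (e ^+ 4 / 2) (3 / 2).

(** Clamping extends the gap to the whole plane: the extension is Lipschitz and, by [gap_boundary],
    positive outside the rectangle, so all rays can be followed over the same interval [[0, 2]]. *)
Definition ray_gap_fun c s rho := gap (ca (e ^+ 4 + rho * c)) (cb (1 + rho * s)).

Lemma clamp_rect x y : in_rect e (ca x) (cb y).
Proof.
have := epowD 0 12; have := epowD 0 4; rewrite expr0 => h1 h2.
by split; apply: clamp_in; clear - e_gt0 e_small epow epowD h1 h2; lra.
Qed.

Lemma ray_gap_fun_lip c s rho c' s' rho' :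
  `|ray_gap_fun c s rho - ray_gap_fun c' s' rho'| <=
  2000 / e ^+ 12 * (`|rho * c - rho' * c'| + `|rho * s - rho' * s'|).
Proof.
apply: le_trans (gap_lip (clamp_rect _ _) (clamp_rect _ _)) _.
rewrite ler_wpM2l ?divr_ge0 ?(ltW (epow 12))//.
have eqD (z x y : R) : (z + x) - (z + y) = x - y by ring.
by rewrite lerD//; apply: le_trans (clamp_lip _ _ _ _) _; rewrite eqD.
Qed.

Definition ray_point c s rho := in_rect e (e ^+ 4 + rho * c) (1 + rho * s).

Lemma ray_gap_fun_in c s rho : ray_point c s rho ->
  ray_gap_fun c s rho = gap (e ^+ 4 + rho * c) (1 + rho * s).
Proof. by move=> [h1 h2]; rewrite /ray_gap_fun /ca /cb !clamp_id. Qed.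

Lemma ray_gap_fun_zero c s rho : ray_gap_fun c s rho = 0 ->
  (e ^+ 12 / 2 < e ^+ 4 + rho * c < 1) /\ (e ^+ 4 / 2 < 1 + rho * s < 3 / 2).
Proof.
move=> G0; have := epowD 0 12; have := epowD 0 4; rewrite expr0 => h1 h2.
have bd x : [\/ ca (e ^+ 4 + rho * c) = e ^+ 12 / 2, ca (e ^+ 4 + rho * c) = 1,
    cb (1 + rho * s) = e ^+ 4 / 2 | cb (1 + rho * s) = 3 / 2] -> x.
  by move/(gap_boundary (clamp_rect _ _)); rewrite -/(ray_gap_fun c s rho) G0 ltxx.
split; apply: clamp_interior.
- by clear - e_gt0 e_small epow epowD h2; lra.
- by apply/eqP => h; apply: bd; constructor 1.
- by apply/eqP => h; apply: bd; constructor 2.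
- by clear - e_gt0 e_small epow epowD h1; lra.
- by apply/eqP => h; apply: bd; constructor 3.
- by apply/eqP => h; apply: bd; constructor 4.
Qed.

Lemma unit_le1 c s : c ^+ 2 + s ^+ 2 = 1 -> `|c| <= 1 /\ `|s| <= 1.
Proof. by move=> cs; rewrite !ler_norml; split; apply/andP; split; nra. Qed.

Lemma ray_zero c s : c ^+ 2 + s ^+ 2 = 1 ->
  exists rho, [/\ 0 < rho < 2, ray_gap_fun c s rho = 0,
    forall x, 0 <= x < rho -> ray_gap_fun c s x < 0 &
    forall x, rho < x <= 2 -> 0 < ray_gap_fun c s x].
Proof.
move=> cs; have [c1 s1] := unit_le1 cs.
have [ab0 gap0] := gap_centre; have := epowD 0 12; have := epowD 0 4; rewrite expr0 => h1 h2.
have e4 := epow 4; have e12 := epow 12.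
apply: (@sign_change _ (ray_gap_fun c s) (2000 / e ^+ 12 * (`|c| + `|s|)) 2) => //.
- move=> x y; apply: le_trans (ray_gap_fun_lip _ _ _ _ _ _) _.
  by rewrite -!mulrBl !normrM -mulrDr mulrA [leRHS]mulrAC.
- by rewrite ray_gap_fun_in /ray_point ?mul0r ?addr0.
- apply: gap_boundary (clamp_rect _ _) _.
  (* One of [|c|] and [|s|] is at least 7/10, and a displacement by 14/10 in that direction leaves
     the rectangle. *)
  have [c7|c7] := leP (7 / 10) c.
    by constructor 2; apply: clamp_hi; clear - e_gt0 e_small epow epowD c7 h1 h2 e4; lra.
  have [c7'|c7'] := leP c (- (7 / 10)).
    by constructor 1; apply: clamp_lo; clear - e_gt0 e_small epow epowD c7' h1 h2 e12; lra.
  have c2 : c ^+ 2 <= 1 / 2 by clear - e_gt0 e_small epow epowD c7 c7'; nra.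
  have [s0|s0] := leP 0 s.
    by constructor 4; apply: clamp_hi; [clear - e_gt0 e_small epow epowD h1; lra|clear - e_gt0 e_small epow epowD s0 c2 cs; nra].
  constructor 3; apply: clamp_lo; clear - e_gt0 e_small epow epowD s0 c2 cs e4.
  have s7 : s <= - (7 / 10) by nra.
  by lra.
move=> rho rho0 rho2 G0; have [/andP[a1 a2] /andP[b1 b2]] := ray_gap_fun_zero G0.
have ab : ray_point c s rho by split; apply/andP; split; exact: ltW.
have rhon0 : rho != 0 by rewrite gt_eqF.
pose m := Num.min (Num.min (e ^+ 4 + rho * c - e ^+ 12 / 2) (1 - (e ^+ 4 + rho * c)))
  (Num.min (1 + rho * s - e ^+ 4 / 2) (3 / 2 - (1 + rho * s))).
exists (Num.min m (e ^+ 50 * rho)).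
  by rewrite !lt_min !subr_gt0 a1 a2 b1 b2 mulr_gt0 ?epow.
move=> x xr; rewrite !le_min => /andP[/andP[/andP[ma mb] /andP[mc md]] me].
have xrn0 : x - rho != 0 by rewrite subr_eq0.
(* The relative displacement: [ray_gap] goes from the radius [rho] to [(1 + t) * rho = x]. *)
pose t := (x - rho) / rho.
have tn0 : t != 0 by rewrite mulf_neq0 ?invr_eq0.
have t50 : `|t| <= e ^+ 50 by rewrite normrM normfV (gtr0_norm rho0) ler_pdivrMr.
have aE : e ^+ 4 + rho * c + t * (e ^+ 4 + rho * c - e ^+ 4) = e ^+ 4 + x * c.
  by rewrite /t; field.
have bE : 1 + rho * s + t * (1 + rho * s - 1) = 1 + x * s by rewrite /t; field.
have xin : ray_point c s x.
  have : `|(x - rho) * c| <= `|x - rho| by rewrite normrM ler_piMr.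
  have : `|(x - rho) * s| <= `|x - rho| by rewrite normrM ler_piMr.
  rewrite !ler_norml => /andP[u1 u2] /andP[v1 v2].
  by split; apply/andP; split; clear - e_gt0 e_small epow epowD u1 u2 v1 v2 ma mb mc md; lra.
have gE : gap (e ^+ 4 + rho * c) (1 + rho * s) = 0 by rewrite -ray_gap_fun_in.
have := ray_gap e_gt0 e_small ab (gap_eq0_sol ab gE) tn0 t50.
rewrite aE bE => /(_ _ _ _ xin (chainP xin)).
rewrite -/(gap _ _) -ray_gap_fun_in// /t invf_div mulrA mulrAC pmulr_lgt0//.
Qed.

End Rays.

(** * Taylor bounds for sine and cosine *)

Section Trigonometry.
Variable R : realType.
Implicit Types (x y h t : R).

Lemma mean_value_le (f df : R -> R) (K : R) : (forall x, is_derive x (1 : R) f (df x)) ->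
  (forall x, `|df x| <= K) -> forall x y, `|f x - f y| <= K * `|x - y|.
Proof.
move=> fdf dfK; have cf : continuous f.
  by move=> z; apply: differentiable_continuous; apply/derivable1_diffP; case: (fdf z).
move=> x y; wlog xy : x y / x <= y.
  by move=> W; have [/W//|/ltW/W] := leP x y; rewrite distrC (distrC y).
have [|z _ zE] := @MVT_segment R f df x y xy (fun z _ => fdf z).
  exact: continuous_subspaceT.
by rewrite distrC zE normrM (distrC x) ler_wpM2r.
Qed.

Lemma taylor_remainder_le (f df : R -> R) (K : R) :
  (forall x, is_derive x (1 : R) f (df x)) ->
  (forall x y, `|df x - df y| <= K * `|x - y|) ->
  forall x h, `|f (x + h) - f x - h * df x| <= K * h ^+ 2.
Proof.
move=> fdf dfK; have cf : continuous f.
  by move=> z; apply: differentiable_continuous; apply/derivable1_diffP; case: (fdf z).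
have K0 : 0 <= K by have := le_trans (normr_ge0 _) (dfK 1 0); rewrite subr0 normr1 mulr1.
(* The base point [w] is taken at either end of the interval, which covers both signs of [h]. *)
have main x y w : x <= w <= y -> `|f y - f x - (y - x) * df w| <= K * (y - x) ^+ 2.
  move=> /andP[xw wy]; have xy := le_trans xw wy.
  have [|z zx ->] := @MVT_segment R f df x y xy (fun z _ => fdf z).
    exact: continuous_subspaceT.
  rewrite mulrC -mulrBr normrM ger0_norm ?subr_ge0// mulrC expr2 mulrA.
  rewrite ler_wpM2r ?subr_ge0//; apply: le_trans (dfK _ _) _; rewrite ler_wpM2l//.
  by move: zx; rewrite in_itv/= ler_norml => /andP[z1 z2]; apply/andP; split; lra.
move=> x h; have [h0|h0] := leP 0 h.
  have := main x (x + h) x; rewrite lexx lerDl h0 => /(_ isT).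
  by rewrite (_ : x + h - x = h)//; ring.
have := main (x + h) x x; rewrite lexx gerDl (ltW h0) => /(_ isT).
rewrite (_ : x - (x + h) = - h); last by ring.
by rewrite sqrrN mulNr opprK -normrN opprD opprB.
Qed.

Lemma cos_lip x y : `|cos x - cos y| <= 1 * `|x - y|.
Proof.
apply: (@mean_value_le _ (fun z => - sin z)) => z.
by rewrite normrN sin_max.
Qed.

Lemma sin_lip x y : `|sin x - sin y| <= 1 * `|x - y|.
Proof. by apply: (@mean_value_le _ cos) => z; exact: cos_max. Qed.

Lemma cos_remainder x h : `|cos (x + h) - cos x + h * sin x| <= h ^+ 2.
Proof.
have := @taylor_remainder_le cos (fun z => - sin z) 1 (fun z => is_derive_cos z) _ x h.
rewrite mulrN opprK mul1r; apply=> u v.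
by rewrite -opprD normrN; exact: sin_lip.
Qed.

Lemma sin_remainder x h : `|sin (x + h) - sin x - h * cos x| <= h ^+ 2.
Proof.
have := @taylor_remainder_le sin cos 1 (fun z => is_derive_sin z) _ x h.
by rewrite mul1r; apply=> u v; exact: cos_lip.
Qed.

Lemma smooth_family_trig (I : Type) (w : R) k :
  smooth_family k (fun t (_ : I) => cos (w * t)) /\
  smooth_family k (fun t (_ : I) => sin (w * t)).
Proof.
have bc : bounded_family (fun t (_ : I) => cos (w * t)) by exists 1 => t _; exact: cos_max.
have bs : bounded_family (fun t (_ : I) => sin (w * t)) by exists 1 => t _; exact: sin_max.
have lipw (f : R -> R) : (forall x y, `|f x - f y| <= 1 * `|x - y|) ->
    exists L : R, forall t h (_ : I), `|f (w * (t + h)) - f (w * t)| <= L * `|h|.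
  by move=> fL; exists `|w| => t h _; apply: le_trans (fL _ _) _; rewrite mul1r -mulrBr addrC addKr normrM.
elim: k => [|k [IHc IHs]]; first by split; (split=> //; [apply: lipw cos_lip || apply: lipw sin_lip]).
have cst (a : R) : smooth_family k (fun=> fun _ : I => a) by apply: (@smooth_family_cst _ _ _ _ `|a|).
split; split=> //.
  exists (fun t _ => - w * sin (w * t)); first by apply: smooth_familyM (cst _) IHs.
  exists (w ^+ 2) => t h _; rewrite mulrDr; have := cos_remainder (w * t) (w * h).
  by rewrite exprMn mulNr mulrN opprK [h * (w * _)]mulrA [h * w]mulrC.
exists (fun t _ => w * cos (w * t)); first by apply: smooth_familyM (cst _) IHc.
exists (w ^+ 2) => t h _; rewrite mulrDr; have := sin_remainder (w * t) (w * h).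
by rewrite exprMn [h * (w * _)]mulrA [h * w]mulrC.
Qed.

End Trigonometry.

(** * From local to global Lipschitz bounds *)

Section ChainedLipschitz.
Variable R : realType.

(** The radius [d] depends on [t] without a lower bound. The local bound at the supremum of the
    points reached from [t] is used twice: on its left to reach it, on its right to pass beyond
    it. *)
Lemma lipschitz_of_local (f : R -> R) (L : R) :
  (forall t, exists2 d : R, 0 < d & forall h : R, `|h| < d -> `|f (t + h) - f t| <= L * `|h|) ->
  forall t h, `|f (t + h) - f t| <= L * `|h|.
Proof.
move=> loc.
have L0 : 0 <= L.
  have [d d0 /(_ (d / 2))] := loc 0; rewrite (gtr0_norm (_ : 0 < d / 2)) ?divr_gt0//.
  move=> /(_ _)/(le_trans (normr_ge0 _)); rewrite pmulr_lge0 ?divr_gt0//; apply; lra.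
suff pos t h : 0 <= h -> `|f (t + h) - f t| <= L * `|h|.
  move=> t h; have [|h0] := leP 0 h; first exact: pos.
  by have := pos (t + h) (- h); rewrite addrK distrC normrN; apply; lra.
move=> h0; rewrite (ger0_norm h0).
pose A := [set x | 0 <= x <= h /\ `|f (t + x) - f t| <= L * x].
have A0 : A 0 by rewrite /A /= lexx h0 addr0 subrr normr0 mulr0.
have supA : has_sup A by split; [exists 0|exists h => x [/andP[]]].
have y0 : 0 <= sup A by exact: sup_upper_bound.
have yh : sup A <= h by apply: ge_sup (proj1 supA) _ => x [/andP[]].
have [d d0 dP] := loc (t + sup A).
have Ay : `|f (t + sup A) - f t| <= L * sup A.
  have [x [xh Ax] xlt] := sup_adherent d0 supA.
  have xy : x <= sup A by exact: sup_upper_bound.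
  have := dP (x - sup A); rewrite addrA [t + sup A + x]addrAC addrK distrC.
  rewrite ger0_norm ?subr_ge0// => h1.
  have {}h1 : `|f (t + sup A) - f (t + x)| <= L * (sup A - x).
    by rewrite distrC; apply: h1; lra.
  rewrite -(subrKA (f (t + x))); apply: le_trans (ler_normD _ _) _.
  by apply: le_trans (lerD h1 Ax) _; rewrite -mulrDr subrK.
have [yE|yh'] := eqVneq (sup A) h; first by rewrite -[X in _ <= L * X]yE -{1}yE.
have {}yh' : sup A < h by rewrite lt_neqAle yh'.
pose z := Num.min (d / 2) (h - sup A).
have z0 : 0 < z by rewrite lt_min divr_gt0//= subr_gt0.
have zd : z <= d / 2 by rewrite ge_min lexx.
have zh : z <= h - sup A by rewrite ge_min lexx orbT.
have : A (sup A + z).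
  split; first by apply/andP; split; lra.
  have := dP z; rewrite (gtr0_norm z0) => h1.
  have {}h1 : `|f (t + sup A + z) - f (t + sup A)| <= L * z by apply: h1; lra.
  rewrite addrA -(subrKA (f (t + sup A))); apply: le_trans (ler_normD _ _) _.
  by apply: le_trans (lerD h1 Ay) _; rewrite -mulrDr addrC lexx.
by move=> /(sup_upper_bound supA); rewrite gerDl leNgt z0.
Qed.

End ChainedLipschitz.

(** * The closed curve of solutions and its smoothness *)

Section LoopFamily.
Variables (R : realType) (e : R).
Hypotheses (e_gt0 : 0 < e) (e_small : e <= 1 / 1000).
Implicit Types (t h : R) (n : int).

Let epow := epow_gt0 e_gt0.
Arguments epow k%_N.
Let epowD := epowD_le e_gt0 e_small.
Arguments epowD (j k)%_N.

Definition loop_cos t : R := cos (2 * pi * t).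
Definition loop_sin t : R := sin (2 * pi * t).

Lemma loop_unit t : loop_cos t ^+ 2 + loop_sin t ^+ 2 = 1.
Proof. exact: cos2Dsin2. Qed.

Definition is_radius c s (rho : R) :=
  [/\ 0 < rho < 2, ray_gap_fun e c s rho = 0,
      forall x, 0 <= x < rho -> ray_gap_fun e c s x < 0 &
      forall x, rho < x <= 2 -> 0 < ray_gap_fun e c s x].

(** The radius depends on [t] only through the cosine and sine, so it takes equal values at 0 and 1;
    the closing of the curve rests on this. *)
Definition radius t : R := xget 0 [set rho | is_radius (loop_cos t) (loop_sin t) rho].
Definition loop_a t := e ^+ 4 + radius t * loop_cos t.
Definition loop_b t := 1 + radius t * loop_sin t.
Definition loop_chain t := chain e (loop_a t) (loop_b t).
Definition loop_mu t := left_mu e (loop_a t) (loop_chain t).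

Lemma radiusP t : is_radius (loop_cos t) (loop_sin t) (radius t).
Proof.
have [rho rhoP] := ray_zero e_gt0 e_small (loop_unit t).
apply: (@xgetPex _ 0 [set rho | is_radius (loop_cos t) (loop_sin t) rho]).
by exists rho.
Qed.

Lemma radius_bounds t : 0 < radius t < 2. Proof. by case: (radiusP t). Qed.

Lemma loop_interior t :
  (e ^+ 12 / 2 < loop_a t < 1) /\ (e ^+ 4 / 2 < loop_b t < 3 / 2).
Proof. by have [_ /(ray_gap_fun_zero e_gt0 e_small)] := radiusP t. Qed.

Lemma loop_rect t : in_rect e (loop_a t) (loop_b t).
Proof.
by have [/andP[a1 a2] /andP[b1 b2]] := loop_interior t; split; apply/andP; split; exact: ltW.
Qed.

Lemma loop_sol t :
  two_sided_sol e (loop_a t) (loop_b t) (loop_chain t) (loop_mu t) (loop_mu t).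
Proof.
apply: (gap_eq0_sol e_gt0 e_small (loop_rect t)).
by rewrite -(ray_gap_fun_in (loop_rect t)); case: (radiusP t).
Qed.

Lemma loop_box t : box e 0 (loop_a t) (loop_b t) (loop_chain t).
Proof. by case: (loop_sol t). Qed.

Lemma loop_lattice t n : lattice_eq e (loop_mu t) (loop_chain t) n = 0.
Proof. by have [_ Lm Rm] := loop_sol t; have [/Lm//|n0] := leP n 0; apply: Rm; lia. Qed.

Lemma loop_norm_le t n : `|loop_chain t n| <= 5 / 2.
Proof. exact: (box_norm_le e_gt0 e_small n (loop_rect t) (loop_box t)). Qed.

Lemma loop_mu_bounds t : e ^+ 12 / 2 <= loop_mu t <= 1 - e ^+ 18 / 8.
Proof.
rewrite (left_mu_ge e_gt0 e_small (loop_rect t) (loop_box t)) /=.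
have [_ ->] := two_sided_mu e_gt0 (loop_rect t) (loop_sol t).
exact: (right_mu_le e_gt0 e_small (loop_rect t) (loop_box t)).
Qed.

(** All unknowns of the bordered system in one family, so that a single local operator acts on the
    chain, the parameter and the radius. *)
Definition loop_data t (i : int + bool) : R :=
  match i with inl n => loop_chain t n | inr false => loop_mu t | inr true => radius t end.

Lemma loop_data_bounded : bounded_family loop_data.
Proof.
exists 3 => t [n|[]] /=.
- by have := loop_norm_le t n; clear epow epowD; lra.
- by have /andP[r1 r2] := radius_bounds t; rewrite gtr0_norm//; clear epow epowD; lra.
have /andP[m1 m2] := loop_mu_bounds t; have := epow 12; have := epow 18 => h1 h2.
by rewrite ger0_norm; clear - e_gt0 e_small epow epowD m1 m2 h1 h2; lra.
Qed.

Let C : R := 1000 / e ^+ 25.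

Lemma C_ge0 : 0 <= C. Proof. by apply: divr_ge0 => //; exact: ltW. Qed.

Let K : R := 2 * pi.

Lemma K_ge0 : 0 <= K. Proof. by rewrite /K mulr_ge0// ltW ?pi_gt0. Qed.

Lemma loop_cos_lip t h : `|loop_cos (t + h) - loop_cos t| <= K * `|h|.
Proof.
apply: le_trans (cos_lip _ _) _.
by rewrite mul1r -mulrBr addrAC subrr add0r normrM ger0_norm ?K_ge0.
Qed.

Lemma loop_sin_lip t h : `|loop_sin (t + h) - loop_sin t| <= K * `|h|.
Proof.
apply: le_trans (sin_lip _ _) _.
by rewrite mul1r -mulrBr addrAC subrr add0r normrM ger0_norm ?K_ge0.
Qed.

(** On the ray of [t] the gap is negative at a slightly smaller radius and positive at a slightly
    larger one. Being Lipschitz in the direction, it keeps these signs on nearby rays, and the sign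
    pattern there encloses their radius. *)
Lemma radius_continuous t (eps : R) : 0 < eps ->
  exists2 d : R, 0 < d & forall h, `|h| < d -> `|radius (t + h) - radius t| <= eps.
Proof.
move=> eps0; have [/andP[r0 r2] _ below above] := radiusP t.
pose x : R := Num.max 0 (radius t - eps); pose y : R := Num.min 2 (radius t + eps).
have x0 : 0 <= x by rewrite le_max lexx.
have xr : x < radius t by rewrite gt_max r0 ltrBlDr ltrDl eps0.
have y2 : y <= 2 by rewrite ge_min lexx.
have ry : radius t < y by rewrite lt_min r2 ltrDl eps0.
have fx : ray_gap_fun e (loop_cos t) (loop_sin t) x < 0 by apply: below; rewrite x0.
have fy : 0 < ray_gap_fun e (loop_cos t) (loop_sin t) y by apply: above; rewrite ry.
pose D := 2000 / e ^+ 12 * (4 * K) + 1.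
have D0 : 0 < D.
  apply: ltr_wpDl => //; apply: mulr_ge0; first by apply: divr_ge0 => //; exact: ltW.
  by apply: mulr_ge0 => //; exact: K_ge0.
have lip (z h : R) : 0 <= z <= 2 -> h != 0 ->
    `|ray_gap_fun e (loop_cos (t + h)) (loop_sin (t + h)) z -
      ray_gap_fun e (loop_cos t) (loop_sin t) z| < D * `|h|.
  move=> /andP[z0 z2] hn0; apply: le_lt_trans (ray_gap_fun_lip e_gt0 e_small _ _ _ _ _ _) _.
  rewrite -!mulrBr !normrM (ger0_norm z0).
  have -> : D * `|h| = 2000 / e ^+ 12 * (4 * K * `|h|) + `|h| by rewrite /D; ring.
  apply: ltr_pwDr; first by rewrite normr_gt0.
  apply: ler_wpM2l; first by apply: divr_ge0 => //; exact: ltW.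
  have h1 := ler_pM z0 (normr_ge0 _) z2 (loop_cos_lip t h).
  have h2 := ler_pM z0 (normr_ge0 _) z2 (loop_sin_lip t h).
  by clear - h1 h2 e_gt0 e_small epow epowD; lra.
pose m : R := Num.min (- ray_gap_fun e (loop_cos t) (loop_sin t) x)
  (ray_gap_fun e (loop_cos t) (loop_sin t) y).
exists (m / D); first by rewrite divr_gt0// lt_min oppr_gt0 fx fy.
move=> h hd; have [->|hn0] := eqVneq h 0; first by rewrite addr0 subrr normr0 ltW.
have Dh : D * `|h| < m by rewrite mulrC -ltr_pdivlMr.
have mx : m <= - ray_gap_fun e (loop_cos t) (loop_sin t) x by rewrite ge_min lexx.
have my : m <= ray_gap_fun e (loop_cos t) (loop_sin t) y by rewrite ge_min lexx orbT.
have x2 : 0 <= x <= 2 by rewrite x0 (le_trans (ltW xr))// ltW.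
have y2' : 0 <= y <= 2 by rewrite y2 andbT (le_trans (ltW r0))// ltW.
have := lip x h x2 hn0; have := lip y h y2' hn0; rewrite !ltr_norml => /andP[u1 _] /andP[_ u2].
have [/andP[r0' r2'] _ below' above'] := radiusP (t + h).
have xr' : x <= radius (t + h).
  rewrite leNgt; apply/negP => rx; have := above' x; rewrite rx; move: x2 => /andP[_ ->] /(_ isT).
  by clear - u2 mx Dh e_gt0 e_small epow epowD; lra.
have ry' : radius (t + h) <= y.
  rewrite leNgt; apply/negP => rx; have := below' y; rewrite rx; move: y2' => /andP[-> _] /(_ isT).
  by clear - u1 my Dh e_gt0 e_small epow epowD; lra.
have xe : radius t - eps <= x by rewrite le_max lexx orbT.
have ye : y <= radius t + eps by rewrite ge_min lexx orbT.
by rewrite ler_norml; apply/andP; split; clear - xr' ry' xe ye e_gt0 e_small epow epowD; lra.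
Qed.

Lemma loop_a_le t h : `|loop_a t - loop_a (t + h)| <=
  `|radius (t + h) - radius t| + 2 * K * `|h|.
Proof.
rewrite /loop_a; set r := radius t; set r' := radius (t + h).
rewrite (_ : _ - _ = (r - r') * loop_cos t + r' * (loop_cos t - loop_cos (t + h))); last by ring.
apply: le_trans (ler_normD _ _) _; rewrite !normrM (distrC r) (distrC (loop_cos t)).
have /andP[r0 r2] := radius_bounds (t + h).
apply: lerD; first by rewrite ler_piMr// cos_max.
by rewrite -mulrA ler_pM ?loop_cos_lip// gtr0_norm// ltW.
Qed.

Lemma loop_b_le t h : `|loop_b t - loop_b (t + h)| <=
  `|radius (t + h) - radius t| + 2 * K * `|h|.
Proof.
rewrite /loop_b; set r := radius t; set r' := radius (t + h).
rewrite (_ : _ - _ = (r - r') * loop_sin t + r' * (loop_sin t - loop_sin (t + h))); last by ring.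
apply: le_trans (ler_normD _ _) _; rewrite !normrM (distrC r) (distrC (loop_sin t)).
have /andP[r0 r2] := radius_bounds (t + h).
apply: lerD; first by rewrite ler_piMr// sin_max.
by rewrite -mulrA ler_pM ?loop_sin_lip// gtr0_norm// ltW.
Qed.

Lemma loop_data_continuous t (eps : R) : 0 < eps ->
  exists2 d : R, 0 < d & forall h, `|h| < d -> forall i,
    `|loop_data (t + h) i - loop_data t i| <= eps.
Proof.
move=> eps0; pose D := 2000 / e ^+ 12 + 1.
have D1 : 1 <= D by rewrite lerDr divr_ge0// ltW.
have D0 : 0 < D by clear - D1 e_gt0 e_small epow epowD; lra.
pose x : R := Num.min (eps / (4 * D)) (e ^+ 12 / 4).
have x0 : 0 < x by rewrite lt_min !divr_gt0 ?mulr_gt0 ?epow.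
have [d d0 dP] := radius_continuous t (divr_gt0 x0 (ltr0n R 2)).
have K1 : 0 < 4 * K + 1 by apply: ltr_wpDl => //; apply: mulr_ge0 => //; exact: K_ge0.
exists (Num.min d (x / (4 * K + 1))).
  by rewrite lt_min d0; apply: divr_gt0.
move=> h; rewrite lt_min => /andP[/dP rh hx].
have Kh : 2 * K * `|h| <= x / 2.
  move: hx; rewrite ltr_pdivlMr// => hx.
  by have := normr_ge0 h; clear - hx e_gt0 e_small epow epowD; lra.
have ax : `|loop_a t - loop_a (t + h)| <= x.
  by apply: le_trans (loop_a_le t h) _; clear - rh Kh e_gt0 e_small epow epowD; lra.
have bx : `|loop_b t - loop_b (t + h)| <= x.
  by apply: le_trans (loop_b_le t h) _; clear - rh Kh e_gt0 e_small epow epowD; lra.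
have xe : x <= eps / (4 * D) by rewrite ge_min lexx.
have xe12 : x <= e ^+ 12 / 4 by rewrite ge_min lexx orbT.
have eps1 : D * (2 * x) <= eps.
  move: xe; rewrite ler_pdivlMr ?mulr_gt0//; clear - eps0 D0 e_gt0 e_small epow epowD; lra.
have aa : loop_a (t + h) <= 2 * loop_a t.
  have [/andP[a1 _] _] := loop_rect t; have := epow 12.
  by move: ax; rewrite ler_norml => /andP[ax _]; clear - ax a1 xe12 e_gt0 e_small epow epowD; lra.
have eps2 (c : R) : 0 <= c <= D -> c * (`|loop_a t - loop_a (t + h)| + `|loop_b t - loop_b (t + h)|) <= eps.
  move=> /andP[c0 cD]; apply: le_trans eps1; apply: ler_pM => //.
    exact: addr_ge0.
  by clear - ax bx e_gt0 e_small epow epowD; lra.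
move=> [n|[]] /=; rewrite distrC.
- apply: le_trans (chain_lip e_gt0 e_small (loop_rect _) (loop_rect _) aa n) _.
  apply: eps2; rewrite divr_ge0 ?(ltW (epow 9))//=.
  have : 200 / e ^+ 9 <= 2000 / e ^+ 12.
    apply: le_trans (le_inv_epow e_gt0 e_small (k := 12) (ler0n R 200) _) _ => //.
    by rewrite ler_wpM2r ?invr_ge0 ?(ltW (epow 12))// ler_nat.
  by move/le_trans; apply; rewrite /D lerDl.
- rewrite distrC; apply: le_trans rh _; apply: le_trans eps1.
  by apply: (@le_trans _ _ (1 * (2 * x))); [clear - x0 e_gt0 e_small epow epowD; lra|rewrite ler_wpM2r ?mulr_ge0 ?(ltW x0)].
have [+ _] := two_sided_mu_lip e_gt0 e_small (loop_rect _) (loop_rect _) aa (loop_sol t) (loop_sol (t + h)).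
move/le_trans; apply; apply: eps2; rewrite divr_ge0 ?(ltW (epow 12))//=.
have : 1000 / e ^+ 12 <= 2000 / e ^+ 12.
  by rewrite ler_wpM2r ?invr_ge0 ?(ltW (epow 12))// ler_nat.
  by move/le_trans; apply; rewrite /D lerDl.
Qed.

(* The linearised problem for [loop_data]: the indices [inl n] carry the lattice
   equations, [inr false] and [inr true] the ray conditions on [U 0] and [U 2]. *)
Definition loop_site (l : 'I_4) (i : int + bool) : int + bool :=
  match i with
  | inl n => nth (inr false) [:: inl (n + 1); inl (n - 1); inl n; inr false] l
  | inr b => nth (inr true) [:: inl (if b then 2 else 0)] l
  end.

Definition loop_coef (l : 'I_4) t (i : int + bool) : R :=
  match i with
  | inl n => nth 0 [:: e ^+ 12; e ^+ 12;
      - 2 * e ^+ 12 + loop_mu t - 6 * loop_chain t n ^+ 2 + 5 * loop_chain t n ^+ 4;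
      loop_chain t n] l
  | inr b => nth 0 [:: 1; if b then - loop_sin t else loop_cos t] l
  end.

Lemma loop_local_op t v i : local_op loop_site (fun l => loop_coef l t) v i =
  match i with
  | inl n => lin_eq e (loop_mu t) (loop_chain t) (fun k => v (inl k)) (v (inr false)) n
  | inr false => v (inl 0) + loop_cos t * v (inr true)
  | inr true => v (inl 2) - loop_sin t * v (inr true)
  end.
Proof.
rewrite /local_op !big_ord_recl big_ord0.
by case: i => [n|[]] /=; rewrite /lin_eq; ring.
Qed.

Lemma loop_bounded_below t : bounded_below loop_site (fun l => loop_coef l t) C.
Proof.
move=> v [D vD] M vM; have aE : loop_a t - e ^+ 4 = radius t * loop_cos t.
  by rewrite /loop_a addrAC subrr add0r.
have bE : loop_b t - 1 = radius t * loop_sin t by rewrite /loop_b addrAC subrr add0r.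
have r02 : 0 < radius t <= 2 by have /andP[-> /ltW] := radius_bounds t.
have [||||v1 m1 r1] := bordered_bound e_gt0 e_small (v := fun k => v (inl k))
  (m := v (inr false)) (r := v (inr true)) (M := M) (D := D) (loop_rect t) (loop_sol t) aE bE r02.
- by move=> n; exact: vD.
- by move=> n; have := vM (inl n); rewrite loop_local_op.
- by have := vM (inr false); rewrite loop_local_op.
- by have := vM (inr true); rewrite loop_local_op.
by case=> [n|[]].
Qed.

Let diff t h i := loop_data (t + h) i - loop_data t i.

(** Both members of the family solve the lattice equation, so the linearised equation fails by the
    Taylor remainder only. *)
Lemma lin_defect t h n (M : R) : (forall i, `|diff t h i| <= M) ->
  `|local_op loop_site (fun l => loop_coef l t) (diff t h) (inl n)| <= 1001 * M ^+ 2.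
Proof.
move=> dM; rewrite loop_local_op.
have w5 : `|diff t h (inl n)| <= 5.
  apply: le_trans (ler_normB _ _) _; apply: le_trans (lerD (loop_norm_le _ n) (loop_norm_le _ n)) _.
  by clear - e_gt0 e_small epow epowD C K diff; lra.
have := lattice_taylor e (loop_mu t) (diff t h (inr false)) (loop_norm_le t n)
  (w := fun k => diff t h (inl k)) w5.
have -> : (fun k => loop_chain t k + diff t h (inl k)) = loop_chain (t + h).
  by apply/funext => k; rewrite /diff /= addrC subrK.
rewrite [loop_mu t + _]addrC subrK !loop_lattice subrr sub0r normrN => /le_trans; apply.
have := ler_pM (normr_ge0 _) (normr_ge0 _) (dM (inr false)) (dM (inl n)).
have := ler_pM (normr_ge0 _) (normr_ge0 _) (dM (inl n)) (dM (inl n)).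
by rewrite -!expr2; move: (_ ^+ 2) (_ * _) => u v; clear - e_gt0 e_small epow epowD C K diff; lra.
Qed.

(** The ray conditions are bilinear in the radius and the direction, so the defect is known exactly:
    the change of direction times the new radius. *)
Lemma diff_bool t h b : local_op loop_site (fun l => loop_coef l t) (diff t h) (inr b) =
  radius (t + h) * (if b then loop_sin (t + h) - loop_sin t else loop_cos t - loop_cos (t + h)).
Proof.
have [Uh0 Uh2 _ _ _] := loop_box (t + h); have [U0 U2 _ _ _] := loop_box t.
rewrite loop_local_op /diff; case: b => /=.
  by rewrite Uh2 U2 /loop_b; ring.
by rewrite Uh0 U0 /loop_a; ring.
Qed.

Lemma diff_bool_le t h b :
  `|local_op loop_site (fun l => loop_coef l t) (diff t h) (inr b)| <= 2 * K * `|h|.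
Proof.
rewrite diff_bool normrM -mulrA; have /andP[r0 r2] := radius_bounds (t + h).
apply: ler_pM => //; first by rewrite gtr0_norm// ltW.
by case: b; [exact: loop_sin_lip|rewrite distrC; exact: loop_cos_lip].
Qed.

(** Near [t] the increments are at most [eps] by continuity, so the quadratic defect costs at most
    half of them, and the lower bound bootstraps to a Lipschitz bound. Its constant does not depend
    on [t] although the neighbourhood does, as [lipschitz_of_local] requires. *)
Lemma loop_data_lip t h i : `|diff t h i| <= 4 * C * K * `|h|.
Proof.
apply: (@lipschitz_of_local _ (fun t => loop_data t i)) => {}t.
have C0 : 0 < C by rewrite /C divr_gt0.
have eps0 : 0 < 1 / (2002 * (C + 1)).
  by apply: divr_gt0 => //; apply: mulr_gt0 => //; clear - C0 e_gt0 e_small epow epowD C K diff; lra.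
have [d d0 dP] := loop_data_continuous t eps0; exists d => // {}h /dP dh.
set eps := 1 / _ in eps0 dh.
have epsE : 1001 * C * eps <= 2^-1.
  rewrite /eps mulrA mulr1 ler_pdivrMr.
    by clear - C0 e_gt0 e_small epow epowD C K diff; lra.
  by apply: mulr_gt0 => //; clear - C0 e_gt0 e_small epow epowD C K diff; lra.
have -> : 4 * C * K * `|h| = 2 * (C * (2 * K * `|h|)) by ring.
apply: (half_bootstrap (f := diff t h) dh) => M dM j.
(* [M] may be large; the cut-off at [eps] is what gives [C * (1001 * N ^+ 2) <= N / 2]. *)
pose N : R := Num.min M eps.
have NM : N <= M by rewrite ge_min lexx.
have Ne : N <= eps by rewrite ge_min lexx orbT.
have dN l : `|diff t h l| <= N by rewrite le_min dM dh.
have N0 := le_trans (normr_ge0 _) (dN j).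
have Kh : 0 <= 2 * K * `|h| by apply: mulr_ge0 => //; apply: mulr_ge0 => //; exact: K_ge0.
have CN : C * (1001 * N ^+ 2) <= N / 2.
  rewrite (_ : C * _ = N * (1001 * C * N)); last by ring.
  rewrite ler_wpM2l//; apply: le_trans epsE; rewrite ler_wpM2l//.
  by clear - C0 e_gt0 e_small epow epowD C K diff; lra.
have := @loop_bounded_below t (diff t h) (ex_intro _ eps dh) (1001 * N ^+ 2 + 2 * K * `|h|).
move=> /(_ _ j)/le_trans; apply.
  move=> [n|b].
    apply: le_trans (lin_defect n dN) _.
    by rewrite lerDl.
  by apply: le_trans (diff_bool_le _ _ _) _; rewrite lerDr mulr_ge0// sqr_ge0.
rewrite mulrDr lerD2r; clear - CN NM e_gt0 e_small epow epowD C K diff; lra.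
Qed.

(** The right-hand side of the differentiated system: minus the [t]-derivative, at fixed radius, of
    the conditions [U 0 + e ^+ 4 + radius t * loop_cos t = 0] and
    [U 2 - 1 - radius t * loop_sin t = 0]. [K] is the angular speed. *)
Definition loop_source t (i : int + bool) : R :=
  match i with
  | inl _ => 0
  | inr b => K * (if b then loop_cos t else loop_sin t) * radius t
  end.

Lemma loop_data_linearised : exists B : R, forall t h i,
  `|local_op loop_site (fun l => loop_coef l t) (diff t h) i - h * loop_source t i|
    <= B * h ^+ 2.
Proof.
have K0 := K_ge0; pose L := 4 * C * K.
have L0 : 0 <= L by apply: mulr_ge0 => //; apply: mulr_ge0 => //; exact: C_ge0.
have dL t h i : `|diff t h i| <= L * `|h| by exact: loop_data_lip.
have rem t h (x y : R) : `|x| <= (K * h) ^+ 2 -> `|y| <= 1 ->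
    `|radius (t + h) * x + h * K * y * (radius (t + h) - radius t)| <=
    (2 * K ^+ 2 + K * L) * h ^+ 2.
  move=> xh y1; apply: le_trans (ler_normD _ _) _.
  rewrite (normrM (radius _)) (normrM (h * K * y)) (normrM (h * K)) (normrM h) mulrDl.
  have /andP[r0 r2] := radius_bounds (t + h); apply: lerD.
    by rewrite -mulrA -exprMn ler_pM// gtr0_norm// ltW.
  rewrite (ger0_norm K0) (_ : K * L * _ = `|h| * K * 1 * (L * `|h|)); last first.
    by rewrite -(sqr_normr h); ring.
  apply: ler_pM => //; last exact: (dL t h (inr true)).
    by apply: mulr_ge0 => //; apply: mulr_ge0.
  by apply: ler_wpM2l => //; apply: mulr_ge0.
pose P := 1001 * L ^+ 2; pose Q := 2 * K ^+ 2 + K * L.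
have P0 : 0 <= P by apply: mulr_ge0 => //; exact: sqr_ge0.
have Q0 : 0 <= Q by apply: addr_ge0; apply: mulr_ge0 => //; exact: sqr_ge0.
exists (P + Q) => t h i; have h20 := sqr_ge0 h.
case: i => [n|b].
  rewrite /= mulr0 subr0; apply: le_trans (lin_defect n (dL t h)) _.
  by rewrite exprMn sqr_normr mulrA -/P ler_wpM2r// lerDl.
apply: (@le_trans _ _ (Q * h ^+ 2)); last by rewrite ler_wpM2r// lerDr.
rewrite diff_bool /loop_source; case: b.
  rewrite (_ : _ - _ = radius (t + h) * (loop_sin (t + h) - loop_sin t - K * h * loop_cos t)
    + h * K * loop_cos t * (radius (t + h) - radius t)); last by ring.
  apply: rem; last exact: cos_max.
  by rewrite /loop_sin mulrDr; exact: sin_remainder.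
rewrite (_ : _ - _ = radius (t + h) * - (loop_cos (t + h) - loop_cos t + K * h * loop_sin t)
  + h * K * loop_sin t * (radius (t + h) - radius t)); last by ring.
apply: rem; last exact: sin_max.
by rewrite normrN /loop_cos mulrDr; exact: cos_remainder.
Qed.

Lemma smooth_loop_coef k l : smooth_family k loop_data -> smooth_family k (loop_coef l).
Proof.
move=> xk.
have cst (I : Type) (c : R) : smooth_family k (fun=> fun _ : I => c).
  by apply: (@smooth_family_cst _ _ _ _ `|c|).
(* Indicators of the two border indices, by which the case distinction becomes a sum of products. *)
have sel (b : bool) : smooth_family k (fun=> fun b' : bool => (b == b')%:R : R).
  by apply: (@smooth_family_cst _ _ _ _ 1) => b'; case: eqP; rewrite ?normr0 ?normr1.
have [Ck Sk] := smooth_family_trig bool K k.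
have Uk : smooth_family k loop_chain := smooth_family_reindex (fun n => inl n) xk.
have mk : smooth_family k (fun t (_ : int) => loop_mu t) :=
  smooth_family_reindex (fun=> inr false) xk.
have intk : smooth_family k (fun t n => nth 0 [:: e ^+ 12; e ^+ 12;
    - 2 * e ^+ 12 + loop_mu t - 6 * loop_chain t n ^+ 2 + 5 * loop_chain t n ^+ 4;
    loop_chain t n] l).
  case: (nat_of_ord l) => [|[|[|[|j]]]] /=; [exact: cst|exact: cst| |exact: Uk|].
    have U2 := smooth_familyM Uk Uk.
    apply: smooth_family_ext (smooth_familyD (smooth_familyD (cst _ (- 2 * e ^+ 12)) mk)
      (smooth_familyM U2 (smooth_familyD (cst _ (- 6)) (smooth_familyM (cst _ 5) U2)))).
    by move=> t n; ring.
  by apply: smooth_family_ext (cst _ 0) => t n; rewrite nth_nil.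
have boolk : smooth_family k (fun t (b : bool) =>
    nth 0 [:: 1; if b then - loop_sin t else loop_cos t] l).
  case: (nat_of_ord l) => [|[|j]] /=; [exact: cst| |].
    apply: smooth_family_ext (smooth_familyD (smooth_familyM (sel false) Ck)
      (smooth_familyM (sel true) (smooth_familyM (cst _ (-1)) Sk))).
    by move=> t [] /=; rewrite /loop_cos /loop_sin -/K; ring.
  by apply: smooth_family_ext (cst _ 0) => t n; rewrite nth_nil.
exact: smooth_family_sum intk boolk.
Qed.

Lemma smooth_loop_source k : smooth_family k loop_data -> smooth_family k loop_source.
Proof.
move=> xk.
have sel (b : bool) : smooth_family k (fun=> fun b' : bool => (b == b')%:R * K : R).
  apply: (@smooth_family_cst _ _ _ _ K) => b'.
  by case: eqP => _; rewrite ?mul0r ?mul1r ?normr0 ?ger0_norm; rewrite ?K_ge0.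
have [Ck Sk] := smooth_family_trig bool K k.
have rk : smooth_family k (fun t (_ : bool) => radius t) :=
  smooth_family_reindex (fun=> inr true) xk.
have intk : smooth_family k (fun=> fun _ : int => 0 : R).
  by apply: (@smooth_family_cst _ _ _ _ 0) => ?; rewrite normr0.
have boolk : smooth_family k (fun t (b : bool) =>
    K * (if b then loop_cos t else loop_sin t) * radius t).
  apply: smooth_family_ext (smooth_familyM (smooth_familyD (smooth_familyM (sel false) Sk)
    (smooth_familyM (sel true) Ck)) rk).
  by move=> t [] /=; rewrite /loop_cos /loop_sin -/K; ring.
exact: smooth_family_sum intk boolk.
Qed.

(** The derivative of [loop_data] solves the linearised system, whose coefficients are polynomials
    in [loop_data] and the trigonometric functions. So [k] degrees for [loop_data] give [k] degrees
    for its derivative, hence [k.+1] for itself. *)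
Lemma smooth_loop_data k : smooth_family k loop_data.
Proof.
elim: k => [|k IH]; first by split; [exact: loop_data_bounded|exists (4 * C * K) => t h i; exact: loop_data_lip].
split; first exact: loop_data_bounded.
have [B dB] := loop_data_linearised.
have ck l := smooth_loop_coef l IH.
have [Q cQ] := choice (fun l => smooth_family_bounded (ck l)).
have cS t l i : `|loop_coef l t i| <= \sum_j `|Q j|.
  apply: le_trans (cQ l t i) _; apply: le_trans (ler_norm _) _.
  by rewrite (bigD1 l)//= lerDl; apply: sumr_ge0.
have dbd t h : exists D : R, forall i, `|diff t h i| <= D.
  by exists (4 * C * K * `|h|) => i; exact: loop_data_lip.
have [x' x'P] := choice (fun t => differentiable_of_bounded_below C_ge0 (cS t)
  (@loop_bounded_below t) (dbd t) (dB t)).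
exists x'; last by exists (C * B) => t h i; have [_ _] := x'P t; apply.
apply: (smooth_family_solution C_ge0 ck (smooth_loop_source IH)) => t.
- by have [] := x'P t.
- exact: loop_bounded_below.
- by have [] := x'P t.
Qed.

End LoopFamily.

(** * From smooth families to smooth curves in the sequence space *)

Section CurveDerivatives.
Variable R : realType.

Lemma is_derive_of_remainder (V : normedModType R) (c c' : R -> V) (B : R) :
  (forall t h, `|c (t + h) - c t - h *: c' t| <= B * h ^+ 2) ->
  forall t, is_derive t (1 : R) c (c' t).
Proof.
move=> cB t; have cvgc : h^-1 *: (c (h + t) - c t) @[h --> 0^'] --> c' t.
  apply/cvgrPdist_le => eps eps0.
  have B0 : 0 <= B by have := le_trans (normr_ge0 _) (cB 0 1); rewrite expr1n mulr1.
  have B1 : 0 < B + 1 by lra.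
  have d0 : 0 < eps / (B + 1) by rewrite divr_gt0.
  near=> h; have hn0 : h != 0 by near: h; exact: nbhs_dnbhs_neq.
  have hd : `|h| < eps / (B + 1).
    by near: h; exact: dnbhs0_lt.
  have -> : c' t - h^-1 *: (c (h + t) - c t) = - (h^-1 *: (c (t + h) - c t - h *: c' t)).
    by rewrite (addrC h) (scalerBr _ (_ - _)) scalerK// opprB.
  rewrite normrN normrZ normfV; apply: le_trans (ler_wpM2l _ (cB t h)) _; first by rewrite invr_ge0.
  have nh0 : `|h| != 0 by rewrite normr_eq0.
  have hE : h ^+ 2 = `|h| * `|h| by rewrite -expr2 real_normK ?num_real.
  have -> : `|h|^-1 * (B * h ^+ 2) = B * `|h| by rewrite hE mulrCA mulKf.
  rewrite ltr_pdivlMr// in hd; have := normr_ge0 h; lra.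
have dE : (fun h : R => h^-1 *: ((c \o shift t) (h *: (1 : R)) - c t)) =
    (fun h => h^-1 *: (c (h + t) - c t)).
  by apply/funext => h; rewrite /= [h *: _]mulr1.
apply: DeriveDef; first by rewrite /derivable dE; apply/cvg_ex; exists (c' t).
by rewrite /derive dE; exact: cvg_lim.
Unshelve. all: by end_near.
Qed.

Lemma derive1n_of_remainder (V : normedModType R) (c : nat -> R -> V) (B : nat -> R) :
  (forall k t h, `|c k (t + h) - c k t - h *: c k.+1 t| <= B k * h ^+ 2) ->
  forall k, (c 0%N)^`(k)%classic = c k.
Proof.
move=> cB; elim=> [|k IH]; first by [].
rewrite derive1nS IH; apply/funext => t; rewrite derive1E.
by have dk := is_derive_of_remainder (cB k) t; rewrite derive_val.
Qed.

(** [smooth_family k] provides a derivative for each [k] separately; the remainder property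
    determines it, so choosing by that property yields one derivative for all [k]. *)
Definition family_derivative I (x : R -> I -> R) : R -> I -> R :=
  xget (fun=> fun=> 0) [set x' | exists B : R, forall t h i,
    `|x (t + h) i - x t i - h * x' t i| <= B * h ^+ 2].

Lemma smooth_family_derivative I (x : R -> I -> R) :
  (forall k, smooth_family k x) -> forall k, smooth_family k (family_derivative x).
Proof.
move=> xs k; have [_ [x' x'k [B x'B]]] := xs k.+1.
suff -> : family_derivative x = x' by [].
apply: xget_unique; first by exists B.
move=> y [D yD]; apply/funext => t; apply/funext => i; apply/eqP.
rewrite -subr_eq0 -normr_le0; apply: (@le_add_small _ _ _ (B + D) 1) => // h /andP[h0 _].
rewrite add0r -(ler_pM2l h0) -[h in leLHS](gtr0_norm h0) -normrM.
rewrite (_ : h * (y t i - x' t i) = (x (t + h) i - x t i - h * x' t i)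
  - (x (t + h) i - x t i - h * y t i)); last by ring.
apply: le_trans (ler_normB _ _) _; apply: le_trans (lerD (x'B t h i) (yD t h i)) _.
by rewrite -mulrDl (_ : h * ((B + D) * h) = (B + D) * h ^+ 2)//; ring.
Qed.

Lemma family_derivative_remainder I (x : R -> I -> R) :
  (forall k, smooth_family k x) -> exists B : R, forall t h i,
    `|x (t + h) i - x t i - h * family_derivative x t i| <= B * h ^+ 2.
Proof.
move=> /(_ 1%N) [_ [x' _ [B x'B]]].
apply: (@xgetPex _ (fun=> fun=> 0) [set x' | exists B : R, forall t h i,
    `|x (t + h) i - x t i - h * x' t i| <= B * h ^+ 2]).
by exists x', B.
Qed.

Lemma pair_norm_le (U V : normedModType R) (x : U * V) (M : R) :
  (`|x| <= M) = (`|x.1| <= M) && (`|x.2| <= M).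
Proof. by rewrite prod_normE ge_max. Qed.

Lemma pair_bounded (x : R -> int + bool -> R) : bounded_family x ->
  forall t, (fun n : int => (x t (inl (n - 1)), x t (inl n))) \in @is_bounded_seq R.
Proof.
move=> [B xB] t; apply/asboolP; exists B => n.
by rewrite (@pair_norm_le R R) /= !xB.
Qed.

(** The orbit with [n]-th point [(U_(n-1), U_n)], paired with [mu]; the radius is dropped. *)
Definition family_curve (x : R -> int + bool -> R) (xb : bounded_family x) t :
  ellinf R * R := (Ellinf (pair_bounded xb t), x t (inr false)).

Lemma family_curve_remainder x x' (xb : bounded_family x) (xb' : bounded_family x')
    (B : R) :
  (forall t h i, `|x (t + h) i - x t i - h * x' t i| <= B * h ^+ 2) ->
  forall t h, `|family_curve xb (t + h) - family_curve xb t - h *: family_curve xb' t|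
    <= B * h ^+ 2.
Proof.
move=> xB t h; rewrite pair_norm_le; apply/andP; split; last exact: xB.
by apply: sup_norm_le => n; rewrite (@pair_norm_le R R); apply/andP; split; exact: xB.
Qed.

Lemma smooth_family_curve x (xb : bounded_family x) :
  (forall k, smooth_family k x) ->
  forall k s, derivable ((family_curve xb)^`(k)%classic) s 1.
Proof.
move=> xs; pose X k := iter k (@family_derivative (int + bool)%type) x.
have Xs j k : smooth_family k (X j).
  by elim: j k => [|j IH] k; [exact: xs|exact: (smooth_family_derivative IH)].
pose Xb j := smooth_family_bounded (Xs j 0%N).
have [B XB] := choice (fun j => family_derivative_remainder (Xs j)).
have cB j := family_curve_remainder (Xb j) (Xb j.+1) (XB j).
have -> : family_curve xb = family_curve (Xb 0%N).
  by apply/funext => t; congr (_, _); apply: val_inj.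
move=> k s; rewrite (derive1n_of_remainder cB).
by have [] := is_derive_of_remainder (cB k) s.
Qed.

End CurveDerivatives.

(** * Geometric decay of tails *)

Section HalfDecay.
Variable R : realType.

(** By induction on [m] the bound [B / 2 ^+ m] holds on the whole tail from [m] on: a term from
    [m.+1] on has both its neighbours in the previous tail. *)
Lemma half_decay (f : nat -> R) (B : R) :
  (forall m, `|f m| <= B) ->
  (forall m M, `|f m| <= M -> `|f m.+1| <= M -> `|f m.+2| <= M -> `|f m.+1| <= M / 2) ->
  forall m, `|f m| <= B / 2 ^+ m.
Proof.
move=> fB fM m; suff : forall m j, (m <= j)%N -> `|f j| <= B / 2 ^+ m by move=> /(_ m m); apply.
elim=> {m} [|m IH] j mj; first by rewrite expr0 divr1.
case: j mj => // j mj; rewrite exprSr invfM mulrA; apply: fM; apply: IH; lia.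
Qed.

Lemma cvg_of_half_decay (f : nat -> R) (z B : R) (j : nat) :
  (forall m, `|f (j + m)%N - z| <= B / 2 ^+ m) -> f @ \oo --> z.
Proof.
move=> fB; apply/cvgrPdist_le => eps eps0.
have B0 : 0 <= B by have := le_trans (normr_ge0 _) (fB 0%N); rewrite expr0 divr1.
pose N := (Num.truncn (B / eps)).+1.
have NB : B / eps < N%:R by rewrite /N truncnS_gt.
near=> n; have jn : (j + N <= n)%N by near: n; exact: nbhs_infty_ge.
have -> : n = (j + (n - j))%N by lia.
rewrite distrC; apply: le_trans (fB _) _.
rewrite ler_pdivrMr ?exprn_gt0// mulrC -ler_pdivrMr// ltW// (lt_le_trans NB)//.
have -> : (2 : R) ^+ (n - j) = (2 ^ (n - j))%N%:R by rewrite natrX.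
rewrite ler_nat (leq_trans _ (ltnW (ltn_expl (n - j) (ltnSn 1))))//; lia.
Unshelve. all: by end_near.
Qed.

End HalfDecay.

(** * Chains as heteroclinic orbits *)

Section Orbits.
Variables (R : realType) (e : R).
Hypotheses (e_gt0 : 0 < e) (e_small : e <= 1 / 1000).
Implicit Types (a b mu : R) (U : int -> R) (n : int).

Let epow := epow_gt0 e_gt0.
Arguments epow k%_N.
Let epowD := epowD_le e_gt0 e_small.
Arguments epowD (j k)%_N.

Lemma lattice_orbit mu U n :
  (U n, U (n + 1)) = lattice_map (- e ^+ 12) mu (U (n - 1), U n) <->
  lattice_eq e mu U n = 0.
Proof.
have en0 : e ^+ 12 != 0 by rewrite gt_eqF.
rewrite /lattice_map /lattice_eq /=; split=> [[->]|h].
  rewrite invrN; field.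
  exact: lt0r_neq0.
congr (_, _); rewrite invrN mulNr; apply: (mulfI en0); rewrite mulrBr mulVKf//.
by rewrite -[RHS]addr0 -h; ring.
Qed.

(** [U_plus mu] is the nested root with radicand [1 - mu]. The radicand of [U n] differs from this
    by the coupling applied to [U - U_plus mu], at most [4 * e ^+ 12 * M], whereas [root_lip]
    divides by a root of order at least [e ^+ 9]. *)
Lemma chain_right_decay a b U mu : in_rect e a b -> two_sided_sol e a b U mu mu ->
  forall m : nat, `|U (2 + m)%N%:Z - U_plus mu| <= 10 / 2 ^+ m.
Proof.
move=> ab sU; have [bU Um Up] := sU; have [_ muE] := two_sided_mu e_gt0 ab sU.
have m1 : 0 <= 1 - mu.
  by have := right_mu_le e_gt0 e_small ab bU; rewrite -muE; have := epow 18; clear - e_gt0 e_small epow epowD; lra.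
have z1 : 1 <= U_plus mu.
  by rewrite -sqrtr1 ler_sqrt ?lerDl ?addr_ge0 ?sqrtr_ge0.
have z2 : (U_plus mu) ^+ 2 = 1 + Num.sqrt (1 - mu).
  by rewrite sqr_sqrtr// addr_ge0// sqrtr_ge0.
have mu0 : 0 <= mu.
  have [-> _] := two_sided_mu e_gt0 ab sU; have := left_mu_ge e_gt0 e_small ab bU.
  by have := epow 12; clear - e_gt0 e_small epow epowD; lra.
have z3 : U_plus mu <= 2.
  rewrite -(ler_pXn2r (n := 2)) ?nnegrE ?(le_trans ler01 z1)// z2.
  have : Num.sqrt (1 - mu) <= 1.
    by rewrite -[leRHS]sqrtr1 ler_sqrt// gerBl.
  by clear - e_gt0 e_small epow epowD; lra.
apply: half_decay => [m|m M h0 h1 h2].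
  apply: le_trans (ler_normB _ _) _; rewrite (ger0_norm (le_trans ler01 z1)).
  by have := box_norm_le e_gt0 e_small (2 + m)%N%:Z ab bU; clear - z3 e_gt0 e_small epow epowD; lra.
set n : int := (2 + m.+1)%N%:Z in h1 *.
have n3 : 3 <= n by rewrite /n; int_lia.
have E1 : (2 + m)%N%:Z = n - 1 by rewrite /n; int_lia.
have E2 : (2 + m.+2)%N%:Z = n + 1 by rewrite /n; int_lia.
rewrite E1 in h0; rewrite E2 in h2.
have [x [x0 xr t1 tx]] := step_root e_gt0 e_small ab bU (or_intror n3).
rewrite (two_sided_step e_gt0 e_small ab sU) in t1 tx.
have := root_lip x0 (sqrtr_ge0 (1 - mu)) t1 z1 tx z2 xr (sqr_sqrtr m1).
have u0 : 0 < U n by exact: lt_le_trans t1.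
have -> : rad e b U n - (1 - mu) =
    e ^+ 12 * (2 * (U n - U_plus mu) - (U (n - 1) - U_plus mu) - (U (n + 1) - U_plus mu)) / U n.
  rewrite muE /rad /right_mu; have un0 : U n != 0 by rewrite gt_eqF.
  have bn0 : b != 0 by have [_ b0] := in_rect_gt0 e_gt0 ab; rewrite gt_eqF.
  by field; rewrite un0 bn0.
have M0 := le_trans (normr_ge0 _) h1.
have num : `|2 * (U n - U_plus mu) - (U (n - 1) - U_plus mu) - (U (n + 1) - U_plus mu)| <= 4 * M.
  move: h0 h1 h2; rewrite !ler_norml => /andP[p1 p2] /andP[q1 q2] /andP[r1 r2].
  by apply/andP; split; clear - p1 p2 q1 q2 r1 r2 e_gt0 e_small epow epowD; lra.
move: num; set w := 2 * _ - _ - _ => num.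
rewrite normrM (normrM _ w) (ger0_norm (ltW (epow 12))) normfV (gtr0_norm u0).
have : e ^+ 12 * `|w| / U n <= e ^+ 12 * (4 * M).
  rewrite ler_pdivrMr// -[leRHS]mulrA ler_pM2l ?epow//; apply: le_trans num _.
  by rewrite ler_peMr// mulr_ge0.
move=> H /le_trans/(_ H) {H} H.
have xe : e ^+ 9 / 3 <= x.
  apply: ler_of_sqr => //; rewrite xr.
  have := box_rad_ge e_gt0 e_small ab bU n3; have := sqr_ge0 `|1 - b ^+ 2|.
  rewrite expr_div_n -exprM; have := epow 18; move: (rad e b U n) => r.
  by clear - e_gt0 e_small epow epowD; lra.
have e93 := epowD 9 3; have e9 := epow 9.
have : 2 * (e ^+ 9 / 3) * `|U n - U_plus mu| <= e ^+ 9 * (M / 100).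
  apply: le_trans (le_trans _ H) _; first by rewrite ler_wpM2r// ler_pM2l.
  have := ler_wpM2r M0 e93; clear - e9 M0 e_gt0 e_small epow epowD; move: (e ^+ 12) => u.
  have : 0 <= e ^+ 9 * M by apply: mulr_ge0 => //; exact: ltW.
  by move: (e ^+ 9) => v; lra.
rewrite (_ : 2 * (e ^+ 9 / 3) * _ = e ^+ 9 * (2 / 3 * `|U n - U_plus mu|)); last by ring.
by rewrite ler_pM2l//; clear - M0 e_gt0 e_small epow epowD; lra.
Qed.

(** The quotient of [e ^+ 12] by [den >= e ^+ 8 / 2] makes each site small against its
    neighbours. *)
Lemma chain_left_decay a b U mu : in_rect e a b -> two_sided_sol e a b U mu mu ->
  forall m : nat, `|U (- m%:Z)| <= 1 / 2 ^+ m.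
Proof.
move=> ab sU; have [bU Um Up] := sU; have [a0 _] := in_rect_gt0 e_gt0 ab.
have [/andP[a1 a2] _] := ab.
apply: (half_decay (f := fun m : nat => U (- m%:Z))) => [m|m M h0 h1 h2].
  by apply: le_trans (box_left e_gt0 e_small ab bU _) a2; lia.
set n : int := - m.+1%:Z in h1 *.
have n0 : n < 0 by rewrite /n; int_lia.
have E1 : - m%:Z = n + 1 by rewrite /n; int_lia.
have E2 : - m.+2%:Z = n - 1 by rewrite /n; int_lia.
rewrite E1 in h0; rewrite E2 in h2.
have := step_left e_gt0 e_small ab bU n0; rewrite (two_sided_step e_gt0 e_small ab sU).
have den1 := box_den_ge e_gt0 e_small ab bU n0; have den2 := floor_ge e_gt0 a0.
have den3 := le_trans den2 den1.
have M0 := le_trans (normr_ge0 _) h1.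
move=> /(congr1 Num.norm); rewrite !normrM normrN (ger0_norm (ltW (epow 12))).
have e8 := epow 8; have den0 : 0 < den e a U n by apply: lt_le_trans den3; rewrite divr_gt0.
rewrite (gtr0_norm den0) => H.
have : `|U n| * (e ^+ 8 / 2) <= e ^+ 8 * (M / 100).
  apply: le_trans (ler_wpM2l (normr_ge0 _) den3) _; rewrite H.
  have s2 : `|U (n - 1) + U (n + 1)| <= 2 * M.
    by apply: le_trans (ler_normD _ _) _; clear - h0 h2 e_gt0 e_small epow epowD; lra.
  apply: le_trans (ler_wpM2l (ltW (epow 12)) s2) _.
  have := ler_wpM2r M0 (epowD 8 4); have : 0 <= e ^+ 8 * M by apply: mulr_ge0 => //; exact: ltW.
  by clear - e_gt0 e_small epow epowD; move: (e ^+ (8 + 4)) (e ^+ 8) => u v; lra.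
rewrite mulrC -mulrA ler_pM2l//; clear - M0 e_gt0 e_small epow epowD; lra.
Qed.

Lemma chain_heteroclinic a b U mu (u : ellinf R) :
  in_rect e a b -> two_sided_sol e a b U mu mu ->
  (forall n, u n = (U (n - 1), U n)) -> is_heteroclinic (- e ^+ 12) mu u.
Proof.
move=> ab sU uE; have [_ Um Up] := sU; split.
- move=> n; rewrite !uE addrK; apply/lattice_orbit.
  by have [n0|n0] := leP n 0; [exact: Um|apply: Up; lia].
- have -> : (fun n : nat => u (- n%:Z)) = (fun n : nat => (U (- n.+1%:Z), U (- n%:Z))).
    by apply/funext => n; rewrite uE; congr (U _, _); lia.
  have L := chain_left_decay ab sU.
  apply: (@cvg_pair _ _ _ _ (nbhs (0 : R)) (nbhs (0 : R)));
    apply: (@cvg_of_half_decay _ _ _ 1 0) => m; rewrite add0n subr0//.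
  by apply: le_trans (L m.+1) _; rewrite ler_wpM2l// lef_pV2 ?posrE ?exprn_gt0// ler_weXn2l// ler1n.
have -> : (fun n : nat => u n%:Z) = (fun n : nat => (U (n%:Z - 1), U n%:Z)).
  by apply/funext => n; rewrite uE.
have L := chain_right_decay ab sU.
(* The first component lags by one site, hence the start at 3 instead of 2. *)
apply: (@cvg_pair _ _ _ _ (nbhs (U_plus mu)) (nbhs (U_plus mu))); first apply: (@cvg_of_half_decay _ _ _ 10 3) => m.
  by have := L m; rewrite (_ : (3 + m)%N%:Z - 1 = (2 + m)%N%:Z)//; lia.
exact: (@cvg_of_half_decay _ _ _ 10 2).
Qed.

End Orbits.

(** * Polar angles on the unit circle *)

Section PolarCoordinates.
Variable R : realType.

Lemma polar_angle (c s : R) : c ^+ 2 + s ^+ 2 = 1 ->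
  exists2 t, 0 <= t <= 1 & cos (2 * pi * t) = c /\ sin (2 * pi * t) = s.
Proof.
move=> cs; have /andP[c1 c2] : -1 <= c <= 1.
  by have [] := unit_le1 cs; rewrite ler_norml.
have cin : c \in `[(-1), 1] by rewrite in_itv/= c1.
have pi0 := pi_gt0 R; have pin0 : 2 * pi != 0 :> R by rewrite mulf_neq0// gt_eqF.
have x0 := acos_ge0 (introT andP (conj c1 c2)).
have xpi := acos_lepi (introT andP (conj c1 c2)).
have sx : sin (acos c) = `|s|.
  by rewrite sin_acos ?c1// -cs addrAC subrr add0r sqrtr_sqr.
have pi2 : 0 < 2 * pi :> R by rewrite mulr_gt0.
have y0 : 0 <= acos c / (2 * pi) by rewrite divr_ge0// ltW.
have y1 : acos c / (2 * pi) <= 1 by rewrite ler_pdivrMr//; move: xpi pi0; lra.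
have [s0|s0] := leP 0 s.
  exists (acos c / (2 * pi)); last first.
    by rewrite mulrC divfK// acosK// sx ger0_norm.
  by apply/andP; split; [exact: y0|exact: y1].
exists (1 - acos c / (2 * pi)); last first.
  rewrite mulrBr mulr1 [X in _ - X]mulrC divfK//.
  have -> : 2 * pi - acos c = - acos c + pi *+ 2 :> R by rewrite addrC mulr_natl.
  by rewrite (cosD (- _)) (sinD (- _)) cos2pi sin2pi cosN sinN !mulr1 !mulr0 subr0 addr0 acosK// sx ltr0_norm// opprK.
by apply/andP; split; lra.
Qed.

(** For [y < x] half the difference of the angles, [pi * (x - y)], lies strictly between 0 and [pi],
    where the sine is positive; equal points on the circle give its double cosine 1, so its sine
    vanishes. *)
Lemma polar_angle_inj (x y : R) : 0 <= x < 1 -> 0 <= y < 1 ->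
  cos (2 * pi * x) = cos (2 * pi * y) -> sin (2 * pi * x) = sin (2 * pi * y) -> x = y.
Proof.
have pi0 := pi_gt0 R; wlog xy : x y / y <= x.
  by move=> W x01 y01 hc hs; have [/W|/ltW/W] := leP y x; [|move=> h; apply/esym; move: h]; apply.
move=> /andP[x0 x1] /andP[y0 y1] hc hs; apply/eqP; rewrite -subr_eq0; apply/negPn/negP => xyn0.
have z0 : 0 < pi * (x - y) < pi.
  have h : 0 < x - y by rewrite lt_neqAle eq_sym xyn0 subr_ge0.
  by rewrite mulr_gt0//= gtr_pMr//; lra.
have := sin_gt0_pi z0; have : cos ((pi * (x - y)) *+ 2) = 1.
  have -> : (pi * (x - y)) *+ 2 = 2 * pi * x - 2 * pi * y by rewrite -mulr_natl; ring.
  by rewrite cosB hc hs -!expr2 cos2Dsin2.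
rewrite cos_mulr2n => h; have : sin (pi * (x - y)) ^+ 2 = 0.
  by rewrite sin2cos2; move: h; rewrite -mulr_natl; lra.
by move/eqP; rewrite sqrf_eq0 => /eqP ->; rewrite ltxx.
Qed.

End PolarCoordinates.

(** * The loop as a connected component of the set of connections *)

Section Loop.
Variables (R : realType) (e : R).
Hypotheses (e_gt0 : 0 < e) (e_small : e <= 1 / 1000).
Implicit Types (a b mu t : R) (U : int -> R) (n : int).

Let epow := epow_gt0 e_gt0.
Arguments epow k%_N.
Let epowD := epowD_le e_gt0 e_small.
Arguments epowD (j k)%_N.

(** In polar coordinates about the centre the gap vanishes at the radius [rho], and the sign pattern
    on the ray leaves no zero other than [radius e t]. *)
Lemma sol_on_loop a b U mu : in_rect e a b -> two_sided_sol e a b U mu mu ->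
  exists2 t, 0 <= t <= 1 & U = loop_chain e t /\ mu = loop_mu e t.
Proof.
move=> ab sU; have [UE muE muE'] := sol_chain e_gt0 e_small ab sU.
have gap0 : gap e a b = 0 by rewrite /gap -muE -muE' subrr.
have [ab0 gapc] := gap_centre e_gt0 e_small.
pose rho := Num.sqrt ((a - e ^+ 4) ^+ 2 + (b - 1) ^+ 2).
have sum0 : 0 <= (a - e ^+ 4) ^+ 2 + (b - 1) ^+ 2 by apply: addr_ge0; exact: sqr_ge0.
have rho2 : rho ^+ 2 = (a - e ^+ 4) ^+ 2 + (b - 1) ^+ 2 by exact: sqr_sqrtr.
have rho0 : 0 < rho.
  rewrite lt_neqAle sqrtr_ge0 andbT; apply/eqP => h.
  move: rho2; rewrite -h expr0n /= => /esym/eqP; rewrite paddr_eq0 ?sqr_ge0//.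
  rewrite !sqrf_eq0 !subr_eq0 => /andP[/eqP aE /eqP bE].
  by move: gapc; rewrite -aE -[X in gap e a X]bE gap0 ltxx.
have rhon0 : rho != 0 by rewrite gt_eqF.
have cs : ((a - e ^+ 4) / rho) ^+ 2 + ((b - 1) / rho) ^+ 2 = 1.
  by rewrite !expr_div_n -mulrDl -rho2 divff// expf_neq0.
have [t t01 [ct st]] := polar_angle cs; exists t => //.
(* The sign pattern is known up to the radius 2 only; the rectangle lies in that disc. *)
have rholt : rho <= 2.
  have [/andP[a1 a2] /andP[b1 b2]] := ab; have [a0 b0] := in_rect_gt0 e_gt0 ab.
  apply: ler_of_sqr => //; rewrite rho2; have := epowD 0 4; have := epow 4; rewrite expr0.
  by clear - a0 a2 b0 b2 e_gt0 e_small epow epowD; move: (e ^+ 4) => u u0 u1; nra.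
have aE : e ^+ 4 + rho * loop_cos t = a.
  by rewrite [loop_cos t]ct; field.
have bE : 1 + rho * loop_sin t = b by rewrite [loop_sin t]st; field.
have G0 : ray_gap_fun e (loop_cos t) (loop_sin t) rho = 0.
  by rewrite ray_gap_fun_in /ray_point aE bE.
have [/andP[r0 r2] _ below above] := radiusP e_gt0 e_small t.
have rE : radius e t = rho.
  apply/eqP; rewrite eq_le; apply/andP; split; rewrite leNgt; apply/negP => h.
    by have := below rho; rewrite (ltW rho0) h G0 ltxx => /(_ isT).
  by have := above rho; rewrite rholt h G0 ltxx => /(_ isT).
have UE' : chain e a b = loop_chain e t by rewrite /loop_chain /loop_a /loop_b rE aE bE.
by split; [rewrite UE|rewrite muE /loop_mu -UE' /loop_a rE aE].
Qed.

Definition loop_curve : R -> ellinf R * R :=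
  family_curve (loop_data_bounded e_gt0 e_small).

Lemma loop_curve_heteroclinic t : is_heteroclinic (- e ^+ 12) (loop_curve t).2 (loop_curve t).1.
Proof.
exact: (chain_heteroclinic e_gt0 e_small (loop_rect e_gt0 e_small t) (loop_sol e_gt0 e_small t)).
Qed.

Lemma orbit_lattice mu (u : ellinf R) : is_orbit (- e ^+ 12) mu u ->
  (forall n, u n = ((u (n - 1)).2, (u n).2)) /\
  forall n, lattice_eq e mu (fun k => (u k).2) n = 0.
Proof.
move=> uo; have u1 n : u n = ((u (n - 1)).2, (u n).2).
  rewrite [LHS]surjective_pairing; congr (_, _).
  by have := congr1 fst (uo (n - 1)); rewrite subrK.
split=> // n; apply/(lattice_orbit e_gt0); rewrite -u1 -uo.
by rewrite [RHS]u1 addrK.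
Qed.

(** The chain at [t] has the margin [e ^+ 16] in its box, and [(a, b)] is interior to the rectangle.
    An orbit close to it therefore lies in the box over its own [(a', b')], where [sol_on_loop]
    applies. The divisor 8 pays for the box moving along with [(a', b')]. *)
Lemma loop_curve_isolated t : exists eps : R, 0 < eps /\
  forall q, is_heteroclinic (- e ^+ 12) q.2 q.1 -> `|loop_curve t - q| < eps ->
  exists2 s, 0 <= s <= 1 & q = loop_curve s.
Proof.
have ab := loop_rect e_gt0 e_small t; have sU := loop_sol e_gt0 e_small t.
have [/andP[a1 a2] /andP[b1 b2]] := loop_interior e_gt0 e_small t.
have bU : box e (e ^+ 16) (loop_a e t) (loop_b e t) (loop_chain e t).
  have := step_box e_gt0 e_small ab (loop_box e_gt0 e_small t).
  by congr box; apply/funext => n; exact: (two_sided_step e_gt0 e_small ab sU).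
move: (loop_a e t) (loop_b e t) ab sU a1 a2 b1 b2 bU => a b ab sU a1 a2 b1 b2 bU.
pose m := Num.min (Num.min (a - e ^+ 12 / 2) (1 - a)) (Num.min (b - e ^+ 4 / 2) (3 / 2 - b)).
exists (Num.min m (e ^+ 16 / 8)).
split; first by rewrite !lt_min !subr_gt0 a1 a2 b1 b2 divr_gt0 ?epow.
move=> q [qo _ _]; set eps := `|_ - q|.
rewrite !lt_min => /andP[/andP[/andP[ma mb] /andP[mc md]] e16].
have [u1 Weq] := orbit_lattice qo; set W := (fun k => (q.1 k).2) in Weq.
have WU n : `|W n - loop_chain e t n| <= eps.
  rewrite distrC; have := sup_norm_ge ((loop_curve t).1 - q.1) n.
  have : sup_norm ((loop_curve t).1 - q.1) <= eps by rewrite /eps prod_normE le_max lexx.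
  move=> h1 /le_trans/(_ h1); rewrite (@pair_norm_le R R R) => /andP[_]; exact.
have [U0 U2 /andP[U11 U12] Um Up] := bU.
pose a' := - W 0; pose b' := W 2.
have aa : `|a' - a| <= eps.
  by have := WU 0; rewrite U0 opprK -normrN opprD.
have bb : `|b' - b| <= eps by have := WU 2; rewrite U2.
have eps0 : 0 <= eps := normr_ge0 _.
have ab' : in_rect e a' b'.
  move: aa bb; rewrite !ler_norml => /andP[p1 p2] /andP[r1 r2].
  by split; apply/andP; split; clear - p1 p2 r1 r2 ma mb mc md e_gt0 e_small epow epowD; lra.
have [/andP[a1' a2'] /andP[b1' b2']] := ab'.
have [a0 b0] := in_rect_gt0 e_gt0 ab; have [a0' b0'] := in_rect_gt0 e_gt0 ab'.
have ebW : `|1 - b ^+ 2| <= `|1 - b' ^+ 2| + 3 * eps.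
  rewrite -lerBlDl; apply: le_trans (lerB_dist _ _) _.
  rewrite (_ : _ - _ = (b' - b) * (b' + b)); last by ring.
  rewrite normrM mulrC; apply: ler_pM => //.
  by rewrite gtr0_norm ?addr_gt0//; clear - b2 b2' e_gt0 e_small epow epowD; lra.
have bW : box e 0 a' b' W.
  split.
  - by rewrite opprK.
  - by [].
  - have := WU 1; rewrite ler_norml => /andP[p1 p2].
    by apply/andP; split; clear - p1 p2 U11 U12 ebW e16 eps0 e_gt0 e_small epow epowD; lra.
  - move=> n n0; have := Um n n0; have := WU n; rewrite subr0 => h1 h2.
    have h3 : `|W n| <= `|loop_chain e t n| + eps.
      by rewrite -lerBlDl; apply: le_trans (lerB_dist _ _) h1.
    have h4 : e ^+ 3 * (a - a') <= 1 * eps.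
      apply: le_trans (_ : e ^+ 3 * eps <= _).
        rewrite ler_pM2l ?epow//; apply: le_trans (ler_norm _) _; by rewrite distrC.
      rewrite ler_wpM2r//; have := epowD 0 3; rewrite expr0.
      by clear - e_gt0 e_small epow epowD; lra.
    by clear - h2 h3 h4 e16 eps0 e_gt0 e_small epow epowD; lra.
  move=> n n3; have /andP[h1 h2] := Up n n3.
  have := WU n; rewrite ler_norml => /andP[p1 p2].
  by apply/andP; split; clear - p1 p2 h1 h2 ebW e16 eps0 e_gt0 e_small epow epowD; lra.
have sW : two_sided_sol e a' b' W q.2 q.2 by split.
have [s s01 [WE muE]] := sol_on_loop ab' sW; exists s => //.
rewrite [LHS]surjective_pairing [RHS]surjective_pairing; congr (_, _); last exact: muE.
apply/val_inj/funext => n; rewrite /= [LHS]u1.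
by rewrite -[(q.1 (n - 1)).2]/(W (n - 1)) -[(q.1 n).2]/(W n) WE.
Qed.

Lemma smooth_loop_curve k s : derivable (loop_curve^`(k)%classic) s 1.
Proof. by apply: smooth_family_curve => j; exact: smooth_loop_data. Qed.

Lemma loop_curve_continuous : continuous loop_curve.
Proof.
move=> s; apply: differentiable_continuous; apply/derivable1_diffP.
exact: (@smooth_loop_curve 0%N s).
Qed.

Lemma loop_curve10 : loop_curve 1 = loop_curve 0.
Proof.
have hc : loop_cos (1 : R) = loop_cos 0.
  by rewrite /loop_cos mulr1 mulr0 cos0 mulr_natl cos2pi.
have hs : loop_sin (1 : R) = loop_sin 0.
  by rewrite /loop_sin mulr1 mulr0 sin0 mulr_natl sin2pi.
have rE : radius e 1 = radius e 0 by rewrite /radius hc hs.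
have aE : loop_a e 1 = loop_a e 0 by rewrite /loop_a rE hc.
have bE : loop_b e 1 = loop_b e 0 by rewrite /loop_b rE hs.
have cE : loop_chain e 1 = loop_chain e 0 by rewrite /loop_chain aE bE.
have mE : loop_mu e 1 = loop_mu e 0 by rewrite /loop_mu cE aE.
congr (_, _); last exact: mE.
by apply/val_inj/funext => n; rewrite /= cE.
Qed.

(** On the loop [a < 1], so site 1 is the first site with a value of at least 1; a shift relating
    two points of the loop is therefore trivial. Then [a] and [b] agree, and they determine radius
    and angle. *)
Lemma loop_curve_shift_inj s t : 0 <= s < 1 -> 0 <= t < 1 ->
  shift_proj (loop_curve s) = shift_proj (loop_curve t) -> s = t.
Proof.
move=> s01 t01 [st _].
have [k kE] : shift_class (loop_curve s).1 (loop_curve t).1.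
  by rewrite st; exists 0; apply/val_inj/funext => n; rewrite /= addr0.
have chE n : loop_chain e t n = loop_chain e s (n + k).
  by rewrite -[LHS]/((loop_curve t).1 n).2 -kE.
have first r n : 1 <= loop_chain e r n -> 1 <= n.
  move=> h; rewrite leNgt; apply/negP => n1; have n0 : n <= 0 by int_lia.
  have := box_left e_gt0 e_small (loop_rect e_gt0 e_small r) (loop_box e_gt0 e_small r) n0.
  have [/andP[_ a1] _] := loop_interior e_gt0 e_small r.
  by have := ler_norm (loop_chain e r n); clear - h a1 e_gt0 e_small epow epowD; lra.
have ge1 r : 1 <= loop_chain e r 1.
  by have /andP[] := box_ge1 e_gt0 e_small (loop_rect e_gt0 e_small r) (loop_box e_gt0 e_small r) (or_introl erefl).
have k0 : k = 0.
  have h1 : 1 <= 1 + k by apply: (@first s); rewrite -chE.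
  have h2 : 1 <= 1 - k by apply: (@first t); rewrite chE subrK.
  by int_lia.
have {}chE n : loop_chain e t n = loop_chain e s n by rewrite chE k0 addr0.
have [Us0 Us2 _ _ _] := loop_box e_gt0 e_small s; have [Ut0 Ut2 _ _ _] := loop_box e_gt0 e_small t.
have aE : radius e t * loop_cos t = radius e s * loop_cos s.
  by apply: (addrI (e ^+ 4)); apply: oppr_inj; rewrite -/(loop_a e t) -/(loop_a e s) -Us0 -Ut0.
have bE : radius e t * loop_sin t = radius e s * loop_sin s.
  by apply: (addrI 1); rewrite -/(loop_b e t) -/(loop_b e s) -Us2 -Ut2.
have /andP[rs0 _] := radius_bounds e_gt0 e_small s.
have /andP[rt0 _] := radius_bounds e_gt0 e_small t.
have r2 r : (radius e r * loop_cos r) ^+ 2 + (radius e r * loop_sin r) ^+ 2 = radius e r ^+ 2.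
  by rewrite !exprMn -mulrDr loop_unit mulr1.
have rE : radius e t = radius e s.
  apply/eqP; rewrite -(eqrXn2 (n := 2)) ?(ltW rs0) ?(ltW rt0)//.
  by rewrite -!r2 aE bE.
rewrite rE in aE bE; have rn0 : radius e s != 0 by rewrite gt_eqF.
apply: polar_angle_inj => //; apply/esym; [exact: (mulfI rn0 aE)|exact: (mulfI rn0 bE)].
Qed.

(** The curve is compact, hence closed, and relatively open by [loop_curve_isolated]; so it contains
    every connected set of connections through its starting point. *)
Lemma loop_component :
  is_connected_component (heteroclinic_set (- e ^+ 12) (e ^+ 12 / 2) (1 - e ^+ 18 / 8))
    (loop_curve @` `[0, 1]).
Proof.
set H := heteroclinic_set _ _ _; set G := _ @` _.
have GH : G `<=` H.
  move=> _ [t _ <-]; split; last exact: loop_curve_heteroclinic.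
  by rewrite in_itv/=; exact: loop_mu_bounds.
have G0 : G (loop_curve 0) by exists 0 => //=; rewrite in_itv/= lexx ler01.
have cG : {within `[0, 1], continuous loop_curve}.
  by apply: continuous_subspaceT; exact: loop_curve_continuous.
exists (loop_curve 0); first exact: GH.
apply/seteqP; split.
  apply: connected_component_max => //.
  by apply: connected_continuous_connected cG; exact: segment_connected.
move=> p [B [B0 BH Bc] Bp]; suff BG : B `&` G = B by move: Bp; rewrite -BG => -[].
apply: Bc.
- by exists (loop_curve 0); split.
- have [eps epsP] := choice (fun t => loop_curve_isolated t).
  exists (\bigcup_(t in `[0, 1]) ball (loop_curve t) (eps t)).
    by apply: bigcup_open => t _; exact: ball_open.
  apply/seteqP; split=> q [Bq].
    move=> [t t01 tq]; split=> //; exists t => //; rewrite -tq.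
    by apply: ballxx; have [] := epsP t.
  move=> [t _ tq]; split=> //; have [_ /(_ q)] := epsP t; case.
  - by have [_] := BH _ Bq.
  - by move: tq; rewrite -ball_normE.
  by move=> s s01 ->; exists s => //; rewrite /= in_itv/=.
exists G => //; apply: compact_closed; first exact: norm_hausdorff.
by apply: continuous_compact cG _; exact: segment_compact.
Qed.

End Loop.

Theorem proposition5p5 (R : realType) :
  exists2 dss : R, 0 < dss & forall d : R, - dss <= d < 0 -> has_0_loop d.
Proof.
exists ((1 / 1000) ^+ 12) => [|d /andP[d1 d2]]; first by rewrite exprn_gt0// divr_gt0.
have dn0 : 0 < - d by rewrite oppr_gt0.
(* The positive twelfth root of [- d]. *)
pose e : R := expR (12%:R^-1 * ln (- d)).
have e0 : 0 < e by exact: expR_gt0.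
have eE : e ^+ 12 = - d by rewrite -expRM_natl mulrA divff ?mul1r ?lnK// pnatr_eq0.
have e1 : e <= 1 / 1000.
  rewrite -(ler_pXn2r (n := 12)) ?nnegrE ?(ltW e0)//; last by rewrite divr_ge0.
  by rewrite eE; lra.
have dE : d = - e ^+ 12 by rewrite eE opprK.
rewrite dE; move: e e0 e1 {eE dE} => e e0 e1.
have e12 := epow_gt0 e0 12; have e18 := epow_gt0 e0 18.
have := epowD_le e0 e1 0 12; have := epowD_le e0 e1 0 18; rewrite expr0 => p18 p12.
(* The ends of [J] are the bounds of [loop_mu_bounds] on the parameter along the loop. *)
exists (e ^+ 12 / 2), (1 - e ^+ 18 / 8), (loop_curve e0 e1 @` `[0, 1]),
  (fun t => shift_proj (loop_curve e0 e1 t)), (loop_curve e0 e1); split.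
- by split; clear - e12 e18 p12 p18; lra.
- exact: loop_component.
- split=> [||s t]; [by rewrite image_comp|by rewrite loop_curve10|].
  by rewrite !in_itv /=; exact: loop_curve_shift_inj.
- split=> [|s s01|//]; last by exists s.
  by exists (loop_curve e0 e1) => // k s; exact: smooth_loop_curve.
by rewrite loop_curve10.
Qed.
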